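(* Let $k_0$ be an algebraically closed field, let $k\supseteq k_0$ be a field of characteristic zero, and let $A=\bar B\otimes H\otimes B$ be a graded $k$-algebra with triangular decomposition and inner grading (as specified in the context). Let $\mathcal{O}$ be the category $\mathcal O$ of $A$. Then $\mathcal{O}$ is a highest weight category (in the sense of Cline–Parshall–Scott), with standard objects $\Delta(E)$ and costandard objects $\nabla(E)$ for $E\in\mathrm{Irr}(H)$, with respect to the relation: $E<F$ if $c_F-c_E$ is a positive integer.
   Context: Setting. $A$ is a graded $k$-algebra with graded subalgebras $B,\bar B,H$ such that: $A=\bar B\otimes H\otimes B$ as $k$-modules (via multiplication); $B\otimes H=H\otimes B$ and $H\otimes\bar B=\bar B\otimes H$ inside $A$ (so $BH:=B\otimes H$ and $\bar BH:=\bar B\otimes H$ are subalgebras); $B=\bigoplus_{i\le 0}B_i$, $\bar B=\bigoplus_{i\ge 0}\bar B_i$, $B_0=\bar B_0=k$, $H\subset A_0$; $H=k\otimes_{k_0}H(k_0)$ with $H(k_0)$ a finite-dimensional semisimple split $k_0$-algebra; there is $\partial\in A_0$ with $A_i=\{u\in A\mid \partial u-u\partial=iu\}$ for all $i$. Put $B^i=B_{-i}$. One has $\partial=\partial'-\partial_0$ with $\partial'\in\bar B\otimes H\otimes B^{>0}$ and $\partial_0\in Z(H)$. For a simple $H$-module $E$, $c_E\in k$ is the scalar by which $\partial_0$ acts on $E$. $\mathrm{Irr}(H)$ is the set of isomorphism classes of simple $H$-modules. Category $\mathcal O$. For an $A$-module $M$ and $\alpha\in k$ put $\mathcal W_\alpha(M)=\{m\in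 M\mid(\partial-\alpha)^nm=0\text{ for }n\gg0\}$. $\mathcal O$ is the full subcategory of $A$-modules $M$ such that for each $m\in M$ there is $n$ with $B^{>n}m=0$, and $M=\sum_\alpha\mathcal W_\alpha(M)$ with every $\mathcal W_\alpha(M)$ finitely generated over $k$. Standard and costandard objects. $\Delta(E)=A\otimes_{BH}E$, where $B^{>0}$ acts by $0$ on $E$. $\nabla(E)=\bigoplus_i\mathrm{Homgr}^i_{\bar BH}(A,E)$ (sum of the spaces of graded maps of degree $i$), where $\bar B_{>0}$ acts by $0$ on $E$; equivalently the submodule of elements of $\mathrm{Hom}_{\bar BH}(A,E)$ that are locally finite for $B$. $\Delta(E)$ has a unique simple quotient $L(E)$, which is the unique simple submodule of $\nabla(E)$. Highest weight category: the simple objects $L(E)$ are indexed by the poset; all composition factors $L(F)$ of $\nabla(E)/L(E)$ satisfy $F<E$ (with finite multiplicities); each $L(E)$ has an injective hull $I(E)$ with a finite filtration starting with $\nabla(E)$ and with the other subquotients of the form $\nabla(F)$, $F>E$; dually, the projective cover $P(E)$ is filtered by standard objects with top $\Delta(E)$ and other subquotients $\Delta(F)$, $F>E$. *)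

(* Defs.v *)
From HB Require Import structures.
From mathcomp Require Import all_boot all_order all_algebra all_field.
From mathcomp Require Import mathcomp_extra boolp classical_sets functions cardinality.
From mathcomp Require Import finmap monalg.

Set Implicit Arguments.
Unset Strict Implicit.
Unset Printing Implicit Defensive.

Import GRing.Theory.
Local Open Scope ring_scope.

Section SubAlg.
Variables (k : fieldType) (A : algType k) (S : subalgClosed A).
Record sub_alg := SubAlg { sub_alg_val :> A; _ : sub_alg_val \in S }.
HB.instance Definition _ := [isSub for sub_alg_val].
HB.instance Definition _ := [Choice of sub_alg by <:].
HB.instance Definition _ := [SubChoice_isSubAlgebra of sub_alg by <:].
End SubAlg.

Section SubMod.
Variables (R : nzRingType) (M : lmodType R) (N : submodClosed M).
Record sub_mod := SubMod { sub_mod_val :> M; _ : sub_mod_val \in N }.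
HB.instance Definition _ := [isSub for sub_mod_val].
HB.instance Definition _ := [Choice of sub_mod by <:].
HB.instance Definition _ := [SubChoice_isSubLmodule of sub_mod by <:].
End SubMod.

Section QuotMod.
Local Open Scope quotient_scope.
Variables (R : nzRingType) (M : lmodType R) (N : submodClosed M).

Definition submod_pred : {pred M} := [pred x | x \in N].
Lemma submod_pred_zmod : zmod_closed submod_pred.
Proof. exact: (GRing.submod_closedB (submodClosedP N)). Qed.
HB.instance Definition _ := GRing.isZmodClosed.Build M submod_pred submod_pred_zmod.

Definition quot_mod := Quotient.quot submod_pred.
HB.instance Definition _ := GRing.Zmodule.on quot_mod.

Definition quot_proj (x : M) : quot_mod := \pi_(Quotient.quot submod_pred) x.

Definition quot_scale (a : R) (x : quot_mod) : quot_mod :=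
  quot_proj (a *: repr x).

Lemma quot_scaleE a (x : M) : quot_scale a (quot_proj x) = quot_proj (a *: x).
Proof.
apply/eqP; rewrite -Quotient.idealrBE -scalerBr.
suff: repr (quot_proj x) - x \in submod_pred by exact: rpredZ.
by rewrite Quotient.idealrBE reprK.
Qed.

Lemma quot_projK (x : quot_mod) : quot_proj (repr x) = x.
Proof. exact: reprK. Qed.
Lemma quot_projD x y : quot_proj (x + y) = quot_proj x + quot_proj y.
Proof. exact: Quotient.pi_add. Qed.
Lemma quot_scaleA a b x : quot_scale a (quot_scale b x) = quot_scale (a * b) x.
Proof. by rewrite -[x]quot_projK !quot_scaleE scalerA. Qed.
Lemma quot_scale1 : left_id 1 quot_scale.
Proof. by move=> x; rewrite -[x]quot_projK quot_scaleE scale1r. Qed.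
Lemma quot_scaleDr : right_distributive quot_scale +%R.
Proof.
move=> a x y; rewrite -[x]quot_projK -[y]quot_projK.
by rewrite -quot_projD !quot_scaleE scalerDr quot_projD.
Qed.
Lemma quot_scaleDl x : {morph quot_scale^~ x : a b / a + b}.
Proof.
by move=> a b; rewrite -[x]quot_projK !quot_scaleE scalerDl quot_projD.
Qed.
HB.instance Definition _ := GRing.Zmodule_isLmodule.Build R quot_mod
  quot_scaleA quot_scale1 quot_scaleDr quot_scaleDl.
End QuotMod.

Section FinSum.
Variable V : zmodType.
Implicit Types (P : V -> Prop) (x y : V).

Definition fin_sum P x :=
  exists s : seq V, (forall y, y \in s -> P y) /\ x = \sum_(y <- s) y.

Lemma fin_sum0 P : fin_sum P 0.
Proof. by exists [::]; rewrite big_nil. Qed.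
Lemma fin_sum1 P x : P x -> fin_sum P x.
Proof. by move=> Px; exists [:: x]; rewrite big_seq1; split=> // y /[!inE]/eqP->. Qed.
Lemma fin_sumD P x y : fin_sum P x -> fin_sum P y -> fin_sum P (x + y).
Proof.
move=> [s [Ps ->]] [t [Pt ->]]; exists (s ++ t); rewrite big_cat.
by split=> // z; rewrite mem_cat => /orP[/Ps|/Pt].
Qed.
End FinSum.

Lemma fin_sum_map (V W : zmodType) (P : V -> Prop) (Q : W -> Prop) (f : V -> W) :
    f 0 = 0 -> {morph f : x y / x + y} -> (forall x, P x -> fin_sum Q (f x)) ->
  forall x, fin_sum P x -> fin_sum Q (f x).
Proof.
move=> f0 fD PQ x [s [Ps ->]]; elim: s Ps => [|y s IHs] Ps.
  by rewrite big_nil f0; apply: fin_sum0.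
rewrite big_cons fD; apply: fin_sumD; first by apply/PQ/Ps/mem_head.
by apply: IHs => z sz; apply: Ps; rewrite inE sz orbT.
Qed.

Section Span.
Variables (R : nzRingType) (M : lmodType R) (S : M -> Prop).
Definition span_mod : {pred M} :=
  [pred x | `[< fin_sum (fun y => exists a z, S z /\ y = a *: z) x >]].
Lemma span_mod_submod : submod_closed span_mod.
Proof.
split; first by apply/asboolP/fin_sum0.
move=> a x y /asboolP xS /asboolP yS; apply/asboolP/fin_sumD => //.
move: x xS; apply: fin_sum_map => [|x y1|x [b [z [Sz ->]]]].
- by rewrite scaler0.
- by rewrite scalerDr.
by apply: fin_sum1; exists (a * b), z; rewrite scalerA.
Qed.
HB.instance Definition _ := GRing.isSubmodClosed.Build R M span_mod
  (GRing.submod_closed_semi span_mod_submod).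
End Span.

Section Image.
Variables (R : nzRingType) (M N : lmodType R) (f : {linear M -> N}).
Definition image_mod : {pred N} := [pred y | `[< exists x, f x = y >]].
Lemma image_mod_submod : submod_closed image_mod.
Proof.
split; first by apply/asboolP; exists 0; rewrite linear0.
move=> a x y /asboolP[u <-] /asboolP[v <-]; apply/asboolP.
by exists (a *: u + v); rewrite linearP.
Qed.
HB.instance Definition _ := GRing.isSubmodClosed.Build R N image_mod
  (GRing.submod_closed_semi image_mod_submod).
End Image.

Section Modules.
Variable R : nzRingType.
Implicit Types M N S X : lmodType R.

Definition surj (U V : Type) (f : U -> V) := forall y, exists x, f x = y.

Definition mod_iso M N := exists f : {linear M -> N}, bijective f.

Definition simple_mod M :=
  (exists x : M, x != 0) /\
  forall N : submodClosed M, (forall x, x \in N -> x = 0) \/ (forall x, x \in N).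

Definition semisimple_mod M :=
  forall N : submodClosed M, exists N' : submodClosed M,
    (forall x, x \in N -> x \in N' -> x = 0) /\
    (forall x, exists y z, [/\ y \in N, z \in N' & x = y + z]).

(* N1 is contained in N2 and N2 / N1 is isomorphic to X *)
Definition subquotient M (N1 N2 : submodClosed M) X :=
  {subset N1 <= N2} /\
  exists f : {linear sub_mod N2 -> X},
    surj f /\ forall y : sub_mod N2, f y = 0 <-> (y : M) \in N1.

Definition composition_factor M S :=
  simple_mod S /\ exists N1 N2 : submodClosed M, subquotient N1 N2 S.

Definition filtration M n (F : nat -> submodClosed M) :=
  [/\ forall x, x \in F 0%N -> x = 0,
      forall x, x \in F n
    & forall i, (i < n)%N -> {subset F i <= F i.+1}].

Definition finite_length M :=
  exists n (F : nat -> submodClosed M), filtration n F /\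
    forall i, (i < n)%N -> exists2 S, simple_mod S & subquotient (F i) (F i.+1) S.

(* the number of factors S in a chain of submodules of M is bounded *)
Definition finite_multiplicity M S :=
  exists m, forall n (F : nat -> submodClosed M) (J : {set 'I_n}),
    (forall i, (i < n)%N -> {subset F i <= F i.+1}) ->
    (forall i : 'I_n, i \in J -> subquotient (F i) (F i.+1) S) -> (#|J| <= m)%N.

Definition unique_simple_quotient M S :=
  simple_mod S /\
  exists2 f : {linear M -> S}, surj f &
    forall S' (g : {linear M -> S'}), simple_mod S' -> surj g ->
      forall x, g x = 0 <-> f x = 0.

Definition unique_simple_submodule M S :=
  simple_mod S /\
  exists2 f : {linear S -> M}, injective f &
    forall S' (g : {linear S' -> M}), simple_mod S' -> injective g ->
      forall x, (exists y, g y = x) <-> (exists y, f y = x).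

(* S represents, without repetition, the isomorphism classes of simple
   modules in C *)
Definition simple_representatives (C : lmodType R -> Prop) (I : Type)
    (S : I -> lmodType R) :=
  [/\ forall i, C (S i) /\ simple_mod (S i),
      forall i j, mod_iso (S i) (S j) -> i = j
    & forall X, C X -> simple_mod X -> exists i, mod_iso X (S i)].

Section FullSubcategory.
Variable C : lmodType R -> Prop.

Definition injective_in X :=
  C X /\ forall (M N : lmodType R) (u : {linear M -> N}) (f : {linear M -> X}),
    C M -> C N -> injective u -> exists g : {linear N -> X}, forall x, g (u x) = f x.

Definition projective_in X :=
  C X /\ forall (M N : lmodType R) (p : {linear M -> N}) (f : {linear X -> N}),
    C M -> C N -> surj p -> exists g : {linear X -> M}, forall x, p (g x) = f x.

Definition injective_hull M X :=
  injective_in X /\ exists2 u : {linear M -> X}, injective u &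
    forall N (g : {linear X -> N}), C N -> injective (g \o u) -> injective g.

Definition projective_cover M X :=
  projective_in X /\ exists2 p : {linear X -> M}, surj p &
    forall N (g : {linear N -> X}), C N -> surj (p \o g) -> surj g.

(* C is an abelian subcategory of R-modules in which monomorphisms,
   epimorphisms, subobjects and quotients are those of R-modules *)
Record abelian_subcategory : Prop := {
  absub_zero : forall M, (forall x : M, x = 0) -> C M;
  absub_sum : forall M N, C M -> C N -> C (M * N)%type;
  absub_sub : forall M N (f : {linear M -> N}), injective f -> C N -> C M;
  absub_quot : forall M N (f : {linear M -> N}), surj f -> C M -> C N }.

(* Every object is the union of its subobjects of finite length; directed
   unions of subobjects, and their distributivity over intersections, come for
   free in a subcategory closed under submodules. *)
Definition locally_artinian :=
  forall M, C M -> forall x : M,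
    exists2 N : submodClosed M, x \in N & finite_length (sub_mod N).

Definition enough_injectives :=
  forall M, C M -> exists2 X, injective_in X &
    exists f : {linear M -> X}, injective f.

End FullSubcategory.
End Modules.

Section HighestWeight.
Variables (k : fieldType) (A : algType k).

Definition finite_dim_hom (M N : lmodType A) :=
  exists n (g : 'I_n -> {linear M -> N}), forall f : {linear M -> N},
    exists a : 'I_n -> k, forall x, f x = \sum_i (a i)%:A *: g i x.

Record highest_weight_category (C : lmodType A -> Prop) (Lam : Type)
    (lt : Lam -> Lam -> Prop) (L Delta Nabla : Lam -> lmodType A) : Prop := {
  hw_abelian : abelian_subcategory C;
  hw_artinian : locally_artinian C;
  hw_enough_injectives : enough_injectives C;
  hw_lt_irr : forall a, ~ lt a a;
  hw_lt_trans : forall a b c, lt a b -> lt b c -> lt a c;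
  hw_interval_finite : forall a b, finite_set [set c | lt a c /\ lt c b];
  hw_simple : simple_representatives C L;
  hw_standard : forall a, C (Delta a);
  hw_costandard : forall a, C (Nabla a);
  hw_head : forall a, unique_simple_quotient (Delta a) (L a);
  hw_socle : forall a, unique_simple_submodule (Nabla a) (L a);
  hw_factors : forall a, exists2 u : {linear L a -> Nabla a}, injective u &
    forall b, composition_factor (quot_mod (image_mod u)) (L b) -> lt b a;
  hw_mult : forall a b, finite_multiplicity (Nabla a) (L b);
  hw_hom : forall a b, finite_dim_hom (Nabla a) (Nabla b);
  hw_injective_hull : forall a, exists2 X, injective_hull C (L a) X &
    exists n (F : nat -> submodClosed X),
      [/\ filtration n.+1 F,
          subquotient (F 0%N) (F 1%N) (Nabla a)
        & forall i, (0 < i < n.+1)%N ->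
            exists2 b, lt a b & subquotient (F i) (F i.+1) (Nabla b)];
  hw_projective_cover : forall a, exists2 X, projective_cover C (L a) X &
    exists n (F : nat -> submodClosed X),
      [/\ filtration n.+1 F,
          subquotient (F n) (F n.+1) (Delta a)
        & forall i, (i < n)%N ->
            exists2 b, lt a b & subquotient (F i) (F i.+1) (Delta b)] }.
End HighestWeight.

Section Tensor.
Variables (k : fieldType) (A : algType k).

(* Multiplication X (x) Y (x) Z -> A is an isomorphism, i.e. A has the
   universal property of the tensor product over k. *)
Definition tensor3_mul_iso (X Y Z : subalgClosed A) :=
  forall (V : lmodType k) (phi : sub_alg X -> sub_alg Y -> sub_alg Z -> V),
    (forall y z, linear (fun x => phi x y z)) ->
    (forall x z, linear (fun y => phi x y z)) ->
    (forall x y, linear (fun z => phi x y z)) ->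
  exists2 f : {linear A -> V},
    (forall (x : sub_alg X) (y : sub_alg Y) (z : sub_alg Z),
       f ((x : A) * (y : A) * (z : A)) = phi x y z) &
    forall g : {linear A -> V},
      (forall (x : sub_alg X) (y : sub_alg Y) (z : sub_alg Z),
         g ((x : A) * (y : A) * (z : A)) = phi x y z) -> g =1 f.

(* Multiplication X (x) Y -> A is injective: every bilinear map on X x Y
   factors through it (linear maps extend from subspaces of A to A). *)
Definition tensor_mul_inj (X Y : subalgClosed A) :=
  forall (V : lmodType k) (phi : sub_alg X -> sub_alg Y -> V),
    (forall y, linear (fun x => phi x y)) ->
    (forall x, linear (fun y => phi x y)) ->
  exists f : {linear A -> V}, forall (x : sub_alg X) (y : sub_alg Y),
    f ((x : A) * (y : A)) = phi x y.

Definition mul_span (X Y : subalgClosed A) : A -> Prop :=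
  fin_sum (fun a => exists x y, [/\ x \in X, y \in Y & a = x * y]).

(* X (x) Y = Y (x) X inside A *)
Definition tensor_commute (X Y : subalgClosed A) :=
  [/\ tensor_mul_inj X Y, tensor_mul_inj Y X &
      forall a, mul_span X Y a <-> mul_span Y X a].

Record is_grading (G : int -> {pred A}) : Prop := {
  gr_submod : forall i, submod_closed (G i);
  gr_one : 1 \in G 0;
  gr_mul : forall i j x y, x \in G i -> y \in G j -> x * y \in G (i + j);
  gr_span : forall a, fin_sum (fun x => exists i, x \in G i) a;
  gr_indep : forall (s : seq int) (x : int -> A), uniq s ->
    (forall i, x i \in G i) -> \sum_(i <- s) x i = 0 ->
    forall i, i \in s -> x i = 0 }.
End Tensor.

(* j : U -> W exhibits W as the extension of scalars of U along sigma *)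
Definition is_base_change (k0 k : fieldType) (sigma : {rmorphism k0 -> k})
    (U : lmodType k0) (W : lmodType k) (j : U -> W) :=
  forall (V : lmodType k) (g : {linear U -> V | sigma \; *:%R}),
  exists2 f : {linear W -> V}, (forall u, f (j u) = g u) &
    forall f' : {linear W -> V}, (forall u, f' (j u) = g u) -> f' =1 f.

Definition split_algebra (k0 : fieldType) (H0 : falgType k0) :=
  forall (E : lmodType H0) (f : {linear E -> E}), simple_mod E ->
    exists c : k0, forall x, f x = c%:A *: x.

Record triangular_algebra (k0 k : fieldType) (sigma : {rmorphism k0 -> k})
    (A : algType k) (H0 : falgType k0) := TriangularAlgebra {
  gr : int -> {pred A};
  gr_is_grading : is_grading gr;
  Bm : subalgClosed A;
  Bbar : subalgClosed A;
  Hs : subalgClosed A;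
  tri_iso : tensor3_mul_iso Bbar Hs Bm;
  tri_BH : tensor_commute Bm Hs;
  tri_HBbar : tensor_commute Hs Bbar;
  tri_B_gr : forall b, b \in Bm ->
    fin_sum (fun x => exists i : nat, x \in Bm /\ x \in gr (- i%:Z)) b;
  tri_Bbar_gr : forall b, b \in Bbar ->
    fin_sum (fun x => exists i : nat, x \in Bbar /\ x \in gr i%:Z) b;
  tri_B0 : forall b, b \in Bm -> b \in gr 0 -> exists c : k, b = c%:A;
  tri_Bbar0 : forall b, b \in Bbar -> b \in gr 0 -> exists c : k, b = c%:A;
  tri_H_gr : forall h, h \in Hs -> h \in gr 0;
  tri_H0 : {lrmorphism H0 -> sub_alg Hs | sigma \; *:%R};
  tri_H0_base : is_base_change sigma tri_H0;
  tri_H0_semisimple : semisimple_mod (H0^o : lmodType H0);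
  tri_H0_split : split_algebra H0;
  del : A;
  del_gr : del \in gr 0;
  del_inner : forall (i : int) (u : A), u \in gr i <-> del * u - u * del = u *~ i;
  del' : A;
  del0 : sub_alg Hs;
  del_decomp : del = del' - (del0 : A);
  del'_tri : fin_sum (fun a => exists x y z (i : nat),
    [/\ x \in Bbar, y \in Hs, z \in Bm /\ z \in gr (- i.+1%:Z) & a = x * y * z]) del';
  del0_central : forall h : sub_alg Hs, del0 * h = h * del0 }.

Section CategoryO.
Variables (k0 k : fieldType) (sigma : {rmorphism k0 -> k}) (A : algType k).
Variables (H0 : falgType k0) (T : triangular_algebra sigma A H0).
Notation H := (sub_alg (Hs T)).

(* B^{>n}, in the opposite indexing B^i = B_{-i} *)
Definition Bgt (n : nat) : A -> Prop :=
  fin_sum (fun b => exists i : nat, [/\ (n < i)%N, b \in Bm T & b \in gr T (- i%:Z)]).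

Definition gen_weight (M : lmodType A) (alpha : k) (m : M) :=
  exists N, forall n, (N <= n)%N -> (del T - alpha%:A) ^+ n *: m = 0.

Record category_O (M : lmodType A) : Prop := {
  O_loc_nilp : forall m : M, exists n, forall b, Bgt n b -> b *: m = 0;
  O_weights : forall m : M, fin_sum (fun w => exists alpha, gen_weight alpha w) m;
  O_fin_gen : forall alpha : k, exists n (w : 'I_n -> M),
    (forall i, gen_weight alpha (w i)) /\
    forall m, gen_weight alpha m -> exists a : 'I_n -> k, m = \sum_i (a i)%:A *: w i }.

(* Delta(E) is presented as the free A-module on the symbols [e], e in E, modulo
   [e + e'] = [e] + [e'], [h e] = h [e] for h in H, and b [e] = 0 for b in
   B^{>0}; this is A (x)_{BH} E because BH is generated by H and B^{>0}. *)
Section Standard.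
Variable E : lmodType H.

Definition standard_rel (x : {malg A[E]}) :=
  [\/ exists e e' : E, x = << 1 *g e + e' >> - << 1 *g e >> - << 1 *g e' >>,
      exists (h : H) (e : E), x = << 1 *g h *: e >> - << (h : A) *g e >>
    | exists (b : A) (e : E), Bgt 0 b /\ x = << b *g e >>].

Definition standard : lmodType A := quot_mod (span_mod standard_rel).
End Standard.

Section Costandard.
Variable E : lmodType H.

(* maps A -> E of degree i, linear over Bbar H, where E sits in degree 0 and is
   killed by Bbar_{>0} *)
Record homgr (i : int) (f : A -> E) : Prop := {
  homgrD : {morph f : x y / x + y};
  homgrH : forall (h : H) x, f ((h : A) * x) = h *: f x;
  homgrBbar : forall (j : nat) b x,
    b \in Bbar T -> b \in gr T j.+1%:Z -> f (b * x) = 0;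
  homgr_deg : forall j x, x \in gr T j -> i + j != 0 -> f x = 0 }.

Definition costd_pred : {pred A -> E} :=
  [pred f | `[< fin_sum (fun g => exists i, homgr i g) f >]].

Lemma costd_zmod : zmod_closed costd_pred.
Proof.
split; first by apply/asboolP/fin_sum0.
move=> f g /asboolP Hf /asboolP Hg; apply/asboolP/fin_sumD => //.
move: g Hg; apply: fin_sum_map => [|x y|g [i gi]]; first by rewrite oppr0.
  by rewrite opprD.
apply: fin_sum1; exists i; case: gi => gD gH gB gd; split.
- by move=> x y; rewrite !fctE gD opprD.
- by move=> h x; rewrite !fctE gH scalerN.
- by move=> j b x bB bj; rewrite !fctE (gB j) // oppr0.
by move=> j x xj ij; rewrite !fctE (gd j) // oppr0.
Qed.
HB.instance Definition _ := GRing.isZmodClosed.Build (A -> E) costd_pred costd_zmod.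

Record costandard_sort := Costd { costd_val :> A -> E; _ : costd_val \in costd_pred }.
HB.instance Definition _ := [isSub for costd_val].
HB.instance Definition _ := [Choice of costandard_sort by <:].
HB.instance Definition _ := [SubChoice_isSubZmodule of costandard_sort by <:].

Lemma costdD (f : costandard_sort) : {morph (f : A -> E) : x y / x + y}.
Proof.
case: f => f /= /asboolP[s [Ps ->]] x y; elim: s Ps => [|g s IHs] Ps.
  by rewrite big_nil /= addr0.
have [i gi] := Ps g (mem_head _ _).
have : forall z, z \in s -> exists i, homgr i z.
  by move=> z zs; apply: Ps; rewrite inE zs orbT.
move=> /IHs; rewrite big_cons; set r := \sum_(_ <- _) _ => rD.
change (g (x + y) + r (x + y) = g x + r x + (g y + r y)).
by rewrite (homgrD gi) rD addrACA.
Qed.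

Lemma costd_scale_subproof (a : A) (f : costandard_sort) :
  (fun x => f (x * a)) \in costd_pred.
Proof.
apply/asboolP.
have fin g : fin_sum (fun g => exists i, homgr i g) g -> fin_sum (fun g => exists i, homgr i g) (fun x : A => g (x * a) : E).
  move: g; apply: fin_sum_map => // g [i gi].
  have : fin_sum (fun x => exists i, x \in gr T i) a := gr_span (gr_is_grading T) a.
  pose r b x : E := g (x * b).
  have r0 : r 0 = 0.
    apply/funext=> x; rewrite /r mulr0.
    by apply: (addrI (g 0)); rewrite -(homgrD gi) !addr0.
  have rD : {morph r : x y / x + y}.
    by move=> b c; apply/funext=> x; rewrite /r mulrDr (homgrD gi).
  move: a; apply: (@fin_sum_map _ _ _ _ r r0 rD) => b [j bj].
  apply: fin_sum1; exists (i + j); case: gi => gD gH gB gd; split.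
  - by move=> x y; rewrite /r mulrDl gD.
  - by move=> h x; rewrite /r -mulrA gH.
  - by move=> l c x cB cl; rewrite /r -mulrA (gB l).
  move=> l x xl ijl; rewrite /r (gd (l + j)) //; last by rewrite [l + j]addrC addrA.
  by apply: gr_mul => //; apply: gr_is_grading.
by apply: fin; case: f => f /= /asboolP.
Qed.

Definition costd_scale (a : A) (f : costandard_sort) : costandard_sort :=
  Costd (costd_scale_subproof a f).

Lemma costd_scaleA a b f : costd_scale a (costd_scale b f) = costd_scale (a * b) f.
Proof. by apply/val_inj/funext => x /=; rewrite mulrA. Qed.
Lemma costd_scale1 : left_id 1 costd_scale.
Proof. by move=> f; apply/val_inj/funext => x /=; rewrite mulr1. Qed.
Lemma costd_scaleDr : right_distributive costd_scale +%R.
Proof. by move=> a f g; apply/val_inj/funext => x. Qed.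
Lemma costd_scaleDl f : {morph costd_scale^~ f : a b / a + b}.
Proof. by move=> a b; apply/val_inj/funext => x /=; rewrite mulrDr costdD. Qed.
HB.instance Definition _ := GRing.Zmodule_isLmodule.Build A costandard_sort
  costd_scaleA costd_scale1 costd_scaleDr costd_scaleDl.

Definition costandard : lmodType A := costandard_sort.

(* the scalar by which del0 acts on E; it exists when E is simple, since H is
   split and del0 is central *)
Definition c_ : k := xget 0 [set c : k | forall e : E, del0 T *: e = c%:A *: e].
End Costandard.

Definition irr_lt (I : Type) (Irr : I -> lmodType H) (a b : I) :=
  exists n : nat, c_ (Irr b) - c_ (Irr a) = n.+1%:R.
End CategoryO.

(* Main.v *)
From HB Require Import structures.
From mathcomp Require Import all_boot all_algebra all_field.
From mathcomp Require Import boolp classical_sets functions cardinality.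
From mathcomp Require Import finmap monalg.
Require Import Defs.

(** Why the category is a highest weight category.

    Weights.  Since [del = del' - del0] and the terms of [del'] end in [B^{>0}],
    a copy of a simple [H]-module [E] that is killed by [B^{>0}] consists of
    eigenvectors of [del] for [- c_E].  In an object of [O] every nonzero vector
    is carried by some element of [B] to a nonzero vector killed by [B^{>0}], so
    every nonzero subquotient meets one of the weight spaces [- c_E].  These are
    finitely many and finite-dimensional: [O_artin] bounds the chains of
    submodules, and [low_bound] bounds the weights of all objects below in each
    coset of the integers.  Weights also control the order: if [nabla(F)] or
    [Delta(F)] has the weight [- c_E], then [- c_E] is [- c_F] plus a natural
    number, so that [E < F] or the weight is the lowest one.

    The algebra [H].  In characteristic zero the trace form of a semisimple
    algebra is nondegenerate; the resulting Casimir element survives extension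
    of scalars, and averaging over it gives the semisimplicity of [H]-modules
    ([maschke]), the finiteness of Irr(H) ([finite_irr]) and the scalars [c_E]
    ([central_scalar]).  The relation [del u - u del = i u] then shows that the
    graded pieces of [B] and [Bbar] are finite-dimensional ([Cd_spanned],
    [Bd_spanned]), which puts standard and costandard objects in [O].

    Standard, costandard and simple objects.  Maps out of [Delta(E)] are copies
    of [E] killed by [B^{>0}] ([std_hom]); maps into [nabla(E)] are functionals
    with values in [E] ([nab_hom]).  The simple object [L(E)] is the image of
    the canonical map from [Delta(E)] to [nabla(E)].  Uniqueness of the head and
    of the socle, the composition factors of [nabla(E)] and the classification
    of simple objects are read off from lowest weight vectors.

    Projective covers.  Let [P] be the quotient of [A] by the left ideal
    [A B^{>n} + A (del - al)^N], for large [n] and [N]: it represents the exact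
    functor of vectors of weight [al], so it is projective ([weight_proj]).  It
    is free over [Bbar] in the relative sense of [relfree], a property that
    passes to direct summands, in particular to a minimal submodule [P(E)] that
    maps onto [L(E)], for [al = - c_E].  In a relatively free module a simple
    [H]-module [F] of lowest weight generates a copy of [Delta(F)] that splits
    off over [Bbar H], and the quotient is again relatively free.  Peeling off
    such submodules, with [F > E], one arrives at a quotient of [P(E)] whose
    lowest weight is [- c_E]; being local and relatively free, it is [Delta(E)].

    Injective hulls.  All this dualises.  Functionals on [A] that vanish on the
    corresponding right ideal form an injective object ([weight_inj]), cofree
    over [B] in the sense of [relcofree].  The hull [I(E)] is a direct summand,
    obtained as a minimal quotient in which [L(E)] embeds.  In a relatively
    cofree module a simple [H]-module [F] of lowest weight gives a surjection
    onto [nabla(F)] that splits over [B H], whose kernel is again relatively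
    cofree; peeling off such quotients leaves the submodule [nabla(E)]. *)

Set Implicit Arguments.
Unset Strict Implicit.
Unset Printing Implicit Defensive.

Import GRing.Theory.
Local Open Scope ring_scope.


(** * Submodules, quotients and modules with bounded chains *)

Section Builders.
Variable R : nzRingType.
Implicit Types M N : lmodType R.

(** Submodules are mostly met as predicates; [mksub] packages one when a
    bundled submodule is required. *)
Definition subm M (P : M -> Prop) : Prop :=
  P 0 /\ forall a x y, P x -> P y -> P (a *: x + y).

Section Mksub.
Variables (M : lmodType R) (P : M -> Prop) (HP : subm P).
Definition mksub_pred : {pred M} := [pred x | `[< P x >]].
Lemma mksub_subproof : submod_closed mksub_pred.
Proof.
case: HP => P0 PD; split; first exact/asboolP.
by move=> a x y /asboolP Px /asboolP Py; apply/asboolP/PD.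
Qed.
Definition mksub : submodClosed M :=
  HB.pack mksub_pred (GRing.isSubmodClosed.Build R M mksub_pred
    (GRing.submod_closed_semi mksub_subproof)).
Lemma in_mksub x : x \in mksub <-> P x.
Proof. by split=> [/asboolP|Px] //; apply/asboolP. Qed.
End Mksub.

Lemma subm_in M (N : submodClosed M) : subm (fun x => x \in N).
Proof. by split=> [|a x y xN yN]; rewrite ?rpred0 // rpredD ?rpredZ. Qed.

Definition mklin M N (f : M -> N) (Hf : linear f) : {linear M -> N} :=
  HB.pack f (GRing.isLinear.Build R M N *:%R f Hf).
End Builders.

Section ModuleTools.
Variable R : nzRingType.
Implicit Types M N X Y Z : lmodType R.

Lemma linear_inj M N (f : {linear M -> N}) :
  (forall x, f x = 0 -> x = 0) -> injective f.
Proof.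
move=> f0 x y fxy; apply/eqP; rewrite -subr_eq0; apply/eqP/f0.
by rewrite linearB fxy subrr.
Qed.

Lemma inj_linear0 M N (f : {linear M -> N}) x : injective f -> f x = 0 -> x = 0.
Proof. by move=> finj; rewrite -(linear0 f) => /finj. Qed.

Lemma factor_surj X Y Z (p : {linear X -> Y}) (f : {linear X -> Z}) :
    surj p -> (forall x, p x = 0 -> f x = 0) ->
  exists g : {linear Y -> Z}, forall x, g (p x) = f x.
Proof.
move=> /choice[s sK] kp.
have fs x : f (s (p x)) = f x.
  apply/eqP; rewrite -subr_eq0 -linearB; apply/eqP/kp.
  by rewrite linearB sK subrr.
have gl : linear (f \o s).
  move=> a x y /=; rewrite -(sK x) -(sK y) -linearP !fs linearP.
  by [].
by exists (mklin gl) => x /=; rewrite fs.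
Qed.

Lemma factor_inj X Y Z (u : {linear X -> Y}) (f : {linear Z -> Y}) :
    injective u -> (forall z, exists x, u x = f z) ->
  exists g : {linear Z -> X}, forall z, u (g z) = f z.
Proof.
move=> uinj /choice[g gE].
have gl : linear g by move=> a x y; apply: uinj; rewrite linearP !gE linearP.
by exists (mklin gl).
Qed.

Lemma bij_inverse X Y (f : {linear X -> Y}) :
    injective f -> surj f ->
  exists g : {linear Y -> X}, (forall x, g (f x) = x) /\ forall y, f (g y) = y.
Proof.
move=> finj /choice[g gK].
have gl : linear g by move=> a x y; apply: finj; rewrite linearP !gK.
by exists (mklin gl); split=> // x; apply: finj; rewrite /= gK.
Qed.

Lemma inj_surj_bij X Y (f : {linear X -> Y}) : injective f -> surj f -> bijective f.
Proof. by move=> fi fs; case: (bij_inverse fi fs) => g [gK Kg]; exists g. Qed.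

Lemma bij_surj (U V : Type) (f : U -> V) : bijective f -> surj f.
Proof. by case=> g _ gK y; exists (g y). Qed.

Lemma mod_iso_sym X Y : mod_iso X Y -> mod_iso Y X.
Proof.
case=> f fb; have [g [gK Kg]] := bij_inverse (bij_inj fb) (bij_surj fb).
by exists g; exists f.
Qed.

Lemma mod_iso_trans X Y Z : mod_iso X Y -> mod_iso Y Z -> mod_iso X Z.
Proof. by move=> [f fb] [g gb]; exists (g \o f); apply: bij_comp. Qed.

Lemma zerom_subproof M : subm (fun x : M => x = 0).
Proof. by split=> // a x y -> ->; rewrite scaler0 addr0. Qed.
Definition zerom M := mksub (@zerom_subproof M).

Lemma fullm_subproof M : subm (fun x : M => True).
Proof. by []. Qed.
Definition fullm M := mksub (@fullm_subproof M).

Lemma prem_subproof M N (f : {linear M -> N}) (P : submodClosed N) :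
  subm (fun x => f x \in P).
Proof.
by split=> [|a x y xP yP]; rewrite ?linear0 ?rpred0 // linearP rpredD ?rpredZ.
Qed.
Definition prem M N (f : {linear M -> N}) P := mksub (prem_subproof f P).

Lemma kerm_subproof M N (f : {linear M -> N}) : subm (fun x => f x = 0).
Proof.
by split=> [|a x y x0 y0]; rewrite ?linear0 // linearP x0 y0 scaler0 addr0.
Qed.
Definition kerm M N (f : {linear M -> N}) := mksub (kerm_subproof f).

Lemma imm_subproof M N (f : {linear M -> N}) (P : submodClosed M) :
  subm (fun y => exists2 x, x \in P & f x = y).
Proof.
split=> [|a x y [u uP <-] [v vP <-]]; first by exists 0; rewrite ?rpred0 ?linear0.
by exists (a *: u + v); rewrite ?linearP // rpredD ?rpredZ.
Qed.
Definition imm M N (f : {linear M -> N}) P := mksub (imm_subproof f P).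

Lemma in_image_mod M N (f : {linear M -> N}) y :
  y \in image_mod f <-> exists x, f x = y.
Proof. by split=> [/asboolP|?] //; apply/asboolP. Qed.


Lemma qpi_linear M (N : submodClosed M) : linear (@quot_proj _ _ N).
Proof. by move=> a x y; rewrite quot_projD -quot_scaleE. Qed.
Definition qpi M (N : submodClosed M) : {linear M -> quot_mod N} :=
  mklin (@qpi_linear M N).

Lemma qpi_eq0 M (N : submodClosed M) x : qpi N x = 0 <-> x \in N.
Proof.
have e : (x \in N) = (x - 0 \in submod_pred N) by rewrite subr0.
rewrite e (Quotient.idealrBE (submod_pred N)) -(linear0 (qpi N)).
by split=> [h|/eqP h]; [apply/eqP | ].
Qed.

Lemma qpi_surj M (N : submodClosed M) : surj (qpi N).
Proof. by move=> y; exists (repr y); rewrite /= quot_projK. Qed.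

Lemma incl_linear M (N : submodClosed M) : linear (@sub_mod_val _ _ N).
Proof. by []. Qed.
Definition incl M (N : submodClosed M) : {linear sub_mod N -> M} :=
  mklin (@incl_linear M N).

Lemma incl_inj M (N : submodClosed M) : injective (incl N).
Proof. exact: val_inj. Qed.

Lemma incl_in M (N : submodClosed M) y : incl N y \in N.
Proof. exact: (valP y). Qed.

Lemma in_incl M (N : submodClosed M) x : x \in N -> exists y, incl N y = x.
Proof. by move=> xN; exists (SubMod xN). Qed.

Lemma corestrict X M (N : submodClosed M) (f : {linear X -> M}) :
  (forall x, f x \in N) -> exists g : {linear X -> sub_mod N}, forall x, incl N (g x) = f x.
Proof. by move=> fN; apply: (factor_inj (@incl_inj _ N)) => z; apply/in_incl. Qed.

(** The step that extends a filtration by a submodule of the quotient. *)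
Lemma lift_subquotient M (N : submodClosed M) X (t : {linear X -> quot_mod N}) :
    injective t ->
  subquotient N (prem (qpi N) (image_mod t)) X.
Proof.
move=> tinj; set N' := prem _ _.
split=> [x xN|]; first by apply/in_mksub; rewrite (qpi_eq0 N x).2 ?rpred0.
have [] := @factor_inj _ _ _ t (qpi N \o incl N') tinj.
  by move=> z; have /in_mksub/in_image_mod := incl_in z.
move=> f fE; exists f; split=> [x|y].
  have [m mE] := qpi_surj (t x).
  have /in_incl[y yE] : m \in N' by apply/in_mksub/in_image_mod; exists x; rewrite mE.
  by exists y; apply: tinj; rewrite fE /= -mE -yE.
have -> : (y : M) \in N <-> qpi N (y : M) = 0 by split=> /qpi_eq0.
have -> : qpi N (y : M) = t (f y) by rewrite fE.
by split=> [->|/(inj_linear0 tinj)] //; rewrite linear0.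
Qed.

Lemma subquotient_full M (N : submodClosed M) X (f : {linear M -> X}) :
  surj f -> (forall x, x \in N <-> f x = 0) -> subquotient N (fullm M) X.
Proof.
move=> fs kf; split=> [x _|]; first exact/in_mksub.
exists (f \o incl (fullm M)); split=> [y|y] /=; last by split=> /kf.
have [x <-] := fs y; have /in_incl[z <-] : x \in fullm M by apply/in_mksub.
by exists z.
Qed.

Definition sqm M (N1 N2 : submodClosed M) : lmodType R :=
  quot_mod (prem (incl N2) N1).

Lemma sqmP M (N1 N2 : submodClosed M) : {subset N1 <= N2} -> subquotient N1 N2 (sqm N1 N2).
Proof.
move=> N12; split=> //; exists (qpi (prem (incl N2) N1)); split; first exact: qpi_surj.
move=> y; split=> [/qpi_eq0/in_mksub|yN] //; exact/qpi_eq0/in_mksub.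
Qed.

Lemma genm_subproof M (S : M -> Prop) :
  subm (fin_sum (fun y => exists a z, S z /\ y = a *: z)).
Proof.
split=> [|a x y xS yS]; first exact: fin_sum0.
apply: fin_sumD => //; move: x xS; apply: fin_sum_map => [|x y1|x [b [z [Sz ->]]]].
- by rewrite scaler0.
- by rewrite scalerDr.
by apply: fin_sum1; exists (a * b), z; rewrite scalerA.
Qed.
Definition genm M (S : M -> Prop) := mksub (genm_subproof S).
Lemma genm_gen M (S : M -> Prop) x : S x -> x \in genm S.
Proof. by move=> Sx; apply/in_mksub/fin_sum1; exists 1, x; rewrite scale1r. Qed.
Lemma genm_min M (S : M -> Prop) (N : submodClosed M) :
  (forall x, S x -> x \in N) -> {subset genm S <= N}.
Proof.
move=> SN x /in_mksub[s [sS ->]]; rewrite big_seq; apply: rpred_sum => y /sS[a [z [Sz ->]]].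
by apply/rpredZ/SN.
Qed.

Lemma simple_sub_all M (N : submodClosed M) x :
  simple_mod M -> x \in N -> x <> 0 -> forall y, y \in N.
Proof. by case=> _ /(_ N)[N0|//] /N0. Qed.

Lemma simple_inj M N (f : {linear M -> N}) x :
  simple_mod M -> f x <> 0 -> injective f.
Proof.
move=> [_ /(_ (kerm f))[k0|kA]] fx; last by case: fx; have /in_mksub := kA x.
by apply: linear_inj => y fy; apply: k0; apply/in_mksub.
Qed.

Lemma simple_surj M N (f : {linear M -> N}) x :
  simple_mod N -> f x <> 0 -> surj f.
Proof.
move=> Ns fx y; apply/in_image_mod.
apply: (@simple_sub_all _ (image_mod f) (f x)) => //.
by apply/in_image_mod; exists x.
Qed.

End ModuleTools.

Section Artin.
Variable R : nzRingType.
Implicit Types M X Y Z : lmodType R.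

(** A bounded, strictly increasing integer function on submodules: the only
    form in which lengths and dimensions of modules are used below. *)
Definition artin M := exists n (mu : submodClosed M -> nat),
  (forall N, (mu N <= n)%N) /\
  (forall N N' : submodClosed M, {subset N <= N'} -> ~ {subset N' <= N} -> (mu N < mu N')%N).

Lemma artin_min M (Q : submodClosed M -> Prop) N : artin M -> Q N ->
  exists2 N', Q N' & forall N'', Q N'' -> {subset N'' <= N'} -> {subset N' <= N''}.
Proof.
case=> n [mu [_ mulin]]; elim: (mu N).+1 {-2}N (ltnSn (mu N)) => // m IH {}N mN QN.
have [[N'' [QN'' [sN nsN]]]|H] := EM (exists N'' : submodClosed M, Q N'' /\ {subset N'' <= N} /\ ~ {subset N <= N''}).
  by apply: (IH N'') => //; apply: leq_trans (mulin _ _ sN nsN) _.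
exists N => // N'' QN'' sN; have [//|ns] := EM {subset N <= N''}.
by case: H; exists N''.
Qed.

Lemma artin_max M (Q : submodClosed M -> Prop) N : artin M -> Q N ->
  exists2 N', Q N' & forall N'', Q N'' -> {subset N' <= N''} -> {subset N'' <= N'}.
Proof.
case=> n [mu [mun mulin]]; elim: (n - mu N).+1 {-2}N (ltnSn (n - mu N)) => // m IH {}N mN QN.
have [[N'' [QN'' [sN nsN]]]|H] := EM (exists N'' : submodClosed M, Q N'' /\ {subset N <= N''} /\ ~ {subset N'' <= N}).
  apply: (IH N'') => //; apply: leq_trans (_ : _ <= n - mu N)%N _ => //.
  by rewrite ltn_sub2l ?mulin // (leq_trans _ (mun N'')) // mulin.
exists N => // N'' QN'' sN; have [//|ns] := EM {subset N'' <= N}.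
by case: H; exists N''.
Qed.

Lemma sqm_simple M (N1 N2 : submodClosed M) :
    {subset N1 <= N2} -> ~ {subset N2 <= N1} ->
    (forall N : submodClosed M, {subset N1 <= N} -> {subset N <= N2} ->
       {subset N <= N1} \/ {subset N2 <= N}) ->
  simple_mod (sqm N1 N2).
Proof.
move=> s12 ns21 btw; split.
  apply: contrapT => H; apply: ns21 => x /in_incl[y yx].
  have /qpi_eq0/in_mksub : qpi (prem (incl N2) N1) y = 0.
    by apply: contrapT => /eqP h; apply: H; exists (qpi (prem (incl N2) N1) y).
  by rewrite yx.
move=> P; set p := qpi (prem (incl N2) N1); pose N := imm (incl N2) (prem p P).
have [||NN1|N2N] := btw N.
- move=> x xN1; have [y yx] := in_incl (s12 _ xN1).
  apply/in_mksub; exists y => //; apply/in_mksub.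
  by rewrite (_ : p y = 0) ?rpred0 //; apply/qpi_eq0/in_mksub; rewrite yx.
- by move=> _ /in_mksub[y _ <-]; apply: incl_in.
- left=> z zP; have [y yz] := qpi_surj z; rewrite -yz; apply/qpi_eq0/in_mksub/NN1.
  by apply/in_mksub; exists y => //; apply/in_mksub; rewrite /p yz.
right=> z; have [y <-] := qpi_surj z.
have /N2N/in_mksub[y' /in_mksub y'P yy'] := incl_in y.
by rewrite -(incl_inj yy').
Qed.

(** Go up through minimal overmodules; the measure bounds the number of steps. *)
Lemma artin_finite_length M : artin M -> finite_length M.
Proof.
move=> am; have [n [mu [mun mulin]]] := am.
have step (N : submodClosed M) : exists N' : submodClosed M, {subset N <= N'} /\
    ((exists x, x \notin N) -> ~ {subset N' <= N} /\ simple_mod (sqm N N')).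
  have [NA|/existsNP[x /negP xN]] := EM (forall x, x \in N).
    by exists N; split=> // -[x]; rewrite NA.
  have [|N' [sN nsN] minN] := @artin_min _ (fun N' => {subset N <= N'} /\ ~ {subset N' <= N}) (fullm M) am.
    by split=> [y _|/(_ x)]; [apply/in_mksub|move=> h; case/negP: xN; apply/h/in_mksub].
  exists N'; split=> // _; split=> //; apply: sqm_simple => // N'' s1 s2.
  by have [|ns] := EM {subset N'' <= N}; [left|right; apply: minN].
have [g gP] := choice step; pose F i := iter i g (zerom M).
have muF i : (exists x, x \notin F i) -> (i <= mu (F i))%N.
  elim: i => // i IH [x xF]; have [|ns _] := (gP (F i)).2.
    by exists x; apply: contra xF => /(gP (F i)).1.
  apply: leq_ltn_trans (IH _) _; first by exists x; apply: contra xF => /(gP (F i)).1.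
  exact: mulin (gP _).1 ns.
have Fn : forall x, x \in F n.+1.
  move=> x; apply: contraT => xF; have := muF n.+1 (ex_intro _ x xF).
  by rewrite leqNgt ltnS mun.
(* stop the chain at the first index where it reaches M *)
pose full i := `[< forall x, x \in F i >].
have exf : exists i, full i by exists n.+1; apply/asboolP.
have [m /asboolP mfull mmin] := ex_minnP exf.
exists m, F; split; first by split=> // [x /in_mksub|i _ x] //; apply: (gP _).1.
move=> i im; exists (sqm (F i) (F i.+1)); last exact/sqmP/(gP _).1.
have /(gP (F i)).2[] // : exists x, x \notin F i.
apply: contrapT => H; move: im; rewrite ltnNge => /negP; apply; apply: mmin.
by apply/asboolP => x; apply: contraT => xF; case: H; exists x.
Qed.

Lemma subquotient_strict M (N1 N2 : submodClosed M) X :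
  subquotient N1 N2 X -> (exists x : X, x != 0) -> ~ {subset N2 <= N1}.
Proof.
move=> [_ [f [fs fk]]] [x x0] s21; have [y yx] := fs x.
by case/eqP: x0; rewrite -yx; apply/fk/s21/(valP y).
Qed.

(** The steps with factor [S] are strict, so the measure counts them. *)
Lemma artin_multiplicity M S : artin M -> simple_mod S -> finite_multiplicity M S.
Proof.
move=> [m [mu [mum mulin]]] [S0 _]; exists m => n F J Fm FJ.
have muF i (N : submodClosed M) : (i <= n)%N -> {subset F i <= N} ->
    (#|[set j in J | (j < i)%N]%SET| <= mu N)%N.
  elim: i N => [|i IH] N ile sN.
    rewrite (_ : #|_| = 0%N) //; apply/eqP; rewrite cards_eq0.
    by apply/eqP/finset.setP=> j; rewrite !inE andbF.
  have si := Fm i ile; pose o := Ordinal ile.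
  have [oJ|noJ] := boolP (o \in J); last first.
    apply: leq_trans (IH N (ltnW ile) _); last by move=> x /si/sN.
    apply/subset_leq_card/fintype.subsetP=> j; rewrite !inE => /andP[jJ].
    rewrite jJ ltnS leq_eqVlt => /orP[/eqP ji|//].
    by case/negP: noJ; rewrite (_ : o = j) //; apply/val_inj.
  have lt : (mu (F i) < mu N)%N.
    apply: mulin => [x /si/sN //|sNi].
    by apply: (subquotient_strict (FJ o oJ)) => // x /sN/sNi.
  apply: leq_trans lt; rewrite (cardsD1 o) inE oJ ltnSn add1n ltnS.
  apply: leq_trans (IH (F i) (ltnW ile) _) => //.
  apply/subset_leq_card/fintype.subsetP=> j; rewrite !inE => /and3P[jo jJ].
  rewrite jJ ltnS leq_eqVlt => /orP[/eqP ji|//].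
  by case/eqP: jo; apply/val_inj.
have sF : {subset F n <= fullm M} by move=> x _; apply/in_mksub.
apply: leq_trans (leq_trans (muF n (fullm M) (leqnn _) sF) (mum _)).
by apply/subset_leq_card/fintype.subsetP=> j jJ; rewrite !inE jJ ltn_ord.
Qed.

(** The images of the iterates of [f] form a descending chain, which stops. *)
Lemma artin_inj_surj M (f : {linear M -> M}) : artin M -> injective f -> surj f.
Proof.
move=> am finj; pose P i := mksub (@subm_in _ _ (image_mod f)).
have linit i : linear (iter i f).
  by elim: i => // i IH a x y; rewrite !iterS IH linearP.
pose Q (N : submodClosed M) := exists i, forall x, x \in N <-> exists y, iter i f y = x.
have [|N [i Ni] Nmin] := @artin_min M Q (fullm M) am.
  by exists 0%N => x; split=> [_|_]; [exists x|apply/in_mksub].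
pose N' := imm (mklin (linit i.+1)) (fullm M).
have inN' x : x \in N' <-> exists y, iter i.+1 f y = x.
  split=> [/in_mksub[y _ <-]|[y <-]]; first by exists y.
  by apply/in_mksub; exists y => //; apply/in_mksub.
move=> y; have : iter i f y \in N' .
  apply: (Nmin N'); first by exists i.+1.
    by move=> x /inN'[z <-]; apply/Ni; exists (f z); rewrite -iterSr.
  by apply/Ni; exists y.
case/inN' => z; rewrite iterSr => e; exists z.
elim: i {N Ni Nmin N' inN' P Q} e => //= i IH /finj e.
by apply: IH; rewrite -e.
Qed.

(** The kernels of the iterates of [f] form an ascending chain, which stops. *)
Lemma artin_surj_inj M (f : {linear M -> M}) : artin M -> surj f -> injective f.
Proof.
move=> am fs.
have linit i : linear (iter i f).
  by elim: i => // i IH a x y; rewrite !iterS IH linearP.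
have sit i : surj (iter i f).
  elim: i => [y|i IH y] /=; first by exists y.
  by have [z <-] := fs y; have [x <-] := IH z; exists x.
pose Q (N : submodClosed M) := exists i, forall x, x \in N <-> iter i f x = 0.
have [|N [i Ni] Nmax] := @artin_max M Q (zerom M) am.
  by exists 0%N => x; split=> [/in_mksub|h] //; apply/in_mksub.
apply: linear_inj => x fx0; have [y yx] := sit i x.
have : y \in N.
  apply: (Nmax (kerm (mklin (linit i.+1)))).
  - by exists i.+1 => z; split=> [/in_mksub|h] //; apply/in_mksub.
  - by move=> z /Ni z0; apply/in_mksub; rewrite /= z0 linear0.
  by apply/in_mksub; rewrite /= yx.
by move/Ni; rewrite yx.
Qed.
End Artin.

(** * Finite-dimensional linear algebra for predicates *)

Section Spans.
Variable k : fieldType.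
Implicit Types V W : lmodType k.

Definition lspan V (s : seq V) : submodClosed V := genm (fun x => x \in s).
(** The spanning vectors need not satisfy [P], so this passes to smaller
    predicates; [fd_sub] gives back a spanning family inside [P] when [P] is a
    subspace. *)
Definition spanned V (P : V -> Prop) := exists s : seq V, forall x, P x -> x \in lspan s.
Definition comb V (s : seq V) (v : 'rV[k]_(size s)) := \sum_i v 0 i *: s`_i.
Global Arguments comb [V] s v.

Lemma comb_linear V (s : seq V) : linear (@comb V s).
Proof.
move=> a u v; rewrite /comb scaler_sumr -big_split; apply: eq_bigr => i _ /=.
by rewrite !mxE scalerDl scalerA.
Qed.
HB.instance Definition _ V s := GRing.isLinear.Build k _ _ _ (@comb V s) (@comb_linear V s).

Lemma lspanP V (s : seq V) x : x \in lspan s <-> exists v, x = comb s v.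
Proof.
split=> [|[v ->]]; last first.
  by apply: rpred_sum => i _; apply/rpredZ/genm_gen/mem_nth.
move: x; pose N := mksub (@imm_subproof _ _ _ (@comb V s) (fullm _)).
suff sN : {subset lspan s <= N} by move=> x /sN/in_mksub[v _ <-]; exists v.
apply: genm_min => x xs; apply/in_mksub.
have xi : (index x s < size s)%N by rewrite index_mem.
exists (delta_mx 0 (Ordinal xi)); first exact/in_mksub.
rewrite /= /comb (bigD1 (Ordinal xi)) //= big1 => [|j ji].
  by rewrite addr0 mxE !eqxx scale1r nth_index.
by rewrite mxE eqxx (negPf ji) scale0r.
Qed.

Lemma lspan_in V (s : seq V) (N : submodClosed V) :
  (forall x, x \in s -> x \in N) -> {subset lspan s <= N}.
Proof. exact: genm_min. Qed.

Lemma spanned_sub V (P Q : V -> Prop) : (forall x, P x -> Q x) -> spanned Q -> spanned P.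
Proof. by move=> PQ [s sQ]; exists s => x /PQ/sQ. Qed.

Lemma spanned_add V (P Q : V -> Prop) : spanned P -> spanned Q ->
  spanned (fun z => exists x y, [/\ P x, Q y & z = x + y]).
Proof.
move=> [s sP] [t tQ]; exists (s ++ t) => _ [x [y [Px Qy ->]]].
apply: rpredD.
  by apply: (lspan_in _ (sP x Px)) => z zs; apply: genm_gen; rewrite mem_cat zs.
by apply: (lspan_in _ (tQ y Qy)) => z zs; apply: genm_gen; rewrite mem_cat zs orbT.
Qed.

Lemma spanned_fin_sum V (P : V -> Prop) : spanned P -> spanned (fin_sum P).
Proof.
move=> [s sP]; exists s => x [t [tP ->]].
by rewrite big_seq; apply: rpred_sum => y /tP/sP.
Qed.

Lemma spanned_bigU V (P : nat -> V -> Prop) n :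
  (forall i, (i < n)%N -> spanned (P i)) ->
  spanned (fun x => exists2 i, (i < n)%N & P i x).
Proof.
elim: n => [_|n IH H]; first by exists [::] => x [].
have [s sP] := IH (fun i lin => H i (leqW lin)); have [t tP] := H n (leqnn _).
exists (s ++ t) => x [i]; rewrite ltnS leq_eqVlt => /orP[/eqP->|lin] Px.
  by apply: (lspan_in _ (tP x Px)) => z zs; apply: genm_gen; rewrite mem_cat zs orbT.
have xs : x \in lspan s by apply: sP; exists i.
by apply: (lspan_in _ xs) => z zs; apply: genm_gen; rewrite mem_cat zs.
Qed.

Lemma spanned_linear V W (f : {linear V -> W}) (P : V -> Prop) :
  spanned P -> spanned (fun y => exists2 x, P x & f x = y).
Proof.
move=> [s sP]; exists (map f s) => _ [x Px <-].
suff /(_ x (sP x Px)) /in_mksub : {subset lspan s <= prem f (lspan (map f s))} by [].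
by apply: lspan_in => y ys; apply/in_mksub/genm_gen/map_f.
Qed.

Lemma spanned_mul (A : algType k) (P Q : A -> Prop) : spanned P -> spanned Q ->
  spanned (fun z => exists x y, [/\ P x, Q y & z = x * y]).
Proof.
move=> [s sP] [t tQ]; exists [seq x * y | x <- s, y <- t] => _ [x [y [Px Qy ->]]].
set N := lspan _.
have lm (b : A) : linear (fun a : A => a * b) by move=> a u v; rewrite mulrDl scalerAl.
have rm (b : A) : linear (fun a : A => b * a) by move=> a u v; rewrite mulrDr scalerAr.
suff /(_ x (sP x Px)) /in_mksub : {subset lspan s <= prem (mklin (lm y)) N} by [].
apply: lspan_in => u us; apply/in_mksub => /=.
suff /(_ y (tQ y Qy)) /in_mksub : {subset lspan t <= prem (mklin (rm u)) N} by [].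
by apply: lspan_in => v vt; apply/in_mksub/genm_gen/allpairs_f.
Qed.

(** Take a subspace of largest dimension among those contained in [U]. *)
Lemma subspace_vspace n (U : 'rV[k]_n -> Prop) : subm U ->
  exists U' : {vspace 'rV[k]_n}, forall v, v \in U' <-> U v.
Proof.
move=> [U0 UD].
pose Q m := `[< exists U' : {vspace 'rV[k]_n}, (forall v, v \in U' -> U v) /\ \dim U' = m >].
have exQ : exists m, Q m.
  by exists 0%N; apply/asboolP; exists 0%VS; split; [move=> v; rewrite memv0 => /eqP->|rewrite dimv0].
have Qb m : Q m -> (m <= n)%N.
  move=> /asboolP[U' [_ <-]]; apply: leq_trans (dimvS (subvf _)) _.
  by rewrite dimvf /dim /= mul1n.
case: (ex_maxnP exQ Qb) => m /asboolP[U' [sU dU]] mmax; exists U' => v.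
split=> [/sU//|Uv]; apply: contraT => nvU.
have /mmax : Q (\dim (U' + <[v]>)).
  apply/asboolP; exists (U' + <[v]>)%VS; split=> // w /memv_addP[x xU [y /vlineP[a ->] ->]].
  by rewrite addrC; apply: UD => //; apply: sU.
rewrite -dU leqNgt => /negP; case.
rewrite ltn_neqAle dimvS ?addvSl // andbT; apply: contra nvU => /eqP dE.
have /eqP -> : U' == (U' + <[v]>)%VS by rewrite eqEdim addvSl dE leqnn.
by apply: (subvP (addvSr _ _)); rewrite memv_line.
Qed.

Definition fd V (P : V -> Prop) := exists n (w : 'I_n -> V),
  (forall i, P (w i)) /\ forall x, P x -> exists a : 'I_n -> k, x = \sum_i a i *: w i.

Lemma fd_spanned V (P : V -> Prop) : fd P -> spanned P.
Proof.
move=> [n [w [_ wP]]]; exists (codom w) => x /wP[a ->].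
by apply: rpred_sum => i _; apply/rpredZ/genm_gen/codom_f.
Qed.

(** Subspaces of a space spanned by finitely many vectors, and more generally
    spaces injecting into one, have a finite spanning family of their own. *)
Lemma fd_inj V W (P : V -> Prop) (Q : W -> Prop) (f : V -> W) :
    subm P -> spanned Q ->
    (forall a x y, P x -> P y -> f (a *: x + y) = a *: f x + f y) ->
    (forall x, P x -> f x = 0 -> x = 0) -> (forall x, P x -> Q (f x)) ->
  fd P.
Proof.
move=> [P0 PD] [s sQ] fl f0 fQ; have f00 : f 0 = 0.
  have := fl (-1) 0 0 P0 P0; rewrite scaler0 addr0 => /eqP.
  by rewrite addrC scaleN1r subrr => /eqP.
pose U (v : 'rV[k]_(size s)) := exists2 x, P x & f x = comb s v.
have Us : subm U.
  split=> [|a u v [x Px fx] [y Py fy]]; first by exists 0; rewrite ?linear0.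
  by exists (a *: x + y); [apply: PD|rewrite fl // fx fy linearP].
have [U' UP] := subspace_vspace Us.
have bP i : U (vbasis U')`_i.
  have [lti|gei] := ltnP i (\dim U').
    by apply/UP/vbasis_mem/mem_nth; rewrite size_tuple.
  by rewrite nth_default ?size_tuple //; case: Us.
pose w (i : 'I_(\dim U')) := xget 0 [set x | P x /\ f x = comb s (vbasis U')`_i].
have wP i : P (w i) /\ f (w i) = comb s (vbasis U')`_i.
  by rewrite /w; case: xgetP => [x _ //|H]; have [x Px fx] := bP i; case: (H x).
have wsum (a : 'I_(\dim U') -> k) (r : seq 'I_(\dim U')) :
    P (\sum_(i <- r) a i *: w i) /\
    f (\sum_(i <- r) a i *: w i) = \sum_(i <- r) a i *: f (w i).
  elim: r => [|i r [IH1 IH2]]; first by rewrite !big_nil.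
  rewrite !big_cons fl //; last by case: (wP i).
  by rewrite IH2; split=> //; apply: PD => //; case: (wP i).
exists (\dim U'), w; split=> [i|x Px]; first by case: (wP i).
have [v fxv] := (lspanP s (f x)).1 (sQ _ (fQ _ Px)).
have vU : v \in U' by apply/UP; exists x.
exists (fun i => coord (vbasis U') i v); have [Pw fw] := wsum (fun i => coord (vbasis U') i v) (index_enum _).
apply/eqP; rewrite -subr_eq0 -scaleN1r addrC; apply/eqP/f0; first exact: PD.
rewrite fl // fw fxv scaleN1r; apply/eqP; rewrite addrC subr_eq0; apply/eqP.
rewrite {1}(coord_vbasis vU) linear_sum; apply: eq_bigr => i _.
by rewrite (wP i).2 linearZ.
Qed.

Lemma fd_sub V (P Q : V -> Prop) : subm P -> spanned Q -> (forall x, P x -> Q x) -> fd P.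
Proof. by move=> Ps Qs PQ; apply: (fd_inj (f := id) Ps Qs). Qed.

(** A finite-dimensional space projects onto each of its subspaces. *)
Lemma fd_proj V (P Q : V -> Prop) : subm P -> subm Q -> spanned Q ->
    (forall x, P x -> Q x) ->
  exists p : V -> V, [/\ forall x, Q x -> P (p x), forall x, P x -> p x = x &
    forall a x y, Q x -> Q y -> p (a *: x + y) = a *: p x + p y].
Proof.
move=> [P0 PD] [Q0 QD] [s sQ] PQ.
have [|U UP] := @subspace_vspace _ (fun v : 'rV[k]_(size s) => P (comb s v)).
  by split=> [|a u v]; rewrite ?linear0 ?linearP //; apply: PD.
have /choice[c cP] : forall x, exists v : 'rV[k]_(size s), Q x -> x = comb s v.
  move=> x; have [Qx|] := EM (Q x); last by exists 0.
  by have [v] := (lspanP s x).1 (sQ x Qx); exists v.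
exists (fun x => comb s (projv U (c x))); split=> [x Qx|x Px|a x y Qx Qy].
- exact/UP/memv_proj.
- have e := cP x (PQ x Px).
  by rewrite projv_id -?e //; apply/UP; rewrite -e.
have e : comb s (c (a *: x + y) - (a *: c x + c y)) = 0.
  by rewrite linearB linearP /= -!cP ?subrr //; apply: QD.
have : projv U (c (a *: x + y) - (a *: c x + c y)) = c (a *: x + y) - (a *: c x + c y).
  by rewrite projv_id //; apply/UP; rewrite e.
rewrite linearB linearP => /(congr1 (comb s)); rewrite e linearB linearP /=.
by move/eqP; rewrite subr_eq0 => /eqP.
Qed.
End Spans.

Section Restriction.
Variables (k : fieldType) (R : algType k).

(** An alias of [M], so that scaling by [k] does not compete with scaling by
    [R]. *)
Definition kmod (M : lmodType R) : Type := M.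
HB.instance Definition _ (M : lmodType R) := GRing.Zmodule.on (kmod M).
Section KmodScale.
Variable M : lmodType R.
Definition kscale (c : k) (m : kmod M) : kmod M := c%:A *: (m : M).
Fact kscaleA a b m : kscale a (kscale b m) = kscale (a * b) m.
Proof. by rewrite /kscale scalerA -scalerAl mul1r scalerA. Qed.
Fact kscale1 : left_id 1 kscale.
Proof. by move=> m; rewrite /kscale !scale1r. Qed.
Fact kscaleDr : right_distributive kscale +%R.
Proof. by move=> a x y; rewrite /kscale scalerDr. Qed.
Fact kscaleDl m : {morph kscale^~ m : a b / a + b}.
Proof. by move=> a b; rewrite /kscale !scalerDl. Qed.
HB.instance Definition _ := GRing.Zmodule_isLmodule.Build k (kmod M)
  kscaleA kscale1 kscaleDr kscaleDl.
End KmodScale.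

Lemma kscaleE (M : lmodType R) (c : k) (m : kmod M) : c *: m = c%:A *: (m : M) :> M.
Proof. by []. Qed.

Lemma klinear (M N : lmodType R) (f : {linear M -> N}) : linear (f : kmod M -> kmod N).
Proof. by move=> a x y; rewrite (linearP f (a%:A) x y). Qed.

(** Submodules that are told apart by a finite-dimensional subspace [P] have
    bounded chains, with measure the dimension of the intersection with [P]. *)
Lemma artin_of_spanned (M : lmodType R) (P : kmod M -> Prop) : spanned P ->
    (forall N N' : submodClosed M, {subset N <= N'} -> ~ {subset N' <= N} ->
       exists x, [/\ P x, x \in N' & x \notin N]) ->
  artin M.
Proof.
move=> [s sP] sep; pose n := size s.
have /choice[U UP] : forall N : submodClosed M, exists U : {vspace 'rV[k]_n},
    forall v, v \in U <-> (comb s v : M) \in N.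
  move=> N; apply: subspace_vspace; split=> [|a u v uN vN].
    by rewrite linear0 rpred0.
  by rewrite linearP rpredD //; apply: rpredZ.
exists n, (fun N => \dim (U N)); split=> [N|N N' s12 ns].
  apply: leq_trans (dimvS (subvf _)) _.
  by rewrite dimvf /dim /= mul1n.
have sU : (U N <= U N')%VS by apply/subvP=> v /UP/s12/UP.
rewrite ltn_neqAle dimvS // andbT; apply/negP => dE.
have [x [Px xN' /negP]] := sep N N' s12 ns; apply.
have [v xv] := (lspanP s x).1 (sP x Px).
have /eqP UE : U N == U N' by rewrite eqEdim sU (eqP dE) leqnn.
by rewrite xv; apply/UP; rewrite UE; apply/UP; rewrite -xv.
Qed.

Lemma artin_spanned (M : lmodType R) : spanned (fun _ : kmod M => True) -> artin M.
Proof.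
move=> sM; apply: (artin_of_spanned sM) => N N' s12 ns.
have [H|] := EM (forall x, x \in N' -> x \in N); first by case: ns.
by move=> /existsNP[x /not_implyP[xN' /negP xN]]; exists x.
Qed.

(** The images of the powers of the variable are linearly dependent. *)
Lemma spanned_dependent (V : lmodType k) (f : {linear {poly k} -> V}) :
  spanned (fun v => exists2 p, True & f p = v) -> exists2 p : {poly k}, p != 0 & f p = 0.
Proof.
move=> [s sR]; pose n := size s.
have /choice[c cP] : forall i, exists v : 'rV[k]_n, f 'X^i = comb s v.
  by move=> i; apply/lspanP/sR; exists 'X^i.
pose C : 'M[k]_(n.+1, n) := \matrix_(i < n.+1) c i.
have kC : kermx C != 0.
  by rewrite -mxrank_eq0 mxrank_ker -lt0n subn_gt0 (leq_ltn_trans (rank_leq_col _)).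
have [v /sub_kermxP vC v0] := rowV0Pn kC.
exists (rVpoly v).
  by apply: contra v0 => /eqP p0; rewrite -[v]rVpolyK p0 linear0.
have -> : rVpoly v = \sum_(i < n.+1) v 0 i *: 'X^i.
  by rewrite /rVpoly poly_def; apply: eq_bigr => i _; rewrite insubT // => lti; congr (v _ _ *: _); apply/val_inj.
rewrite linear_sum /= (eq_bigr (fun i : 'I_n.+1 => comb s (v 0 i *: c i))).
  rewrite -linear_sum /= -(linear0 (comb s)); congr (comb s _).
  rewrite -[RHS]vC mulmx_sum_row; apply: eq_bigr => i _.
  by rewrite rowK.
by move=> i _; rewrite !linearZ /= cP.
Qed.

Lemma spanned_algebraic (x : R) : spanned (fun _ : R => True) ->
  exists2 p : {poly k}, p != 0 & horner_alg x p = 0.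
Proof.
have hl : linear (horner_alg x : {poly k} -> R).
  by move=> a p q; rewrite rmorphD -mul_polyC rmorphM /= horner_algC mulr_algl.
move=> sR; have [|p p0 pz] := @spanned_dependent R (mklin hl).
  exact: spanned_sub sR.
by exists p.
Qed.
End Restriction.

(** * Split semisimple algebras and their simple modules *)

(** A Casimir element [\sum_i p i (x) q i] whose product is 1 and that commutes
    with the algebra (for the outer actions): averaging over it makes any
    linear map equivariant. *)
Definition casimir (k : fieldType) (R : algType k) :=
  exists n (p q : 'I_n -> R), \sum_i p i * q i = 1 /\
    forall h, exists t : 'I_n -> 'I_n -> k,
      (forall i, h * p i = \sum_j t i j *: p j) /\
      (forall j, q j * h = \sum_i t i j *: q i).

Lemma mxtrace_idem (F : fieldType) n (P : 'M[F]_n) :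
  P *m P = P -> \tr P = (\rank P)%:R.
Proof.
move=> PP; have e : row_base P *m col_base P = 1%:M.
  apply: (row_free_inj (row_base_free P)); rewrite mul1mx.
  apply: (row_full_inj (A := col_base P)); first exact: col_base_full.
  rewrite -(mulmxA (row_base P)) (mulmxA (col_base P)).
  by rewrite !(mulmx_base P) PP.
by rewrite -{1}(mulmx_base P) mxtrace_mulC e mxtrace1.
Qed.

Section TraceForm.
Variables (F : fieldType) (H : falgType F).
Hypothesis char0 : [pchar F] =i pred0.
Hypothesis ss : semisimple_mod (H^o : lmodType H).

Let n := \dim {:H}.
Let b := vbasis {:H}.
Let co i (x : H) : F := coord b i x.

Let coE x : x = \sum_i co i x *: b`_i.
Proof. exact/coord_vbasis/memvf. Qed.

Definition regmx (x : H) : 'M[F]_n := \matrix_(i, j) co j (x * b`_i).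

Let regmx_linear : linear regmx.
Proof.
move=> a x y; apply/matrixP=> i j; rewrite !mxE mulrDl -scalerAl.
by rewrite /co linearD linearZ.
Qed.
HB.instance Definition _ := GRing.isLinear.Build F _ _ _ regmx regmx_linear.

Lemma regmxM x y : regmx (x * y) = regmx y *m regmx x.
Proof.
apply/matrixP=> i j; rewrite !mxE -mulrA {1}(coE (y * b`_i)) mulr_sumr /co linear_sum.
by apply: eq_bigr => l _; rewrite !mxE -scalerAr linearZ.
Qed.

Lemma regmx_eq0 x : regmx x = 0 -> x = 0.
Proof.
move=> /matrixP x0; rewrite -[x]mulr1 [1 in LHS]coE mulr_sumr big1 // => i _.
rewrite -scalerAr (coE (x * _)) big1 ?scaler0 // => j _.
by have := x0 i j; rewrite !mxE => ->; rewrite scale0r.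
Qed.

Let tr x := \tr (regmx x).
Let tr_linear : scalar tr.
Proof. by move=> a x y; rewrite /tr !linearP. Qed.
HB.instance Definition _ := GRing.isLinear.Build F _ _ _ tr tr_linear.
Let trC x y : tr (x * y) = tr (y * x).
Proof. by rewrite /tr !regmxM mxtrace_mulC. Qed.

(** The radical of the trace form is a left ideal, hence generated by an
    idempotent; in characteristic zero an idempotent of trace 0 is 0. *)
Lemma trace_form_nondegenerate x : (forall y, tr (x * y) = 0) -> x = 0.
Proof.
pose P (x : H^o) := forall y : H, tr ((x : H) * y) = 0.
have Ps : subm P.
  split=> [y|a u v Pu Pv y]; first by rewrite mul0r linear0.
  rewrite mulrDl linearD /= Pv addr0 -[a *: u]/(a * u) trC mulrA trC.
  exact: Pu.
have [N' [dj sum]] := ss (mksub Ps).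
have [e [e' [/in_mksub Pe N'e' one]]] := sum (1 : H).
have id x0 : P x0 -> (x0 : H) = x0 * (e : H).
  move=> Px0; suff z : (x0 : H) * (e' : H) = 0.
    by rewrite -{1}[x0 : H]mulr1 [1 in LHS]one mulrDr z addr0.
  apply: dj; last first.
    by have := (subm_in N').2 (x0 : H) e' 0 N'e' (rpred0 _); rewrite addr0.
  have -> : (x0 : H) * (e' : H) = (- (x0 : H)) * (e : H) + x0.
    apply/eqP; rewrite mulNr addrC eq_sym subr_eq.
    by rewrite [X in _ == X]addrC -mulrDr -one mulr1.
  by apply/in_mksub; apply: Ps.2.
move=> Px; rewrite (id x Px); suff -> : (e : H) = 0 by rewrite mulr0.
have := Pe 1; rewrite mulr1 /tr mxtrace_idem -?regmxM -?id //.
move/eqP; rewrite (pcharf0P _).1 // mxrank_eq0 => /eqP.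
exact: regmx_eq0.
Qed.

(** Dual bases for the trace form. *)
Lemma casimir_falg : casimir H.
Proof.
pose G : 'M[F]_n := \matrix_(i, j) tr (b`_i * b`_j).
have Gfree : row_free G.
  rewrite -kermx_eq0; apply/rowV0P => u /sub_kermxP uG.
  pose x := \sum_i u 0 i *: b`_i.
  have x0 : x = 0.
    apply: trace_form_nondegenerate => y; rewrite (coE y) mulr_sumr linear_sum big1 // => j _.
    rewrite -scalerAr linearZ mulr_suml linear_sum /=.
    have /matrixP/(_ 0 j) := uG; rewrite !mxE => uGj.
    rewrite (eq_bigr (fun i => u 0 i * G i j)); first by rewrite uGj mulr0.
    by move=> i _; rewrite -scalerAl linearZ mxE.
  apply/rowP=> i; rewrite mxE; have /freeP : free b by apply/basis_free/vbasisP.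
  by move=> /(_ (u 0) x0 i).
have Gu : G \in unitmx by rewrite -row_free_unit.
pose q (j : 'I_n) : H := \sum_l invmx G l j *: b`_l.
have dual (i j : 'I_n) : tr (b`_i * q j) = (i == j)%:R.
  have /matrixP/(_ i j) := mulmxV Gu; rewrite !mxE => <-.
  rewrite mulr_sumr linear_sum; apply: eq_bigr => l _.
  by rewrite -scalerAr linearZ !mxE mulrC.
have coq (i : 'I_n) x : co i x = tr (x * q i).
  rewrite [in RHS](coE x) mulr_suml linear_sum (bigD1 i) //= big1 => [|j ji].
    by rewrite addr0 -scalerAl linearZ /= dual eqxx mulr1.
  by rewrite -scalerAl linearZ /= dual (negPf ji) mulr0.
have qE x : x = \sum_(i < n) tr (x * b`_i) *: q i.
  apply/eqP; rewrite -subr_eq0; apply/eqP/trace_form_nondegenerate => y.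
  rewrite (coE y) mulr_sumr linear_sum big1 // => j _.
  rewrite -scalerAr linearZ /= mulrBl linearB /= mulr_suml linear_sum /=.
  rewrite (bigD1 j) //= big1 => [|i ij].
    by rewrite addr0 -scalerAl linearZ /= [tr (q j * _)]trC dual eqxx mulr1 subrr mulr0.
  by rewrite -scalerAl linearZ /= [tr (q i * _)]trC dual eq_sym (negPf ij) mulr0.
exists n, (fun i => b`_i), q; split.
  apply/eqP; rewrite -subr_eq0; apply/eqP/trace_form_nondegenerate => y.
  rewrite mulrBl mul1r linearB /= trC mulr_sumr linear_sum /=; apply/eqP; rewrite subr_eq0.
  by apply/eqP/eq_bigr => i _; rewrite mulrA -coq mxE.
move=> h; exists (fun i j => tr (h * b`_i * q j)); split=> [i|j].
  by rewrite {1}(coE (h * b`_i)); apply: eq_bigr => j _; rewrite coq.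
by rewrite {1}(qE (q j * h)); apply: eq_bigr => i _; rewrite -(mulrA (q j)) (trC (q j)).
Qed.
End TraceForm.

Section BaseChange.
Variables (k0 k : fieldType) (sigma : {rmorphism k0 -> k}).

(** The universal property only gives maps out of [W]; applied to the
    coordinate map of [U], it yields coordinates on [W]. *)
Lemma base_change_coords (U : vectType k0) (W : lmodType k)
    (j : {linear U -> W | sigma \; *:%R}) : is_base_change sigma j ->
  exists f : {linear W -> 'rV[k]_(\dim {:U})},
    forall w, w = \sum_i f w 0 i *: j (vbasis {:U})`_i.
Proof.
move=> jb; pose b := vbasis {:U}.
pose g (u : U) : 'rV[k]_(\dim {:U}) := \row_i sigma (coord b i u).
have gl : linear_for (sigma \; *:%R) g.
  by move=> a u v; apply/rowP=> i; rewrite !mxE linearP rmorphD rmorphM.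
pose g' : {linear U -> 'rV[k]_(\dim {:U}) | sigma \; *:%R} :=
  HB.pack g (GRing.isLinear.Build _ _ _ _ g gl).
have [f fE _] := jb _ g'; exists f => w.
pose F (w : W) := \sum_i f w 0 i *: j b`_i.
have Fl : linear F.
  move=> a x y; rewrite /F linearP scaler_sumr -big_split; apply: eq_bigr => i _ /=.
  by rewrite !mxE scalerDl scalerA.
have Fj u : F (j u) = j u.
  rewrite /F fE {2}(coord_vbasis (memvf u)) linear_sum; apply: eq_bigr => i _.
  by rewrite mxE linearZ.
have [f0 _ f0E] := jb W j.
have idl : linear (id : W -> W) by [].
have e1 := f0E (mklin idl) (fun u => erefl) w.
by have e2 := f0E (mklin Fl) Fj w; rewrite -[LHS]/(mklin idl w) e1 -e2.
Qed.

Variables (H0 : falgType k0) (R : algType k) (j : {lrmorphism H0 -> R | sigma \; *:%R}).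
Hypothesis jb : is_base_change sigma j.
Hypothesis cas : casimir H0.

Lemma lrmorphZ a u : j (a *: u) = sigma a *: j u.
Proof. by rewrite linearZ. Qed.

Lemma base_change_span (P : submodClosed R) : (forall u, j u \in P) -> forall w, w \in P.
Proof.
by have [f fE] := base_change_coords jb => jP w; rewrite (fE w) rpred_sum // => i _; apply/rpredZ/jP.
Qed.

Lemma base_change_spanned : spanned (fun _ : R => True).
Proof.
exists [seq j x | x <- vbasis {:H0}] => w _; move: w; apply: base_change_span => u.
rewrite (coord_vbasis (memvf u)) linear_sum; apply: rpred_sum => i _.
rewrite linearZ; apply/rpredZ/genm_gen/map_f/mem_nth.
by rewrite size_tuple.
Qed.

Definition casimir_rel n (p q : 'I_n -> R) (h : R) := exists t : 'I_n -> 'I_n -> k,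
  (forall i, h * p i = \sum_j t i j *: p j) /\ (forall j, q j * h = \sum_i t i j *: q i).

Lemma casimir_rel_sub n (p q : 'I_n -> R) : subm (casimir_rel p q).
Proof.
split=> [|a x y [t [t1 t2]] [u [u1 u2]]].
  exists (fun _ _ => 0); split=> i.
    by rewrite mul0r big1 // => l _; rewrite scale0r.
  by rewrite mulr0 big1 // => l _; rewrite scale0r.
exists (fun i l => a * t i l + u i l); split=> i.
  rewrite mulrDl -scalerAl t1 u1 scaler_sumr -big_split; apply: eq_bigr => l _ /=.
  by rewrite scalerDl scalerA.
rewrite mulrDr -scalerAr t2 u2 scaler_sumr -big_split; apply: eq_bigr => l _ /=.
by rewrite scalerDl scalerA.
Qed.

(** The defining relations hold on the image of [j] and are stable under
    linear combinations. *)
Lemma casimir_base_change : casimir R.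
Proof.
have [n [p [q [pq1 pq]]]] := cas; exists n, (j \o p), (j \o q); split.
  by rewrite -(rmorph1 j) -pq1 rmorph_sum; apply: eq_bigr => i _; rewrite rmorphM.
move=> h; have : h \in mksub (casimir_rel_sub (j \o p) (j \o q)).
  move: h; apply: base_change_span => u; apply/in_mksub.
  have [t [t1 t2]] := pq u; exists (fun i l => sigma (t i l)); split=> i /=.
    by rewrite -rmorphM t1 rmorph_sum; apply: eq_bigr => l _; exact: lrmorphZ.
  by rewrite -rmorphM t2 rmorph_sum; apply: eq_bigr => l _; exact: lrmorphZ.
by move/in_mksub.
Qed.
End BaseChange.

Section CentralScalar.
Variables (k0 : closedFieldType) (k : fieldType) (sigma : {rmorphism k0 -> k}).
Variables (H0 : falgType k0) (R : algType k) (j : {lrmorphism H0 -> R | sigma \; *:%R}).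
Hypothesis jb : is_base_change sigma j.
Hypothesis cas : casimir H0.

Lemma falg_spanned (F : fieldType) (H : falgType F) : spanned (fun _ : H => True).
Proof.
exists (vbasis {:H}) => x _; rewrite (coord_vbasis (memvf x)).
by apply: rpred_sum => i _; apply/rpredZ/genm_gen/mem_nth; rewrite size_tuple.
Qed.

(** Over the closed field [k0] the minimal polynomial of [z] splits, so [z]
    has an eigenvector in [E], and its eigenspace is a submodule. *)
Lemma central_image_scalar (z : H0) (E : lmodType R) : (forall h, h * z = z * h) ->
  simple_mod E -> exists c : k, forall e : E, j z *: e = c%:A *: e.
Proof.
move=> zC Es; have [[e0 e00] _] := Es.
have [p p0 pz] := spanned_algebraic z (falg_spanned H0).
have [s ps] := closed_field_poly_normal p.
have zero : j (\prod_(r <- s) (z - r%:A)) *: e0 = 0.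
  have : horner_alg z (\prod_(r <- s) ('X - r%:P)) = 0.
    have lp : lead_coef p != 0 by rewrite lead_coef_eq0.
    apply: (scalerI lp).
    by move: pz; rewrite {1}ps linearZ /= mulr_algl scaler0.
  rewrite rmorph_prod => /= eq0; rewrite (eq_bigr (fun r => horner_alg z ('X - r%:P))).
    by rewrite eq0 rmorph0 scale0r.
  by move=> r _; rewrite linearB /= horner_algX horner_algC.
have [r [e e_n0 er]] : exists r, exists2 e : E, e != 0 & j (z - r%:A) *: e = 0.
  elim: s e0 e00 {ps} zero => [|r s IH] e0 e00.
    by rewrite big_nil rmorph1 scale1r => e0E; case/eqP: e00.
  rewrite big_cons rmorphM -scalerA => H.
  have [e1|e1] := eqVneq (j (\prod_(r <- s) (z - r%:A)) *: e0) 0; first exact: IH e1.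
  by exists r; exists (j (\prod_(r <- s) (z - r%:A)) *: e0).
exists (sigma r) => e1.
have Cj (w : R) : w * j z = j z * w.
  have Ps : subm (fun w => w * j z = j z * w).
    split=> [|a x y xP yP]; first by rewrite mul0r mulr0.
    by rewrite mulrDl mulrDr -scalerAl -scalerAr xP yP.
  have : w \in mksub Ps; last by move/in_mksub.
  by move: w; apply: (base_change_span jb) => u; apply/in_mksub; rewrite -!rmorphM zC.
have Ks : subm (fun e : E => j z *: e = (sigma r)%:A *: e).
  split=> [|a x y xP yP]; first by rewrite !scaler0.
  by rewrite !scalerDr !scalerA -Cj -!scalerA xP yP !scalerA mulr_algl mulr_algr.
have : e1 \in mksub Ks; last by move/in_mksub.
apply: (simple_sub_all Es (x := e)); last exact/eqP.
have jB : j (z - r%:A) = j z - (sigma r)%:A.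
  by rewrite rmorphB; congr (_ - _); rewrite -[LHS]/(j r%:A) lrmorphZ rmorph1.
apply/in_mksub; move: er; rewrite jB scalerBl => /eqP.
by rewrite subr_eq0 => /eqP.
Qed.

(** Inserting [z] into the Casimir sum writes it as a combination of the
    central elements [\sum_i p i * b * q i] with [b] in [H0], to which
    [central_image_scalar] applies. *)
Lemma central_scalar (z : R) (E : lmodType R) : (forall h, h * z = z * h) ->
  simple_mod E -> exists c : k, forall e : E, z *: e = c%:A *: e.
Proof.
move=> zC Es; have [n [p [q [pq1 pq]]]] := cas.
have [f fE] := base_change_coords jb.
pose b := vbasis {:H0}; pose zz l := \sum_i p i * b`_l * q i.
have zzC l h : h * zz l = zz l * h.
  have [t [t1 t2]] := pq h; rewrite /zz mulr_sumr mulr_suml.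
  transitivity (\sum_i \sum_i' t i i' *: (p i' * b`_l * q i)).
    apply: eq_bigr => i _; rewrite !mulrA t1 !mulr_suml.
    by apply: eq_bigr => i' _; rewrite -!scalerAl.
  rewrite exchange_big; apply: eq_bigr => i' _ /=; rewrite -mulrA t2 mulr_sumr.
  by apply: eq_bigr => i _; rewrite -scalerAr.
have zE : z = \sum_l f z 0 l *: j (zz l).
  have {1}-> : z = \sum_i j (p i) * z * j (q i).
    under eq_bigr do rewrite zC -mulrA -rmorphM.
    by rewrite -mulr_sumr -rmorph_sum pq1 rmorph1 mulr1.
  under eq_bigr do rewrite {1}(fE z) mulr_sumr mulr_suml.
  rewrite exchange_big; apply: eq_bigr => l _; rewrite rmorph_sum scaler_sumr /=.
  by apply: eq_bigr => i _; rewrite -scalerAr -scalerAl -!rmorphM.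
have /choice[c cP] : forall l, exists c : k, forall e : E, j (zz l) *: e = c%:A *: e.
  by move=> l; apply: central_image_scalar.
exists (\sum_l f z 0 l * c l) => e; rewrite {1}zE scaler_suml scaler_suml scaler_suml.
apply: eq_bigr => l _; rewrite -[_ *: j _]mulr_algl -[LHS]scalerA cP.
by rewrite [LHS]scalerA mulr_algl scalerA.
Qed.
End CentralScalar.

Section CasimirModules.
Variables (k : fieldType) (R : algType k).
Hypothesis Rsp : spanned (fun _ : R => True).
Hypothesis cas : casimir R.

Lemma spanned_cyclic (M : lmodType R) (v : M) :
  spanned (fun w : kmod M => exists h : R, h *: v = w).
Proof.
have fl : linear ((fun h => h *: v) : R -> kmod M).
  by move=> a x y; rewrite scalerDl kscaleE scalerA mulr_algl.
by apply: spanned_sub (spanned_linear (mklin fl) Rsp) => _ [h <-]; exists h.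
Qed.

(** Maschke: averaging a linear projection over the Casimir element. *)
Lemma maschke (M : lmodType R) (P Q : submodClosed M) :
    spanned (fun x : kmod M => x \in Q) -> {subset P <= Q} ->
  exists r : M -> M, [/\ forall x, x \in Q -> r x \in P, forall x, x \in P -> r x = x &
    forall h x y, x \in Q -> y \in Q -> r (h *: x + y) = h *: r x + r y].
Proof.
move=> Qs PQ.
have ks (N : submodClosed M) : subm (fun x : kmod M => x \in N).
  by split=> [|a x y xN yN]; [apply: (subm_in N).1|apply: (subm_in N).2].
have [r0 [r0P r0id r0l]] := fd_proj (ks P) (ks Q) Qs PQ.
have [n [p [q [pq1 pq]]]] := cas.
have r0D (x y : M) : x \in Q -> y \in Q -> r0 (x + y) = r0 x + r0 y.
  by move=> xQ yQ; have := r0l 1 x y xQ yQ; rewrite !scale1r.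
have r00 : r0 0 = 0 by apply: r0id; apply: (subm_in P).1.
have r0Z (a : k) (x : M) : x \in Q -> r0 (a%:A *: x) = a%:A *: r0 x.
  by move=> xQ; have := r0l a x 0 xQ (rpred0 Q); rewrite r00 !addr0.
pose r (x : M) : M := \sum_i p i *: (r0 (q i *: x) : M).
have rD (x y : M) : x \in Q -> y \in Q -> r (x + y) = r x + r y.
  move=> xQ yQ; rewrite /r -big_split; apply: eq_bigr => i _ /=.
  by rewrite scalerDr r0D ?rpredZ // scalerDr.
exists r; split=> [x xQ|x xP|h x y xQ yQ].
- by apply: rpred_sum => i _; apply/rpredZ/r0P/rpredZ.
- rewrite /r -[RHS]scale1r -pq1 scaler_suml; apply: eq_bigr => i _.
  by rewrite r0id ?scalerA //; apply: rpredZ.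
rewrite rD ?rpredZ //; congr (_ + _); have [t [t1 t2]] := pq h.
transitivity (\sum_i \sum_j t j i *: p i *: (r0 (q j *: x) : M)).
  apply: eq_bigr => i _; rewrite scalerA t2 scaler_suml.
  rewrite (_ : r0 _ = \sum_j (t j i)%:A *: (r0 (q j *: x) : M)).
    rewrite scaler_sumr; apply: eq_bigr => j _.
    by rewrite [LHS]scalerA mulr_algr.
  elim: (index_enum _) => [|j s IH]; first by rewrite !big_nil.
  rewrite !big_cons r0D ?IH; last by apply: rpred_sum => l _; apply: rpredZ.
    by congr (_ + _); rewrite -r0Z ?rpredZ // scalerA mulr_algl.
  exact: rpredZ.
rewrite exchange_big /r scaler_sumr; apply: eq_bigr => j _ /=.
by rewrite scalerA t1 scaler_suml.
Qed.

(** A simple module is a direct summand of the algebra, hence projective. *)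
Lemma simple_section (E : lmodType R) : simple_mod E ->
  exists e : E, exists t : {linear E -> R^o}, forall x, (t x : R) *: e = x.
Proof.
move=> Es; have [[e e0] _] := Es; exists e.
have fl : linear ((fun h : R => h *: e) : R^o -> E).
  by move=> a x y; rewrite scalerDl scalerA.
pose f : {linear R^o -> E} := mklin fl.
have fs : surj f by apply: (@simple_surj _ _ _ f 1) => //; apply/eqP; rewrite /= scale1r.
have Qs : spanned (fun x : kmod (R^o : lmodType R) => x \in fullm (R^o : lmodType R)).
  have gl : linear (id : R -> kmod (R^o : lmodType R)).
    by move=> a x y; rewrite kscaleE -[_%:A *: _]/(_%:A * _) mulr_algl.
  by apply: spanned_sub (spanned_linear (mklin gl) Rsp) => x _; exists x.
have [|r [rP rid rl]] := @maschke R^o (kerm f) (fullm _) Qs.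
  by move=> x _; apply/in_mksub.
have Q x : x \in fullm (R^o : lmodType R) by apply/in_mksub.
have gl : linear ((fun h => h - r h) : R^o -> R^o).
  by move=> a x y; rewrite rl // scalerBr opprD addrACA.
have [|t tE] := @factor_surj _ _ _ _ f (mklin gl) fs.
  by move=> x fx /=; rewrite rid ?subrr //; apply/in_mksub.
exists t => x; have [h <-] := fs x; rewrite tE /= scalerBl.
have /in_mksub /= -> := rP h (Q h).
by rewrite subr0.
Qed.

Lemma artin_cyclic (M : lmodType R) (v : M) : (forall w, exists h : R, w = h *: v) -> artin M.
Proof.
move=> Mv; apply: artin_spanned; apply: spanned_sub (spanned_cyclic v) => w _.
by have [h ->] := Mv w; exists h.
Qed.

Lemma exists_simple_sub (M : lmodType R) (N : submodClosed M) (v : M) : v \in N -> v <> 0 ->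
  exists (X : lmodType R) (g : {linear X -> M}),
    [/\ simple_mod X, injective g & forall x, g x \in N].
Proof.
move=> vN v0.
have Vs : subm (fun w => exists h : R, w = h *: v).
  split=> [|a x y [h ->] [h' ->]]; first by exists 0; rewrite scale0r.
  by exists (a * h + h'); rewrite scalerDl scalerA.
pose V := mksub Vs.
have vV : v \in V by apply/in_mksub; exists 1; rewrite scale1r.
have aV : artin (sub_mod V).
  have [v' v'E] := in_incl vV; apply: (@artin_cyclic _ v') => w.
  have /in_mksub[h wE] := incl_in w; exists h; apply: (@incl_inj _ _ V).
  by rewrite linearZ v'E.
have [|P [y yP y0] Pmin] := @artin_min _ _ (fun P : submodClosed (sub_mod V) => exists2 y, y \in P & y <> 0) (fullm _) aV.
  have [v' v'E] := in_incl vV; exists v'; first exact/in_mksub.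
  by move=> z; apply: v0; rewrite -v'E z linear0.
exists (sub_mod P), (incl V \o incl P); split=> [|x z /incl_inj/incl_inj //|x /=].
  have [y' y'E] := in_incl yP.
  split; first by exists y'; apply/eqP => z; apply: y0; rewrite -y'E z linear0.
  move=> N'; have [H|] := EM (forall x, x \in N' -> x = 0); first by left.
  move=> /existsNP[x /not_implyP[xN' x0]]; right=> z.
  have /in_mksub[z' z'N] : incl P z \in imm (incl P) N'.
    apply: (Pmin (imm (incl P) N')); last exact: incl_in.
      exists (incl P x); first by apply/in_mksub; exists x.
      by move=> /(inj_linear0 (@incl_inj _ _ _)).
    by move=> _ /in_mksub[u _ <-]; apply: incl_in.
  by move=> /incl_inj <-.
have /in_mksub[h e] := incl_in (incl P x).
change (incl V (incl P x) \in N); rewrite e; exact: rpredZ.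
Qed.

(** Each simple module occurs in a composition series of the algebra, at a
    place that determines it. *)
Lemma finite_irr (I : Type) (Irr : I -> lmodType R) :
    simple_representatives (fun _ => True) Irr ->
  exists n (l : I -> 'I_n), injective l.
Proof.
move=> [IrrS IrrI _].
have aR : artin (R^o : lmodType R).
  by apply: (@artin_cyclic _ (1 : R^o)) => w; exists w; rewrite -[RHS]/(_ * 1) mulr1.
have [n [F [[F0 Fn Fm] FS]]] := artin_finite_length aR.
have H i : exists (l : 'I_n), forall X, simple_mod X -> subquotient (F l) (F l.+1) X -> mod_iso X (Irr i).
  have [_ Es] := IrrS i; have [[e e0] _] := Es.
  have fl : linear ((fun h : R => h *: e) : R^o -> Irr i).
    by move=> a x y; rewrite scalerDl scalerA.
  pose f : {linear R^o -> Irr i} := mklin fl.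
  pose nz m := `[< exists2 x, x \in F m & f x <> 0 >].
  have exnz : exists m, nz m.
    exists n; apply/asboolP; exists 1; first exact: Fn.
    by apply/eqP; rewrite /= scale1r.
  have [[|l] /asboolP[x xF fx0] lmin] := ex_minnP exnz.
    by case: fx0; rewrite (F0 x xF) linear0.
  have ln : (l < n)%N.
    by apply: lmin; apply/asboolP; exists 1; [apply: Fn|apply/eqP; rewrite /= scale1r].
  have Fl0 y : y \in F l -> f y = 0.
    move=> yF; apply: contrapT => fy0; suff : (l.+1 <= l)%N by rewrite ltnn.
    by apply: lmin; apply/asboolP; exists y.
  exists (Ordinal ln) => X Xs /= [_ [g [gs gk]]].
  have [|h hE] := @factor_surj _ _ _ _ g (f \o incl (F l.+1)) gs.
    by move=> y /gk/Fl0.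
  have [x' x'E] := in_incl xF.
  have h0 : h (g x') <> 0 by rewrite hE -[X in X <> _]/(f (incl _ x')) x'E.
  by exists h; apply: inj_surj_bij; [apply: (simple_inj Xs h0)|apply: (simple_surj Es h0)].
have [l lP] := choice H; exists n, l => i i' ll.
have [X Xs Xsq] := FS (l i) (ltn_ord _).
apply: IrrI; apply: mod_iso_trans (lP i' X Xs _); last by rewrite -ll.
exact/mod_iso_sym/lP.
Qed.
End CasimirModules.

(** * The triangular decomposition *)

Section Triangular.
Variables (k0 : closedFieldType) (k : fieldType) (sigma : {rmorphism k0 -> k}).
Hypothesis k_char0 : [pchar k] =i pred0.
Variables (A : algType k) (H0 : falgType k0) (T : triangular_algebra sigma A H0).
Local Notation G := (gr T).
Local Notation B := (Bm T).
Local Notation C := (Bbar T).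
Local Notation H := (Hs T).
Let grP := gr_is_grading T.

Lemma gr_subm i : subm (fun x => x \in G i).
Proof. exact: gr_submod grP i. Qed.
Lemma gr0 i : 0 \in G i. Proof. exact: (gr_subm i).1. Qed.
Lemma grD i x y : x \in G i -> y \in G i -> x + y \in G i.
Proof. by move=> xi yi; have := (gr_subm i).2 1 x y xi yi; rewrite scale1r. Qed.
Lemma grZ i c x : x \in G i -> c *: x \in G i.
Proof. by move=> xi; have := (gr_subm i).2 c x 0 xi (gr0 i); rewrite addr0. Qed.
Lemma grM i j l x y : x \in G i -> y \in G j -> l = i + j -> x * y \in G l.
Proof. by move=> xi yj ->; apply: gr_mul. Qed.

Lemma sum_supp (s t : seq int) (x : int -> A) : uniq s -> uniq t ->
    {subset s <= t} -> (forall i, i \notin s -> x i = 0) ->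
  \sum_(i <- t) x i = \sum_(i <- s) x i.
Proof.
move=> us ut st xs; rewrite (bigID (mem s)) /= [X in _ + X]big1 ?addr0 //.
rewrite -big_filter; apply/perm_big/uniq_perm; rewrite ?filter_uniq // => i.
by rewrite mem_filter; apply/andP/idP => [[]//|is_]; split=> //; apply: st.
Qed.

(** [x] is the family of homogeneous components of [a]. *)
Definition hdec (a : A) (x : int -> A) := exists s, [/\ uniq s,
  forall i, x i \in G i, forall i, i \notin s -> x i = 0 & a = \sum_(i <- s) x i].

Lemma hdecP a b x y c : hdec a x -> hdec b y -> hdec (c *: a + b) (fun i => c *: x i + y i).
Proof.
move=> [s [us xG x0 ->]] [t [ut yG y0 ->]]; exists (undup (s ++ t)).
split=> [|i|i|]; first exact: undup_uniq; first exact: grD (grZ _ _) _.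
  by rewrite mem_undup mem_cat negb_or => /andP[/x0-> /y0->]; rewrite scaler0 addr0.
rewrite big_split -scaler_sumr /=; congr (_ *: _ + _); apply/esym/sum_supp; rewrite ?undup_uniq //.
  by move=> i; rewrite mem_undup mem_cat => ->.
by move=> i; rewrite mem_undup mem_cat orbC => ->.
Qed.

Lemma hdec_uniq a x y : hdec a x -> hdec a y -> x =1 y.
Proof.
move=> xa ya i; have [s [us xG x0]] := hdecP (-1) xa ya.
rewrite scaleN1r addNr => /esym eq0.
have : -1 *: x i + y i = 0.
  have [is_|/x0 //] := boolP (i \in s).
  exact: (gr_indep grP us xG eq0).
by rewrite scaleN1r addrC => /eqP; rewrite subr_eq0 => /eqP.
Qed.

Lemma hdec1 i x : x \in G i -> hdec x (fun j => if j == i then x else 0).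
Proof.
move=> xi; exists [:: i]; rewrite big_seq1 eqxx; split=> // j.
  by case: eqP => [->|]; rewrite ?gr0.
by rewrite inE => /negPf->.
Qed.

Lemma gr_ind (P : A -> Prop) : P 0 -> (forall x y, P x -> P y -> P (x + y)) ->
  (forall i x, x \in G i -> P x) -> forall a, P a.
Proof.
move=> P0 PD PG a; have [s [sG ->]] := gr_span grP a.
rewrite big_seq; elim/big_ind: _ => // x /sG[i]; exact: PG.
Qed.

Lemma hdec_ex a : exists x, hdec a x.
Proof.
move: a; apply: gr_ind => [|a b [x xa] [y yb]|i x xi]; last by eexists; apply: hdec1 xi.
  by exists (fun=> 0), [::]; rewrite big_nil; split=> // i; apply: gr0.
by exists (fun i => 1 *: x i + y i); rewrite -[a]scale1r; apply: hdecP.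
Qed.

Definition hcf i a := xget (fun=> 0) (hdec a) i.
Lemma hcfP a : hdec a (hcf^~ a).
Proof.
rewrite /hcf; case: xgetP => [x _ //|no]; have [x xa] := hdec_ex a.
by case: (no x).
Qed.
Lemma hcf_linear i : linear (hcf i).
Proof. by move=> c a b; apply: (hdec_uniq (hcfP _) (hdecP c (hcfP a) (hcfP b))). Qed.

(** The homogeneous component of degree [i]. *)
Definition hc i : {linear A -> A} := mklin (hcf_linear i).

Lemma hc_in i a : hc i a \in G i.
Proof. by have [s [_ h _ _]] := hcfP a; apply: h. Qed.
Lemma hc_id i a : a \in G i -> hc i a = a.
Proof. by move=> ai; rewrite /= (hdec_uniq (hcfP a) (hdec1 ai)) eqxx. Qed.
Lemma hc_neq i j a : a \in G j -> i != j -> hc i a = 0.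
Proof. by move=> aj ij; rewrite /= (hdec_uniq (hcfP a) (hdec1 aj)) (negPf ij). Qed.

Lemma hc_mull i j a b : a \in G j -> hc i (a * b) = a * hc (i - j) b.
Proof.
move=> aj; move: b; apply: gr_ind => [|x y IHx IHy|l x xl].
- by rewrite mulr0 !linear0 mulr0.
- by rewrite mulrDr !linearD mulrDr IHx IHy.
have [il|il] := eqVneq i (j + l).
  by rewrite il addrAC subrr add0r !hc_id //; apply: grM aj xl erefl.
rewrite (@hc_neq i (j + l)) //; last exact: grM aj xl erefl.
by rewrite (@hc_neq _ l) ?mulr0 // subr_eq addrC.
Qed.

Lemma hc_mulr i j a b : b \in G j -> hc i (a * b) = hc (i - j) a * b.
Proof.
move=> bj; move: a; apply: gr_ind => [|x y IHx IHy|l x xl].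
- by rewrite mul0r !linear0 mul0r.
- by rewrite mulrDl !linearD mulrDl IHx IHy.
have [il|il] := eqVneq i (l + j).
  by rewrite il addrK !hc_id //; apply: grM xl bj erefl.
rewrite (@hc_neq i (l + j)) //; last exact: grM xl bj erefl.
by rewrite (@hc_neq _ l) ?mul0r // subr_eq.
Qed.

(** Degree [i] in [Bbar], and degree [- i] in [B]: both are indexed by
    naturals. *)
Definition Cd (i : nat) x := x \in C /\ x \in G i%:Z.
Definition Bd (i : nat) x := x \in B /\ x \in G (- i%:Z).

Lemma Hgr h : h \in H -> h \in G 0. Proof. exact: tri_H_gr. Qed.
Lemma one_gr : 1 \in G 0. Proof. exact: gr_one grP. Qed.

Lemma C_ind (P : A -> Prop) : P 0 -> (forall x y, P x -> P y -> P (x + y)) ->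
  (forall i x, Cd i x -> P x) -> forall a, a \in C -> P a.
Proof.
move=> P0 PD PG a /(@tri_Bbar_gr _ _ _ _ _ T)[s [sG ->]].
rewrite big_seq; elim/big_ind: _ => // x /sG[i]; exact: PG.
Qed.
Lemma B_ind (P : A -> Prop) : P 0 -> (forall x y, P x -> P y -> P (x + y)) ->
  (forall i x, Bd i x -> P x) -> forall a, a \in B -> P a.
Proof.
move=> P0 PD PG a /(@tri_B_gr _ _ _ _ _ T)[s [sG ->]].
rewrite big_seq; elim/big_ind: _ => // x /sG[i]; exact: PG.
Qed.

Lemma spanCHB_subproof : subm (fin_sum (fun a => exists x h b,
  [/\ x \in C, h \in H, b \in B & a = x * h * b])).
Proof.
split=> [|c x y xP yP]; first exact: fin_sum0.
apply: fin_sumD => //; move: x xP; apply: fin_sum_map => [|x z|_ [x [h [b [xC hH bB ->]]]]].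
- by rewrite scaler0.
- by rewrite scalerDr.
apply: fin_sum1; exists (c *: x), h, b; split=> //; first exact: rpredZ.
by rewrite !scalerAl.
Qed.

Lemma CHB_span a : fin_sum (fun a => exists x h b,
  [/\ x \in C, h \in H, b \in B & a = x * h * b]) a.
Proof.
pose N := mksub spanCHB_subproof.
have [|||f _ fE] := @tri_iso _ _ _ _ _ T (quot_mod N) (fun _ _ _ => 0).
- by move=> ? ? c x y; rewrite scaler0 addr0.
- by move=> ? ? c x y; rewrite scaler0 addr0.
- by move=> ? ? c x y; rewrite scaler0 addr0.
have zl : linear (fun _ : A => 0 : quot_mod N) by move=> c x y; rewrite scaler0 addr0.
suff /qpi_eq0/in_mksub : qpi N a = 0 by [].
rewrite (fE (qpi N)).
  by rewrite -(fE (mklin zl)).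
move=> x h b; apply/qpi_eq0/in_mksub/fin_sum1; exists (x : A), (h : A), (b : A); split=> //; exact: valP.
Qed.

Lemma tri_ind (P : A -> Prop) : P 0 -> (forall x y, P x -> P y -> P (x + y)) ->
  (forall i j x h b, Cd i x -> h \in H -> Bd j b -> P (x * h * b)) -> forall a, P a.
Proof.
move=> P0 PD PG a; have [s [sG ->]] := CHB_span a.
rewrite big_seq; elim/big_ind: _ => // _ /sG[x [h [b [xC hH bB ->]]]].
move: x xC; apply: C_ind => [|x y|i x xi]; rewrite ?mul0r ?mulrDl //; first exact: PD.
move: b bB; apply: B_ind => [|b c|j b bj]; rewrite ?mulr0 ?mulrDr //; first exact: PD.
exact: PG xi hH bj.
Qed.

Lemma tri_map (V : lmodType k) (phi : A -> A -> A -> V) :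
    (forall y z, linear (fun x => phi x y z)) -> (forall x z, linear (fun y => phi x y z)) ->
    (forall x y, linear (fun z => phi x y z)) ->
  exists f : {linear A -> V}, forall x h b, x \in C -> h \in H -> b \in B ->
    f (x * h * b) = phi x h b.
Proof.
move=> l1 l2 l3.
have [|||f fE _] := @tri_iso _ _ _ _ _ T V (fun x y z => phi (x : A) (y : A) (z : A)).
- by move=> y z c u v; apply: l1.
- by move=> y z c u v; apply: l2.
- by move=> y z c u v; apply: l3.
by exists f => x h b xC hH bB; apply: (fE (SubAlg xC) (SubAlg hH) (SubAlg bB)).
Qed.

(** [tpi] projects [A] onto [Bbar H] along [A B^{>0}], and [tpi'] onto [H B]
    along [Bbar_{>0} A]. *)
Lemma tpi_ex : exists f : {linear A -> A}, forall x h b, x \in C -> h \in H -> b \in B ->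
  f (x * h * b) = x * h * hc 0 b.
Proof.
apply: tri_map => [y z|x z|x y] c u v; rewrite ?linearP ?mulrDl ?mulrDr ?mulrDl.
- by rewrite -!scalerAl.
- by rewrite -!scalerAr -!scalerAl.
- by rewrite -!scalerAr.
Qed.
Lemma tpi'_ex : exists f : {linear A -> A}, forall x h b, x \in C -> h \in H -> b \in B ->
  f (x * h * b) = hc 0 x * h * b.
Proof.
apply: tri_map => [y z|x z|x y] c u v; rewrite ?linearP ?mulrDl ?mulrDr ?mulrDl.
- by rewrite -!scalerAl.
- by rewrite -!scalerAr -!scalerAl.
- by rewrite -!scalerAr.
Qed.
Definition tpi := projT1 (cid tpi_ex).
Definition tpi' := projT1 (cid tpi'_ex).
Lemma tpiE x h b : x \in C -> h \in H -> b \in B -> tpi (x * h * b) = x * h * hc 0 b.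
Proof. exact: (projT2 (cid tpi_ex)). Qed.
Lemma tpi'E x h b : x \in C -> h \in H -> b \in B -> tpi' (x * h * b) = hc 0 x * h * b.
Proof. exact: (projT2 (cid tpi'_ex)). Qed.

Lemma Cd_C i x : Cd i x -> x \in C. Proof. by case. Qed.
Lemma Bd_B i x : Bd i x -> x \in B. Proof. by case. Qed.
Lemma Cd_G i x : Cd i x -> x \in G i%:Z. Proof. by case. Qed.
Lemma Bd_G i x : Bd i x -> x \in G (- i%:Z). Proof. by case. Qed.
Hint Resolve Cd_C Bd_B Cd_G Bd_G : core.

Lemma HC_CH h x : h \in H -> x \in C -> mul_span C H (h * x).
Proof.
by have [_ _ e] := tri_HBbar T => hH xC; apply/e/fin_sum1; exists h, x.
Qed.
Lemma BH_HB b h : b \in B -> h \in H -> mul_span H B (b * h).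
Proof.
by have [_ _ e] := tri_BH T => hH xC; apply/e/fin_sum1; exists b, h.
Qed.

Lemma tpi_C x a : x \in C -> tpi (x * a) = x * tpi a.
Proof.
move=> xC; move: a; apply: tri_ind => [|a b|i j y h b /Cd_C yC hH /Bd_B bB].
- by rewrite mulr0 linear0 mulr0.
- by rewrite mulrDr !linearD mulrDr => -> ->.
by rewrite !mulrA !tpiE ?rpredM // !mulrA.
Qed.

Lemma tpi_H h a : h \in H -> tpi (h * a) = h * tpi a.
Proof.
move=> hH; move: a; apply: tri_ind => [|a b|i j y g b /Cd_C yC gH /Bd_B bB].
- by rewrite mulr0 linear0 mulr0.
- by rewrite mulrDr !linearD mulrDr => -> ->.
rewrite tpiE // !mulrA; have [s [sP ->]] := HC_CH hH yC.
rewrite !mulr_suml linear_sum; rewrite !big_seq; apply: eq_bigr => _ /sP[x [l [xC lH ->]]].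
by rewrite -[x * l * g]mulrA tpiE ?rpredM // mulrA.
Qed.

Lemma hc0_Bd j b : Bd j.+1 b -> hc 0 b = 0.
Proof. by move=> bj; rewrite (hc_neq (Bd_G bj)) // eq_sym oppr_eq0. Qed.
Lemma hc0_Cd j b : Cd j.+1 b -> hc 0 b = 0.
Proof. by move=> bj; rewrite (hc_neq (Cd_G bj)). Qed.

Lemma tpi_B a j b : Bd j.+1 b -> tpi (a * b) = 0.
Proof.
move=> [bB bj]; move: a; apply: tri_ind => [|x y|i l y g c /Cd_C yC gH cl].
- by rewrite mul0r linear0.
- by rewrite mulrDl !linearD => -> ->; rewrite addr0.
rewrite -mulrA tpiE ?rpredM //; last exact: Bd_B cl.
rewrite (@hc_neq _ (- (l + j.+1)%:Z)) ?mulr0 //.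
  by apply: (grM (Bd_G cl) bj); rewrite PoszD opprD.
by rewrite eq_sym oppr_eq0 addnS.
Qed.

Lemma tpi_rH a h : h \in H -> tpi (a * h) = tpi a * h.
Proof.
move=> hH; move: a; apply: tri_ind => [|x y|i l y g c /Cd_C yC gH /Bd_B cB].
- by rewrite mul0r linear0 mul0r.
- by rewrite mulrDl !linearD mulrDl => -> ->.
have e : hc 0 c * h = hc 0 (c * h) by rewrite (hc_mulr _ _ (Hgr hH)) subr0.
rewrite (tpiE yC gH cB) -[RHS]mulrA e -[y * g * c * h]mulrA.
have [s [sP ->]] := BH_HB cB hH.
rewrite !mulr_sumr !linear_sum mulr_sumr !big_seq; apply: eq_bigr => _ /sP[x [b [xH bB ->]]].
by rewrite mulrA -[y * g * x]mulrA tpiE ?rpredM // (hc_mull _ _ (Hgr xH)) subr0 !mulrA.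
Qed.

Lemma tpi_1 : tpi 1 = 1.
Proof.
have := @tpiE 1 1 1; rewrite !mul1r hc_id ?one_gr // => -> //; exact: rpred1.
Qed.


Lemma tpi_hc i a : hc i (tpi a) = tpi (hc i a).
Proof.
move: a; apply: tri_ind => [|x y|j l x h b xj hH bl].
- by rewrite !linear0.
- by rewrite !linearD => -> ->.
have bB := Bd_B bl; have xC := Cd_C xj.
have g : x * h * b \in G (j%:Z - l%:Z).
  by apply: (grM (grM (Cd_G xj) (Hgr hH) erefl) (Bd_G bl)); rewrite addr0.
rewrite tpiE //; case: l bl g => [|l] bl g.
  rewrite [hc 0 b]hc_id; last by have := Bd_G bl; rewrite oppr0.
  have [il|il] := eqVneq i (j%:Z - 0%:Z).
    by subst i; rewrite !hc_id // tpiE // hc_id //; have := Bd_G bl; rewrite oppr0.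
  by rewrite !(hc_neq g il) linear0.
rewrite (hc0_Bd bl) mulr0 linear0.
have [il|il] := eqVneq i (j%:Z - l.+1%:Z); last by rewrite (hc_neq g il) linear0.
by subst i; rewrite hc_id // tpiE // (hc0_Bd bl) mulr0.
Qed.

Lemma tpi'_B b a : b \in B -> tpi' (a * b) = tpi' a * b.
Proof.
move=> bB; move: a; apply: tri_ind => [|x y|i j x h c /Cd_C xC hH /Bd_B cB].
- by rewrite mul0r linear0 mul0r.
- by rewrite mulrDl !linearD mulrDl => -> ->.
by rewrite -!mulrA [h * _]mulrA !mulrA -[_ * c * b]mulrA !tpi'E ?rpredM // !mulrA.
Qed.

Lemma tpi'_rH a h : h \in H -> tpi' (a * h) = tpi' a * h.
Proof.
move=> hH; move: a; apply: tri_ind => [|x y|i l y g c /Cd_C yC gH /Bd_B cB].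
- by rewrite mul0r linear0 mul0r.
- by rewrite mulrDl !linearD mulrDl => -> ->.
rewrite (tpi'E yC gH cB) -[RHS]mulrA -[y * g * c * h]mulrA.
have [s [sP ->]] := BH_HB cB hH.
rewrite !mulr_sumr !linear_sum !big_seq; apply: eq_bigr => _ /sP[x [b [xH bB ->]]].
by rewrite mulrA -[y * g * x]mulrA tpi'E ?rpredM // !mulrA.
Qed.

Lemma tpi'_C x j a : Cd j.+1 x -> tpi' (x * a) = 0.
Proof.
move=> [xC xj]; move: a; apply: tri_ind => [|y z|i l y g c yi gH /Bd_B cB].
- by rewrite mulr0 linear0.
- by rewrite mulrDr !linearD => -> ->; rewrite addr0.
have yC := Cd_C yi; rewrite !mulrA tpi'E ?rpredM // (@hc0_Cd (j + i)) ?mul0r //.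
by split; [apply: rpredM|apply: (grM xj (Cd_G yi))].
Qed.

Lemma tpi'_1 : tpi' 1 = 1.
Proof.
have := @tpi'E 1 1 1; rewrite !mulr1 hc_id ?one_gr // => -> //; exact: rpred1.
Qed.

Lemma tpi'_u b h : b \in B -> h \in H -> tpi' (b * h) = b * h.
Proof. by move=> bB hH; rewrite tpi'_rH // -{1}[b]mul1r tpi'_B // tpi'_1 mul1r. Qed.

Lemma tpi'_hc i a : hc i (tpi' a) = tpi' (hc i a).
Proof.
move: a; apply: tri_ind => [|x y|j l x h b xj hH bl].
- by rewrite !linear0.
- by rewrite !linearD => -> ->.
have bB := Bd_B bl; have xC := Cd_C xj.
have g : x * h * b \in G (j%:Z - l%:Z).
  by apply: (grM (grM (Cd_G xj) (Hgr hH) erefl) (Bd_G bl)); rewrite addr0.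
rewrite tpi'E //; case: j xj g => [|j] xj g.
  rewrite [hc 0 x]hc_id; last exact: Cd_G xj.
  have [il|il] := eqVneq i (0%:Z - l%:Z); last by rewrite !(hc_neq g il) linear0.
  by subst i; rewrite !hc_id // tpi'E // hc_id //; apply: Cd_G xj.
rewrite (hc0_Cd xj) !mul0r linear0.
have [il|il] := eqVneq i (j.+1%:Z - l%:Z); last by rewrite (hc_neq g il) linear0.
by subst i; rewrite hc_id // tpi'E // (hc0_Cd xj) !mul0r.
Qed.

Lemma hc0_B b : b \in B -> exists c : k, hc 0 b = c%:A.
Proof.
move: b; apply: B_ind => [|b b' [c cE] [c' cE']|[|i] b bi].
- by exists 0; rewrite linear0 scale0r.
- by exists (c + c'); rewrite linearD cE cE' scalerDl.
- by have [bB] := bi; rewrite oppr0 => b0; rewrite hc_id //; apply: (tri_B0 (t := T)).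
by exists 0; rewrite (hc0_Bd bi) scale0r.
Qed.

Lemma hc0_C x : x \in C -> exists c : k, hc 0 x = c%:A.
Proof.
move: x; apply: C_ind => [|b b' [c cE] [c' cE']|[|i] b bi].
- by exists 0; rewrite linear0 scale0r.
- by exists (c + c'); rewrite linearD cE cE' scalerDl.
- by have [bB b0] := bi; rewrite hc_id //; apply: (tri_Bbar0 (t := T)).
by exists 0; rewrite (hc0_Cd bi) scale0r.
Qed.

Lemma kH (c : k) : c%:A \in H. Proof. by apply/rpredZ/rpred1. Qed.

Lemma tpi_span (n : nat) a :
  fin_sum (fun z => exists x h, [/\ Cd n x, h \in H & z = x * h]) (hc n%:Z (tpi a)).
Proof.
move: a; apply: tri_ind => [|x y|j l x h b xj hH /Bd_B bB].
- by rewrite !linear0; apply: fin_sum0.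
- by rewrite !linearD; apply: fin_sumD.
rewrite tpiE //; last exact: Cd_C xj.
have [c ->] := hc0_B bB; have hc' : h * c%:A \in H by rewrite rpredM ?kH.
rewrite -mulrA.
have g : x * (h * c%:A) \in G j%:Z by apply: (grM (Cd_G xj) (Hgr hc')); rewrite addr0.
have [/eqP nj|nj] := eqVneq n%:Z j%:Z; last by rewrite (hc_neq g nj); apply: fin_sum0.
move: nj g; rewrite eqz_nat => /eqP -> g.
by rewrite hc_id //; apply: fin_sum1; exists x, (h * c%:A).
Qed.

Lemma tpi'_span (n : nat) a :
  fin_sum (fun z => exists h b, [/\ h \in H, Bd n b & z = h * b]) (hc (- n%:Z) (tpi' a)).
Proof.
move: a; apply: tri_ind => [|x y|j l x h b xj hH bl].
- by rewrite !linear0; apply: fin_sum0.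
- by rewrite !linearD; apply: fin_sumD.
rewrite tpi'E //; [|exact: Cd_C xj|exact: Bd_B bl].
have [c ->] := hc0_C (Cd_C xj); have hc' : c%:A * h \in H by rewrite rpredM ?kH.
have g : c%:A * h * b \in G (- l%:Z) by apply: (grM (Hgr hc') (Bd_G bl)); rewrite add0r.
have [/eqP nj|nj] := eqVneq (- n%:Z) (- l%:Z); last by rewrite (hc_neq g nj); apply: fin_sum0.
move: nj g; rewrite eqr_opp eqz_nat => /eqP -> g.
by rewrite hc_id //; apply: fin_sum1; exists (c%:A * h), b.
Qed.

Lemma tpi_neg (n : nat) a : hc (- n.+1%:Z) (tpi a) = 0.
Proof.
move: a; apply: tri_ind => [|x y|j l x h b xj hH /Bd_B bB].
- by rewrite !linear0.
- by rewrite !linearD => -> ->; rewrite addr0.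
rewrite tpiE //; last exact: Cd_C xj.
have [c ->] := hc0_B bB; have hc' : h * c%:A \in H by rewrite rpredM ?kH.
rewrite -mulrA (@hc_neq _ j%:Z) //.
by apply: (grM (Cd_G xj) (Hgr hc')); rewrite addr0.
Qed.

Lemma tpi'_pos (n : nat) a : hc n.+1%:Z (tpi' a) = 0.
Proof.
move: a; apply: tri_ind => [|x y|j l x h b xj hH bl].
- by rewrite !linear0.
- by rewrite !linearD => -> ->; rewrite addr0.
rewrite tpi'E //; [|exact: Cd_C xj|exact: Bd_B bl].
have [c ->] := hc0_C (Cd_C xj); have hc' : c%:A * h \in H by rewrite rpredM ?kH.
rewrite (@hc_neq _ (- l%:Z)) //; first by apply: (grM (Hgr hc') (Bd_G bl)); rewrite add0r.
by case: l {bl}.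
Qed.

Local Notation d := (del T).
Local Notation d' := (del' T).
Local Notation d0 := (del0 T : A).

Lemma d0H : d0 \in H. Proof. exact: valP. Qed.
Lemma d0C h : h \in H -> d0 * h = h * d0.
Proof. by move=> hH; exact: (congr1 (@sub_alg_val _ _ _) (del0_central (t := T) (SubAlg hH))). Qed.
Lemma d_comm i u : u \in G i -> d * u - u * d = u *~ i.
Proof. by move/(@del_inner _ _ _ _ _ T). Qed.

Definition d'_term a := exists i x h y, [/\ Cd i.+1 x, h \in H, Bd i.+1 y & a = x * h * y].

(** The element [del'] has degree 0, so the terms in which the degrees of the
    outer factors are not opposite cancel. *)
Lemma d'_form : fin_sum d'_term d'.
Proof.
have d'0 : d' \in G 0.
  have -> : d' = d + d0 by rewrite (del_decomp T) subrK.
  by apply: grD; [apply: del_gr|apply/Hgr/d0H].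
rewrite -(hc_id d'0); move: d' (del'_tri T) {d'0}.
apply: fin_sum_map => [|x y|_ [x [h [y [i [xC hH [yB yi] ->]]]]]].
- by rewrite linear0.
- by rewrite linearD.
move: x xC; apply: C_ind => [|x x' IH IH'|j x xj].
- by rewrite !mul0r linear0; apply: fin_sum0.
- by rewrite !mulrDl linearD; apply: fin_sumD.
have g : x * h * y \in G (j%:Z - i.+1%:Z).
  by apply: (grM (grM (Cd_G xj) (Hgr hH) erefl) yi); rewrite addr0.
have [e|ne] := eqVneq 0 (j%:Z - i.+1%:Z); last by rewrite (hc_neq g ne); apply: fin_sum0.
rewrite e hc_id //; apply: fin_sum1; exists i, x, h, y; split=> //.
by move/eqP: e; rewrite eq_sym subr_eq0 eqz_nat => /eqP <-.
Qed.

Local Notation HH := (sub_alg (Hs T)).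

Lemma HH_casimir : casimir HH.
Proof.
apply: (casimir_base_change (tri_H0_base T)); apply: casimir_falg.
  by move=> p; rewrite -(k_char0 p) (fmorph_pchar sigma).
exact: tri_H0_semisimple T.
Qed.
Lemma HH_spanned : spanned (fun _ : HH => True).
Proof. exact: base_change_spanned (tri_H0_base T). Qed.

Lemma H_spanned : spanned (fun h : A => h \in H).
Proof.
have vl : linear (@sub_alg_val _ _ H) by [].
apply: spanned_sub (spanned_linear (mklin vl) HH_spanned) => h hH.
by exists (SubAlg hH).
Qed.

Lemma del0_scalar (E : lmodType HH) : simple_mod E ->
  exists c : k, forall e : E, del0 T *: e = c%:A *: e.
Proof.
apply: (central_scalar (tri_H0_base T)); last by move=> h; rewrite (del0_central (t := T)).
apply: casimir_falg; last exact: tri_H0_semisimple T.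
by move=> p; rewrite -(k_char0 p) (fmorph_pchar sigma).
Qed.

Lemma natk_eq0 n : (n%:R == 0 :> k) = (n == 0%N).
Proof. exact: (pcharf0P _).1. Qed.

Lemma H_functional (h : HH) : h <> 0 -> exists l : {linear HH -> k^o}, l h <> 0.
Proof.
move=> h0; have [f fE] := base_change_coords (tri_H0_base T).
have [i fi] : exists i, f h 0 i != 0.
  apply: contrapT => no; apply: h0; rewrite (fE h) big1 // => i _.
  by have [->|ne] := eqVneq (f h 0 i) 0; [rewrite scale0r|case: no; exists i].
have ll : linear (fun h : HH => f h 0 i : k^o) by move=> a x y; rewrite linearP !mxE.
by exists (mklin ll); apply/eqP.
Qed.

(** Tensoring a functional on [H] that does not vanish on [h] with the
    identity recovers [x] from [h * x]. *)
Lemma HC_inj h x : h \in H -> h <> 0 -> x \in C -> h * x = 0 -> x = 0.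
Proof.
move=> hH h0 xC hx; have h0' : SubAlg hH <> 0 by move=> /(congr1 val).
have [l lh] := H_functional h0'; have [inj _ _] := tri_HBbar T.
have [||f fE] := inj A (fun h x => (l h : k) *: (x : A)).
- by move=> y c u v; rewrite linearP scalerDl scalerA.
- by move=> y c u v; rewrite scalerDr !scalerA mulrC.
have := fE (SubAlg hH) (SubAlg xC); rewrite /= hx linear0 => /esym/eqP.
by rewrite scaler_eq0 => /orP[/eqP/lh|/eqP].
Qed.

Lemma BH_inj h x : h \in H -> h <> 0 -> x \in B -> x * h = 0 -> x = 0.
Proof.
move=> hH h0 xB hx; have h0' : SubAlg hH <> 0 by move=> /(congr1 val).
have [l lh] := H_functional h0'; have [inj _ _] := tri_BH T.
have [||f fE] := inj A (fun x h => (l h : k) *: (x : A)).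
- by move=> y c u v; rewrite scalerDr !scalerA mulrC.
- by move=> y c u v; rewrite linearP scalerDl scalerA.
have := fE (SubAlg xB) (SubAlg hH); rewrite /= hx linear0 => /esym/eqP.
by rewrite scaler_eq0 => /orP[/eqP/lh|/eqP].
Qed.

(** In characteristic zero, translating an eigenvalue of [del0] by multiples of
    [i.+1] leaves the finite set of eigenvalues; [c] is the last one before this
    happens, and [h] is the cofactor of [X - c] in the minimal polynomial. *)
Lemma eigen_gap (i : nat) : exists (c : k) (h v : HH),
  [/\ h <> 0, del0 T * h = c *: h & v * ((c + i.+1%:R)%:A - del0 T) = 1].
Proof.
pose z := del0 T; pose Q n := `[< exists p : {poly k}, [/\ p != 0, size p = n & horner_alg z p = 0] >].
have exQ : exists n, Q n.
  have [p p0 pz] := spanned_algebraic z HH_spanned.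
  by exists (size p); apply/asboolP; exists p.
have [n /asboolP[p [p0 sp pz]] nmin] := ex_minnP exQ.
have [c0 rc0] : exists c, root p c.
  have [X [_ [Xs _ _]]] := exists_simple_sub HH_spanned (N := fullm (HH^o : lmodType HH)) (v := 1)
    ((in_mksub (@fullm_subproof _ (HH^o : lmodType HH)) _).2 I) (elimN eqP (oner_neq0 HH)).
  have [c cE] := del0_scalar Xs; exists c; have [[e e0] _] := Xs.
  have act q : horner_alg z q *: e = (q.[c])%:A *: e.
    elim/poly_ind: q => [|q a IH]; first by rewrite horner0 linear0 !scale0r.
    rewrite linearD /= rmorphM /= horner_algX horner_algC hornerMXaddC [LHS]scalerDl.
    have cm : horner_alg z q *: (c%:A *: e) = c%:A *: (horner_alg z q *: e).
      by rewrite !scalerA mulr_algl mulr_algr.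
    rewrite -[(_ * _) *: e]scalerA cE cm IH.
    by rewrite scalerA -scalerDl mulr_algl scalerA -scalerDl mulrC.
  apply/eqP/eqP; apply: contraT => pc; case/eqP: e0.
  have := act p; rewrite pz scale0r => /esym.
  move/(congr1 (fun x => ((p.[c])^-1)%:A *: x)); rewrite scaler0 scalerA.
  by rewrite mulr_algl scalerA mulVf // !scale1r.
have [m0 nr] : exists m, ~~ root p (c0 + m%:R * i.+1%:R).
  apply: contrapT => no; have := @max_poly_roots _ p [seq c0 + m%:R * i.+1%:R | m <- iota 0 (size p)] p0.
  rewrite size_map size_iota ltnn => H.
  have : false; last by []. apply: H.
    apply/allP => _ /mapP[m _ ->]; apply: contraT => nr; by case: no; exists m.
  rewrite map_inj_uniq ?iota_uniq // => m m' /addrI /(mulIf _) e.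
  have {}e : m%:R = m'%:R :> k by apply: e; rewrite natk_eq0.
  wlog le : m m' e / (m <= m')%N.
    by move=> W; case/orP: (leq_total m m') => le; [|apply/esym]; apply: W.
  by apply/eqP; rewrite eqn_leq le /= -subn_eq0 -natk_eq0 natrB // e subrr.
have {nr}[m rm nrm] : exists2 m, root p (c0 + m%:R * i.+1%:R) & ~~ root p (c0 + m.+1%:R * i.+1%:R).
  elim: m0 nr => [|m IH nr]; first by rewrite mul0r addr0 rc0.
  by have [rm|/IH //] := boolP (root p (c0 + m%:R * i.+1%:R)); exists m.
set c := c0 + m%:R * i.+1%:R in rm; exists c.
have /factor_theorem[p' pE] := rm; set c' := c + i.+1%:R.
have nrc : p.[c'] != 0.
  by move: nrm; rewrite /root -[m.+1%:R]natr1 mulrDl mul1r addrA.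
have p'0 : p' != 0 by apply: contra p0 => /eqP p'0; rewrite pE p'0 mul0r.
have [q qE] : exists q, p - p.[c']%:P = q * ('X - c'%:P).
  by apply/factor_theorem; rewrite /root hornerD hornerN hornerC subrr.
exists (horner_alg z p'), (p.[c']^-1 *: horner_alg z q); split.
- move=> zp'; have : (size p <= size p')%N by rewrite sp; apply: nmin; apply/asboolP; exists p'.
  by rewrite pE size_Mmonic ?monicXsubC // size_XsubC addn2 ltnn.
- move: pz; rewrite pE rmorphM rmorphB /= horner_algX horner_algC => /eqP.
  by rewrite mulrBr subr_eq0 mulr_algr (del0_central (t := T)) => /eqP.
have := congr1 (horner_alg z) qE; rewrite linearB /= pz sub0r horner_algC rmorphM rmorphB /=.
rewrite horner_algX horner_algC => e; rewrite -scalerAl -opprB mulrN -e opprK.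
by rewrite scalerA mulVf // scale1r.
Qed.
End Triangular.

(** * Finite-dimensionality of the graded pieces *)

Section FiniteDimension.
Variables (k0 : closedFieldType) (k : fieldType) (sigma : {rmorphism k0 -> k}).
Hypothesis k_char0 : [pchar k] =i pred0.
Variables (A : algType k) (H0 : falgType k0) (T : triangular_algebra sigma A H0).
Local Notation G := (gr T).
Local Notation B := (Bm T).
Local Notation C := (Bbar T).
Local Notation H := (Hs T).
Local Notation d := (del T).
Local Notation d' := (del' T).
Local Notation d0 := (del0 T : A).
Local Notation Cd := (Cd T).
Local Notation Bd := (Bd T).
Local Notation tpi := (tpi T).
Local Notation tpi' := (tpi' T).
Hint Resolve Cd_C Bd_B Cd_G Bd_G : core.

Lemma tpi_CH x h : x \in C -> h \in H -> tpi (h * x) = h * x.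
Proof.
move=> xC hH; rewrite tpi_H // -{1}[x]mulr1 -[x * 1]mulr1 -mulrA tpi_C // !mulr1.
by rewrite tpi_1 mulr1.
Qed.

Lemma kmulC (c : k) (a : A) : a * c%:A = c%:A * a.
Proof. by rewrite mulr_algl mulr_algr. Qed.

Lemma subm_Cd i : subm (Cd i).
Proof.
split=> [|c x y [xC xi] [yC yi]]; first by split; rewrite ?rpred0 ?gr0.
by split; [rewrite rpredD ?rpredZ|apply/grD/yi/grZ].
Qed.
Lemma subm_Bd i : subm (Bd i).
Proof.
split=> [|c x y [xC xi] [yC yi]]; first by split; rewrite ?rpred0 ?gr0.
by split; [rewrite rpredD ?rpredZ|apply/grD/yi/grZ].
Qed.

Lemma spanned1 (V : lmodType k) (v : V) : spanned (fun x => exists c : k, x = c *: v).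
Proof. by exists [:: v] => _ [c ->]; apply/rpredZ/genm_gen/mem_head. Qed.

(** Take [c] and [h] from [eigen_gap], and [b] of degree [i] in [Bbar]. Modulo
    [A B^{>0}] the relation [del (h b) - (h b) del = i (h b)] becomes
    [h b (c + i - del0) = tpi (del' (h b))]. The factor [c + i - del0] is
    invertible, and the right-hand side lies in a space built from [Bbar_j] with
    [j < i], since the terms of [del'] end in [B^{>0}]. *)
Lemma Cd_spanned i : spanned (Cd i).
Proof.
elim/ltn_ind: i => -[_|i IH].
  apply: spanned_sub (spanned1 (1 : A)) => x [xC x0].
  by have [c ->] := tri_Bbar0 xC x0; exists c.
have [c [[h hH] [[v vH] [h0 cE vE]]]] := eigen_gap k_char0 T i.
have {}h0 : h <> 0 by move=> e; apply: h0; apply/val_inj.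
have {}cE : d0 * h = c *: h by move/(congr1 val): cE.
have {vE} : v * ((c + i.+1%:R)%:A - d0) = 1 by move/(congr1 val): vE.
rewrite mulrBr -(d0C vH) kmulC -mulrBl => vE.
pose step D := spanned (fun z => exists2 b, Cd i.+1 b & z = tpi (D * (h * b))).
have stepd' : step d'.
  have [s [sP ->]] := d'_form T; rewrite big_seq; elim/big_ind: _ => [|x y xP yP|_ /sP[j [x [g [y [xj gH [yB yj] ->]]]]]].
  - by exists [::] => _ [b _ ->]; rewrite mul0r linear0 rpred0.
  - apply: spanned_sub (spanned_add xP yP) => _ [b bi ->].
    exists (tpi (x * (h * b))), (tpi (y * (h * b))); rewrite mulrDl linearD.
    by split=> //; exists b.
  have xgT b : tpi (x * g * y * (h * b)) = (x * g) * tpi (y * (h * b)).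
    by rewrite -!mulrA (tpi_C _ (Cd_C xj)) (tpi_H _ gH).
  have yhb b : Cd i.+1 b -> y * (h * b) \in G (i%:Z - j%:Z).
    move=> bi; apply: (grM yj (grM (Hgr hH) (Cd_G bi) erefl)).
    by rewrite add0r addrC !intS opprD addrACA subrr add0r.
  have [ji|ij] := leqP j i; last first.
    exists [::] => _ [b bi ->]; rewrite xgT -(hc_id (yhb b bi)) -tpi_hc.
    rewrite (_ : i%:Z - j%:Z = - (j - i.+1).+1%:Z) ?tpi_neg ?mulr0 ?rpred0 //.
    by rewrite subnSK // -subzn ?(ltnW ij) // opprB.
  have sQ := spanned_mul (spanned1 (x * g)) (spanned_fin_sum (spanned_mul (IH (i - j)%N (leq_subr _ _)) (H_spanned T))).
  apply: spanned_sub sQ => _ [b bi ->]; exists (x * g), (tpi (y * (h * b))); split=> //.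
    by exists 1; rewrite scale1r.
  rewrite -(hc_id (yhb b bi)) -tpi_hc subzn //.
  exact: tpi_span.
have sQ := spanned_mul stepd' (spanned1 v).
apply: fd_spanned; apply: (fd_inj (f := fun b => h * b) (subm_Cd _) sQ).
- by move=> a x y _ _; rewrite mulrDr -scalerAr.
- by move=> x [xC _]; apply: (HC_inj hH h0 xC).
move=> b bi; have bC := Cd_C bi.
exists (tpi (d' * (h * b))), v; split=> //; [by exists b|by exists 1; rewrite scale1r|].
have : tpi (d * (h * b) - (h * b) * d) = (h * b) *+ i.+1.
  rewrite (@d_comm _ _ _ _ _ T i.+1%:Z); last by apply: (grM (Hgr hH) (Cd_G bi)); rewrite add0r.
  by rewrite -pmulrn raddfMn /= (tpi_CH bC hH).
have -> : h * b * d = h * b * d' - h * b * d0 by rewrite (del_decomp T) mulrBr.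
have -> : d * (h * b) = d' * (h * b) - c *: (h * b).
  by rewrite (del_decomp T) mulrBl [d0 * _]mulrA cE -scalerAl.
have killd' : tpi (h * b * d') = 0.
  have [s [sP ->]] := d'_form T; rewrite mulr_sumr linear_sum big_seq big1 // => _ /sP[j [x [g [y [_ _ yj ->]]]]].
  by rewrite !mulrA (tpi_B _ yj).
rewrite !linearB /= killd' oppr0 sub0r opprK linearZ /= (tpi_rH (h * b) (d0H T)) (tpi_CH bC hH) => e.
have -> : tpi (d' * (h * b)) = (h * b) * ((c + i.+1%:R)%:A - d0).
  by rewrite mulrBr mulr_algr scalerDl scaler_nat -[_ *+ _]e addrA addrK addrC subrK.
by rewrite -mulrA vE mulr1.
Qed.

(** The mirror image of [Cd_spanned], modulo [Bbar_{>0} A]. *)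
Lemma Bd_spanned i : spanned (Bd i).
Proof.
elim/ltn_ind: i => -[_|i IH].
  apply: spanned_sub (spanned1 (1 : A)) => x [xB]; rewrite oppr0 => x0.
  by have [c ->] := tri_B0 xB x0; exists c.
have [c [[h hH] [[v vH] [h0 cE vE]]]] := eigen_gap k_char0 T i.
have {}h0 : h <> 0 by move=> e; apply: h0; apply/val_inj.
have {}cE : d0 * h = c *: h by move/(congr1 val): cE.
have {}vE : v * ((c + i.+1%:R)%:A - d0) = 1 by move/(congr1 val): vE.
pose step D := spanned (fun z => exists2 b, Bd i.+1 b & z = tpi' ((b * h) * D)).
have stepd' : step d'.
  have [s [sP ->]] := d'_form T; rewrite big_seq; elim/big_ind: _ => [|x y xP yP|_ /sP[j [x [g [y [[xC xj] gH yj ->]]]]]].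
  - by exists [::] => _ [b _ ->]; rewrite mulr0 linear0 rpred0.
  - apply: spanned_sub (spanned_add xP yP) => _ [b bi ->].
    exists (tpi' ((b * h) * x)), (tpi' ((b * h) * y)); rewrite mulrDr linearD.
    by split=> //; exists b.
  have xgT b : tpi' (b * h * (x * g * y)) = tpi' (b * h * x) * (g * y).
    by rewrite !mulrA (tpi'_B _ (Bd_B yj)) (tpi'_rH _ gH).
  have bhx b : Bd i.+1 b -> b * h * x \in G (j%:Z - i%:Z).
    move=> bi; apply: (grM (grM (Bd_G bi) (Hgr hH) erefl) xj).
    by rewrite addr0 addrC !intS opprD addrACA subrr add0r.
  have [ji|ij] := leqP j i; last first.
    exists [::] => _ [b bi ->]; rewrite xgT -(hc_id (bhx b bi)) -tpi'_hc.
    rewrite (_ : j%:Z - i%:Z = (j - i.+1).+1%:Z) ?tpi'_pos ?mul0r ?rpred0 //.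
    by rewrite subnSK // -subzn ?(ltnW ij).
  have sQ := spanned_mul (spanned_fin_sum (spanned_mul (H_spanned T) (IH (i - j)%N (leq_subr _ _)))) (spanned1 (g * y)).
  apply: spanned_sub sQ => _ [b bi ->]; exists (tpi' (b * h * x)), (g * y); split=> //.
    rewrite -(hc_id (bhx b bi)) -tpi'_hc -[j%:Z - _]opprK opprB subzn //.
    exact: tpi'_span.
  by exists 1; rewrite scale1r.
have sQ := spanned_mul (spanned1 v) stepd'.
apply: fd_spanned; apply: (fd_inj (f := fun b => b * h) (subm_Bd _) sQ).
- by move=> a x y _ _; rewrite mulrDl -scalerAl.
- by move=> x [xC _]; apply: (BH_inj hH h0 xC).
move=> b bi; have bB := Bd_B bi.
exists v, (tpi' ((b * h) * d')); split=> //; [by exists 1; rewrite scale1r|by exists b|].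
have : tpi' (d * (b * h) - (b * h) * d) = - ((b * h) *+ i.+1).
  rewrite (@d_comm _ _ _ _ _ T (- i.+1%:Z)); last first.
    by apply: (grM (Bd_G bi) (Hgr hH)); rewrite addr0.
  by rewrite mulrNz linearN /= -pmulrn raddfMn /= tpi'_u.
have -> : b * h * d = b * h * d' - c *: (b * h).
  by rewrite (del_decomp T) mulrBr -[b * h * d0]mulrA -(d0C hH) cE -scalerAr.
have -> : d * (b * h) = d' * (b * h) - d0 * (b * h).
  by rewrite (del_decomp T) mulrBl.
have killd' : tpi' (d' * (b * h)) = 0.
  have [s [sP ->]] := d'_form T; rewrite mulr_suml linear_sum big_seq big1 // => _ /sP[j [x [g [y [xj _ _ ->]]]]].
  by rewrite -!mulrA (tpi'_C _ xj).
have td0 : tpi' (d0 * (b * h)) = d0 * (b * h).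
  have [s [sP ->]] : mul_span B H (d0 * (b * h)).
    rewrite mulrA; have [s [sP e]] : mul_span B H (d0 * b).
      by have [_ _ e] := tri_BH T; apply/e/fin_sum1; exists d0, b; rewrite d0H.
    rewrite e mulr_suml; exists [seq x * h | x <- s]; rewrite big_map; split=> //.
    move=> _ /mapP[_ /sP[x [g [xB gH ->]]] ->]; exists x, (g * h).
    by rewrite rpredM // mulrA.
  rewrite linear_sum !big_seq; apply: eq_bigr => _ /sP[x [g [xB gH ->]]].
  exact: tpi'_u.
rewrite !linearB /= killd' sub0r td0 opprK linearZ /= (tpi'_u bB hH) => e.
have -> : tpi' (b * h * d') = ((c + i.+1%:R)%:A - d0) * (b * h).
  rewrite mulrBl mulr_algl scalerDl scaler_nat -[_ *+ _]opprK -e.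
  by rewrite !opprD !opprK addrCA [d0 * _ + _]addrC addrK addrC subrK.
by rewrite mulrA vE mul1r.
Qed.
End FiniteDimension.

(** * Weights *)

Section Weights.
Variables (k0 : closedFieldType) (k : fieldType) (sigma : {rmorphism k0 -> k}).
Hypothesis k_char0 : [pchar k] =i pred0.
Variables (A : algType k) (H0 : falgType k0) (T : triangular_algebra sigma A H0).
Local Notation G := (gr T).
Local Notation B := (Bm T).
Local Notation H := (Hs T).
Local Notation d := (del T).
Local Notation Cd := (Cd T).
Local Notation Bd := (Bd T).
Hint Resolve Cd_C Bd_B Cd_G Bd_G : core.

(** [JB n] is the left ideal generated by the [B^m] and [JC n] the right ideal
    generated by the [Bbar_m], for [m > n]. *)
Definition JB n := fin_sum (fun a => exists x b m, [/\ (n < m)%N, Bd m b & a = x * b]).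
Definition JC n := fin_sum (fun a => exists x b m, [/\ (n < m)%N, Cd m x & a = x * b]).

Lemma JB_mull n a x : JB n x -> JB n (a * x).
Proof.
apply: (fin_sum_map (f := fun x => a * x)) => [|y z|_ [y [b [m [nm bm ->]]]]].
- by rewrite mulr0.
- by rewrite mulrDr.
by apply: fin_sum1; exists (a * y), b, m; rewrite mulrA.
Qed.
Lemma JC_mulr n a x : JC n x -> JC n (x * a).
Proof.
apply: (fin_sum_map (f := fun x => x * a)) => [|y z|_ [y [b [m [nm bm ->]]]]].
- by rewrite mul0r.
- by rewrite mulrDl.
by apply: fin_sum1; exists y, (b * a), m; rewrite mulrA.
Qed.
Lemma JB0 n : JB n 0. Proof. exact: fin_sum0. Qed.
Lemma JC0 n : JC n 0. Proof. exact: fin_sum0. Qed.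
Lemma JB_gen n m x b : (n < m)%N -> Bd m b -> JB n (x * b).
Proof. by move=> nm bm; apply: fin_sum1; exists x, b, m. Qed.
Lemma JC_gen n m x b : (n < m)%N -> Cd m x -> JC n (x * b).
Proof. by move=> nm bm; apply: fin_sum1; exists x, b, m. Qed.

Lemma tri_gr i j x h b : Cd i x -> h \in H -> Bd j b -> x * h * b \in G (i%:Z - j%:Z).
Proof. by move=> xi hH bj; apply: (grM (grM (Cd_G xi) (Hgr hH) erefl) (Bd_G bj)); rewrite addr0. Qed.

(** [A_j] is finite-dimensional modulo the left ideal generated by the [B^m],
    [m > n], and likewise modulo the right ideal generated by the [Bbar_m]. *)
Lemma slice_B n j : exists W : A -> Prop, [/\ spanned W, forall w, W w -> w \in G j &
  forall a, a \in G j -> exists2 w, W w & JB n (a - w)].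
Proof.
pose S m w := exists l x h b, [/\ l%:Z - m%:Z = j, Cd l x, h \in H, Bd m b & w = x * h * b].
exists (fin_sum (fun w => exists2 m, (m < n.+1)%N & S m w)); split.
- apply/spanned_fin_sum/spanned_bigU => m _.
  have [[l lm]|no] := EM (exists l : nat, l%:Z - m%:Z = j); last first.
    by exists [::] => w [l [x [h [b [lm]]]]]; case: no; exists l.
  apply: spanned_sub (spanned_mul (spanned_mul (Cd_spanned k_char0 T l) (H_spanned T)) (Bd_spanned k_char0 T m)).
  move=> w [l' [x [h [b [lm' xl hH bm ->]]]]]; exists (x * h), b; split=> //.
  exists x, h; split=> //; suff <- : l' = l by [].
  by apply/eqP; rewrite -eqz_nat; apply/eqP/(addIr (- m%:Z)); rewrite lm lm'.
- move=> w [s [sP ->]]; rewrite big_seq; elim/big_ind: _ => [|x y|_ /sP[m _ [l [x [h [b [<- xl hH bm ->]]]]]]].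
  + exact: gr0.
  + exact: grD.
  exact: tri_gr.
move=> a aj; rewrite -(hc_id aj) {aj}; move: a; apply: tri_ind => [|x y [u Su Ju] [v Sv Jv]|l m x h b xl hH bm].
- by exists 0; rewrite ?subr0 ?linear0; apply: fin_sum0.
- exists (u + v); first exact: fin_sumD.
  by rewrite linearD opprD addrACA; apply: fin_sumD.
have g := tri_gr xl hH bm.
have [e|ne] := eqVneq j (l%:Z - m%:Z); last first.
  by rewrite (hc_neq g ne); exists 0; rewrite ?subr0; apply: fin_sum0.
rewrite {1}e hc_id //; have [nm|mn] := leqP m n.
  by exists (x * h * b); rewrite ?subrr; [apply: fin_sum1; exists m => //; exists l, x, h, b|apply: fin_sum0].
by exists 0; [apply: fin_sum0|rewrite subr0; apply: JB_gen bm].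
Qed.

Lemma slice_C n j : exists W : A -> Prop, [/\ spanned W, forall w, W w -> w \in G j &
  forall a, a \in G j -> exists2 w, W w & JC n (a - w)].
Proof.
pose S l w := exists m x h b, [/\ l%:Z - m%:Z = j, Cd l x, h \in H, Bd m b & w = x * h * b].
exists (fin_sum (fun w => exists2 l, (l < n.+1)%N & S l w)); split.
- apply/spanned_fin_sum/spanned_bigU => l _.
  have [[m lm]|no] := EM (exists m : nat, l%:Z - m%:Z = j); last first.
    by exists [::] => w [m [x [h [b [lm]]]]]; case: no; exists m.
  apply: spanned_sub (spanned_mul (spanned_mul (Cd_spanned k_char0 T l) (H_spanned T)) (Bd_spanned k_char0 T m)).
  move=> w [m' [x [h [b [lm' xl hH bm ->]]]]]; exists (x * h), b; split=> //; first by exists x, h.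
  suff <- : m' = m by [].
  by apply/eqP; rewrite -eqz_nat -eqr_opp; apply/eqP/(addrI l%:Z); rewrite lm lm'.
- move=> w [s [sP ->]]; rewrite big_seq; elim/big_ind: _ => [|x y|_ /sP[l _ [m [x [h [b [<- xl hH bm ->]]]]]]].
  + exact: gr0.
  + exact: grD.
  exact: tri_gr.
move=> a aj; rewrite -(hc_id aj) {aj}; move: a; apply: tri_ind => [|x y [u Su Ju] [v Sv Jv]|l m x h b xl hH bm].
- by exists 0; rewrite ?subr0 ?linear0; apply: fin_sum0.
- exists (u + v); first exact: fin_sumD.
  by rewrite linearD opprD addrACA; apply: fin_sumD.
have g := tri_gr xl hH bm.
have [e|ne] := eqVneq j (l%:Z - m%:Z); last first.
  by rewrite (hc_neq g ne); exists 0; rewrite ?subr0; apply: fin_sum0.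
rewrite {1}e hc_id //; have [nm|mn] := leqP l n.
  by exists (x * h * b); rewrite ?subrr; [apply: fin_sum1; exists l => //; exists m, x, h, b|apply: fin_sum0].
by exists 0; [apply: fin_sum0|rewrite subr0 -mulrA; apply: JC_gen xl].
Qed.

Definition pd (p : {poly k}) : A := horner_alg d p.
Lemma pdM p q : pd (p * q) = pd p * pd q. Proof. exact: rmorphM. Qed.
Lemma pdD p q : pd (p + q) = pd p + pd q. Proof. exact: linearD. Qed.
Lemma pd1 : pd 1 = 1. Proof. exact: rmorph1. Qed.
Lemma pdC c : pd c%:P = c%:A. Proof. exact: horner_algC. Qed.
Lemma pdX : pd 'X = d. Proof. exact: horner_algX. Qed.
Lemma pdXC c : pd ('X - c%:P) = d - c%:A.
Proof. by rewrite /pd rmorphB /= horner_algX horner_algC. Qed.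
Lemma pdXCn c n : pd (('X - c%:P) ^+ n) = (d - c%:A) ^+ n.
Proof. by rewrite /pd rmorphXn /= -/(pd _) pdXC. Qed.
Lemma pd_comm p q : pd p * pd q = pd q * pd p.
Proof. by rewrite -!pdM mulrC. Qed.

Lemma pd_gr0 p : pd p \in G 0.
Proof.
elim/poly_ind: p => [|p c IH]; first by rewrite /pd linear0 gr0.
rewrite pdD pdM pdX pdC; apply: grD; last by apply/grZ/one_gr.
by apply: (grM IH (del_gr T)); rewrite addr0.
Qed.

Definition zk (i : int) : k := i%:~R.
Lemma zkE i : zk i = i%:~R. Proof. by []. Qed.

Lemma d_shift i u : u \in G i -> d * u = u * (d + (zk i)%:A).
Proof.
move=> ui; have /eqP := d_comm ui; rewrite subr_eq => /eqP ->.
rewrite mulrDr addrC mulr_algr /zk; congr (_ + _).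
by rewrite -scaler_int.
Qed.

(** Moving an element of degree [i] across [del] translates polynomials in
    [del] by [i]. *)
Definition shiftp (i : int) (p : {poly k}) := p \Po ('X - (zk i)%:P).

Lemma pd_shift i u p : u \in G i -> pd (shiftp i p) * u = u * pd p.
Proof.
move=> ui; rewrite /shiftp; elim/poly_ind: p => [|p c IH].
  by rewrite comp_poly0 /pd linear0 mul0r mulr0.
rewrite comp_polyD comp_polyM comp_polyX comp_polyC !pdD !pdM !pdC pdX pdXC [LHS]mulrDl [RHS]mulrDr.
rewrite kmulC; congr (_ + _).
by rewrite -mulrA mulrBl (d_shift ui) [u * _]mulrDr kmulC addrK mulrA IH mulrA.
Qed.

Section Module.
Implicit Types M N : lmodType A.

Local Notation gw := (gen_weight T).

Lemma gwP M (al : k) (m : M) : gw al m <-> exists n, pd (('X - al%:P) ^+ n) *: m = 0.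
Proof.
split=> [[n H]|[n H]]; exists n; first by rewrite pdXCn H.
by move=> l nl; rewrite -(subnK nl) exprD -scalerA -!pdXCn H scaler0.
Qed.

(** The sum of the weight spaces other than [al], described by polynomials in
    [del] that do not vanish at [al]. *)
Definition cw M (al : k) (m : M) := exists q : {poly k}, q.[al] != 0 /\ pd q *: m = 0.


Lemma gw_cw M al (m : M) : gw al m -> cw al m -> m = 0.
Proof.
move=> /gwP[n pm] [q [qa qm]].
have : coprimep (('X - al%:P) ^+ n) q.
  by rewrite coprimep_expl // coprimep_sym coprimep_XsubC.
move=> /Bezout_eq1_coprimepP[[u v] /= e].
by rewrite -[m]scale1r -pd1 -e pdD !pdM scalerDl -!scalerA pm qm !scaler0 addr0.
Qed.

Lemma gw0 M al : gw al (0 : M).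
Proof. by apply/gwP; exists 0%N; rewrite scaler0. Qed.
Lemma cw0 M al : cw al (0 : M).
Proof. by exists 1; rewrite hornerC oner_neq0 scaler0. Qed.

Lemma pd_kill_dvd M p q (m : M) : pd p *: m = 0 -> pd (q * p) *: m = 0.
Proof. by move=> pm; rewrite pdM -scalerA pm scaler0. Qed.

Lemma gwD M al (m m' : M) : gw al m -> gw al m' -> gw al (m + m').
Proof.
move=> /gwP[n pm] /gwP[n' pm']; apply/gwP; exists (n + n')%N.
by rewrite scalerDr exprD {1}mulrC !pd_kill_dvd // addr0.
Qed.
Lemma cwD M al (m m' : M) : cw al m -> cw al m' -> cw al (m + m').
Proof.
move=> [q [qa qm]] [q' [qa' qm']]; exists (q * q'); rewrite hornerM mulf_neq0 //.
by rewrite scalerDr {1}mulrC !pd_kill_dvd // addr0.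
Qed.

Lemma gw_scale M al i u (m : M) : u \in G i -> gw al m -> gw (al + zk i) (u *: m).
Proof.
move=> ui /gwP[n pm]; apply/gwP; exists n.
rewrite (_ : ('X - (al + zk i)%:P) ^+ n = shiftp i (('X - al%:P) ^+ n)).
  by rewrite scalerA (pd_shift _ ui) -scalerA pm scaler0.
rewrite /shiftp rmorphXn /= rmorphB /= comp_polyX comp_polyC polyCD.
by rewrite opprD addrA addrAC.
Qed.
Lemma cw_scale M al i u (m : M) : u \in G i -> cw al m -> cw (al + zk i) (u *: m).
Proof.
move=> ui [q [qa qm]]; exists (shiftp i q); split.
  by rewrite /shiftp horner_comp hornerXsubC addrK.
by rewrite scalerA (pd_shift _ ui) -scalerA qm scaler0.
Qed.
Lemma gw_scale0 M al u (m : M) : u \in G 0 -> gw al m -> gw al (u *: m).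
Proof. by move=> u0 /(gw_scale u0); rewrite /zk addr0. Qed.
Lemma cw_scale0 M al u (m : M) : u \in G 0 -> cw al m -> cw al (u *: m).
Proof. by move=> u0 /(cw_scale u0); rewrite /zk addr0. Qed.
Lemma kG (c : k) : c%:A \in G 0. Proof. exact/grZ/one_gr. Qed.
Lemma gwN M al (m : M) : gw al m -> gw al (- m).
Proof. by move=> /(gw_scale0 (kG (-1))); rewrite scaleN1r scaleN1r. Qed.
Lemma cwN M al (m : M) : cw al m -> cw al (- m).
Proof. by move=> /(cw_scale0 (kG (-1))); rewrite scaleN1r scaleN1r. Qed.

Lemma gw_neq_cw M al be (m : M) : gw be m -> be != al -> cw al m.
Proof.
move=> /gwP[n pm] ne; exists (('X - be%:P) ^+ n); split=> //.
by rewrite horner_exp hornerXsubC expf_neq0 // subr_eq0 eq_sym.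
Qed.

Lemma gw_lin M N (f : {linear M -> N}) al m : gw al m -> gw al (f m).
Proof. by move=> /gwP[n pm]; apply/gwP; exists n; rewrite -linearZ pm linear0. Qed.
Lemma cw_lin M N (f : {linear M -> N}) al m : cw al m -> cw al (f m).
Proof. by move=> [q [qa qm]]; exists q; rewrite -linearZ qm linear0. Qed.
Lemma gw_inj M N (f : {linear M -> N}) al m : injective f -> gw al (f m) -> gw al m.
Proof.
by move=> fi /gwP[n]; rewrite -linearZ => /(inj_linear0 fi) pm; apply/gwP; exists n.
Qed.

Definition wt M := forall m : M, fin_sum (fun w => exists al, gw al w) m.

Lemma wt_ind M (P : M -> Prop) : wt M -> P 0 -> (forall x y, P x -> P y -> P (x + y)) ->
  (forall al m, gw al m -> P m) -> forall m, P m.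
Proof.
move=> wM P0 PD PG m; have [s [sP ->]] := wM m.
rewrite big_seq; elim/big_ind: _ => // x /sP[al]; exact: PG.
Qed.

Lemma wsplit M al (m : M) : wt M -> exists w, gw al w /\ cw al (m - w).
Proof.
move=> wM; move: m; apply: wt_ind => //.
- by exists 0; rewrite subr0; split; [apply: gw0|apply: cw0].
- move=> x y [u [gu cu]] [v [gv cv]]; exists (u + v); split; first exact: gwD.
  by rewrite opprD addrACA; apply: cwD.
move=> be m mb; have [e|ne] := eqVneq be al.
  by exists m; rewrite -e subrr; split=> //; apply: cw0.
by exists 0; rewrite subr0; split; [apply: gw0|apply: gw_neq_cw mb ne].
Qed.

Definition wproj M al (m : M) : M := xget 0 [set w | gw al w /\ cw al (m - w)].

Section Wproj.
Variable M : lmodType A.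
Hypothesis wM : wt M.
Implicit Types m : M.

Lemma wprojP al m : gw al (wproj al m) /\ cw al (m - wproj al m).
Proof.
rewrite /wproj; case: xgetP => [w _ //|no]; have [w wP] := wsplit al m wM.
by case: (no w).
Qed.
Lemma wproj_gw al m : gw al (wproj al m). Proof. by case: (wprojP al m). Qed.
Lemma wproj_uniq al m w : gw al w -> cw al (m - w) -> wproj al m = w.
Proof.
move=> gwm cwm; have [g c] := wprojP al m; apply/eqP; rewrite -subr_eq0; apply/eqP.
apply: (@gw_cw _ al); first by apply/gwD/gwN.
rewrite (_ : _ - w = (m - w) - (m - wproj al m)); first exact/cwD/cwN.
by rewrite opprB [RHS]addrC addrA subrK.
Qed.
Lemma wproj_id al m : gw al m -> wproj al m = m.
Proof. by move=> g; apply: wproj_uniq => //; rewrite subrr; apply: cw0. Qed.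
Lemma wproj_neq al be m : gw be m -> be != al -> wproj al m = 0.
Proof.
by move=> g ne; apply: wproj_uniq; [apply: gw0|rewrite subr0; apply: gw_neq_cw g ne].
Qed.
Lemma wprojD al m m' : wproj al (m + m') = wproj al m + wproj al m'.
Proof.
have [g c] := wprojP al m; have [g' c'] := wprojP al m'.
by apply: wproj_uniq; [apply: gwD|rewrite opprD addrACA; apply: cwD].
Qed.
Lemma wproj0 al : wproj al (0 : M) = 0. Proof. exact/wproj_id/gw0. Qed.
Lemma wproj_scale al i u m : u \in G i -> wproj (al + zk i) (u *: m) = u *: wproj al m.
Proof.
move=> ui; have [g c] := wprojP al m; apply: wproj_uniq; first exact: gw_scale.
by rewrite -scalerBr; apply: cw_scale.
Qed.
Lemma wproj_scale0 al u m : u \in G 0 -> wproj al (u *: m) = u *: wproj al m.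
Proof. by move=> u0; rewrite -(wproj_scale _ _ u0) /zk addr0. Qed.
(** The projections are given by polynomials in [del], so every submodule is
    stable under them. *)
Lemma wproj_pd al m : exists p, wproj al m = pd p *: m.
Proof.
have [/gwP[n pm] [q [qa qm]]] := wprojP al m.
have : coprimep (('X - al%:P) ^+ n) q.
  by rewrite coprimep_expl // coprimep_sym coprimep_XsubC.
move=> /Bezout_eq1_coprimepP[[u v] /= e]; exists (v * q).
rewrite -{1}[wproj al m]scale1r -pd1 -e pdD scalerDl (pd_kill_dvd _ pm) add0r.
by apply/eqP; rewrite eq_sym -subr_eq0 -scalerBr (pd_kill_dvd _ qm).
Qed.
Lemma wproj_in al m (N : submodClosed M) : m \in N -> wproj al m \in N.
Proof. by move=> mN; have [p ->] := wproj_pd al m; apply: rpredZ. Qed.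

Lemma wproj_eq0 m : (forall al, wproj al m = 0) -> m = 0.
Proof.
move=> m0; have cwm al : cw al m by have [_] := wprojP al m; rewrite m0 subr0.
have [s ps] : exists s : seq k, pd (\prod_(a <- s) ('X - a%:P)) *: m = 0.
  move: m {m0 cwm}; apply: wt_ind => // [|x y [s sx] [t ty]|al m /gwP[n mn]].
  - by exists [::]; rewrite scaler0.
  - by exists (s ++ t); rewrite big_cat scalerDr /= {1}mulrC !pd_kill_dvd // addr0.
  by exists (nseq n al); rewrite big_nseq -(mulr1 (iter _ _ _)) iter_mulr ?mulr1.
elim: s ps => [|a s IH]; first by rewrite big_nil pd1 scale1r.
rewrite big_cons pdM -scalerA => e; apply: IH; apply: (@gw_cw _ a).
  by apply/gwP; exists 1%N; rewrite expr1.
have [q [qa qm]] := cwm a; exists q; split=> //.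
by rewrite scalerA pd_comm -scalerA qm scaler0.
Qed.

Lemma wproj_sum m : exists s : seq k, uniq s /\ m = \sum_(al <- s) wproj al m.
Proof.
have [s sP] : exists s : seq k, forall al, al \notin s -> wproj al m = 0.
  move: m; apply: wt_ind => // [|x y [s sx] [t ty]|al m mal].
  - by exists [::] => al _; rewrite wproj0.
  - by exists (s ++ t) => al; rewrite mem_cat negb_or wprojD => /andP[/sx-> /ty->]; rewrite addr0.
  by exists [:: al] => be; rewrite inE eq_sym; apply: wproj_neq.
exists (undup s); split; first exact: undup_uniq.
apply/eqP; rewrite -subr_eq0; apply/eqP/wproj_eq0 => be.
have wsum (t : seq k) : uniq t -> wproj be (\sum_(al <- t) wproj al m) = if be \in t then wproj be m else 0.
  elim: t => [|a t IH] /=; first by rewrite big_nil wproj0.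
  move=> /andP[nat ut]; rewrite big_cons wprojD IH // inE.
  have [->|ne] := eqVneq be a; first by rewrite (negPf nat) addr0 wproj_id //; apply: wproj_gw.
  by rewrite (wproj_neq (wproj_gw a m)) ?add0r // eq_sym.
have wN (x : M) : wproj be (- x) = - wproj be x.
  have [g c] := wprojP be x; apply: wproj_uniq; first exact: gwN.
  by rewrite -opprD; apply: cwN.
rewrite wprojD wN wsum ?undup_uniq // mem_undup.
by case: ifPn => [_|/sP->]; rewrite ?subrr ?subr0.
Qed.
End Wproj.

Lemma wproj_lin M N (f : {linear M -> N}) al m : wt M -> wt N -> f (wproj al m) = wproj al (f m).
Proof.
move=> wM wN; have [g c] := wprojP wM al m; apply/esym/wproj_uniq => //; first exact: gw_lin.
by rewrite -linearB; apply: cw_lin.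
Qed.

Lemma wt_inj M N (f : {linear M -> N}) : injective f -> wt N -> wt M.
Proof.
move=> fi wN m; have [s [us e]] := wproj_sum wN (f m).
have /choice[g gP] : forall al, exists x, f x = wproj al (f m).
  by move=> al; have [p ->] := wproj_pd wN al (f m); exists (pd p *: m); rewrite linearZ.
have -> : m = \sum_(al <- s) g al.
  by apply: fi; rewrite linear_sum {1}e; apply: eq_bigr => al _; rewrite gP.
elim: (s) => [|al t IH]; first by rewrite big_nil; apply: fin_sum0.
rewrite big_cons; apply: fin_sumD => //; apply: fin_sum1; exists al.
by apply: (gw_inj fi); rewrite gP; apply: wproj_gw.
Qed.

Lemma wt_surj M N (f : {linear M -> N}) : surj f -> wt M -> wt N.
Proof.
move=> fs wM n; have [m <-] := fs n; move: m (wM m).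
apply: fin_sum_map => [|x y|x [al xal]]; rewrite ?linear0 ?linearD //.
by apply: fin_sum1; exists al; apply: gw_lin.
Qed.

Lemma gw_subm M al : subm (fun x : kmod M => gw al x).
Proof.
split=> [|a x y xa ya]; first exact: gw0.
by apply: (gwD (gw_scale0 (kG a) xa) ya).
Qed.
End Module.
End Weights.

(** * Category O *)

Section RestrictH.
Variables (k : fieldType) (A : algType k).
(** An alias of [M], on which the subalgebra [S] acts. *)
Definition hmod_of (S : subalgClosed A) (M : lmodType A) : Type := M.
Variable S : subalgClosed A.
Local Notation hmod := (hmod_of S).
HB.instance Definition _ (M : lmodType A) := GRing.Zmodule.on (hmod M).
Section HmodScale.
Variable M : lmodType A.
Definition hscale (h : sub_alg S) (m : hmod M) : hmod M := (h : A) *: (m : M).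
Fact hscaleA a b m : hscale a (hscale b m) = hscale (a * b) m.
Proof. exact: (scalerA (a : A) (b : A) (m : M)). Qed.
Fact hscale1 : left_id 1 hscale.
Proof. by move=> m; apply: (scale1r (m : M)). Qed.
Fact hscaleDr : right_distributive hscale +%R.
Proof. by move=> a x y; apply: (scalerDr (a : A) (x : M) (y : M)). Qed.
Fact hscaleDl m : {morph hscale^~ m : a b / a + b}.
Proof. by move=> a b; apply: (scalerDl (m : M) (a : A) (b : A)). Qed.
HB.instance Definition _ := GRing.Zmodule_isLmodule.Build (sub_alg S) (hmod M)
  hscaleA hscale1 hscaleDr hscaleDl.
End HmodScale.
End RestrictH.

Section CategoryOBasics.
Variables (k0 : closedFieldType) (k : fieldType) (sigma : {rmorphism k0 -> k}).
Hypothesis k_char0 : [pchar k] =i pred0.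
Variables (A : algType k) (H0 : falgType k0) (T : triangular_algebra sigma A H0).
Local Notation G := (gr T).
Local Notation B := (Bm T).
Local Notation H := (Hs T).
Local Notation d := (del T).
Local Notation d0 := (del0 T : A).
Local Notation Bd := (Bd T).
Local Notation hc := (hc T).
Hint Resolve Cd_C Bd_B Cd_G Bd_G : core.
Local Notation gw := (gen_weight T).
Local Notation wt := (wt T).
Local Notation wproj := (wproj T).
Local Notation hmod M := (hmod_of (Hs T) M).
Local Notation O := (category_O T).
Implicit Types M N : lmodType A.


Definition locnil M := forall m : M, exists n, forall j b, (n < j)%N -> Bd j b -> b *: m = 0.

Lemma O_wt M : O M -> wt M. Proof. exact: O_weights. Qed.
Lemma O_nil M : O M -> locnil M.
Proof.
move=> OM m; have [n nP] := O_loc_nilp OM m; exists n => j b nj [bB bj].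
by apply: nP; apply: fin_sum1; exists j.
Qed.
Lemma O_fd M al : O M -> spanned (fun x : kmod M => gw al x).
Proof. by move=> OM; apply: fd_spanned; apply: O_fin_gen. Qed.
Lemma mkO M : locnil M -> wt M -> (forall al, spanned (fun x : kmod M => gw al x)) -> O M.
Proof.
move=> nM wM sM; split=> // [m|al]; last first.
  by have e := fd_sub (@gw_subm _ _ _ _ _ T M al) (sM al) (fun _ h => h); exact: e.
have [n nP] := nM m; exists n => b [s [sP ->]].
rewrite scaler_suml big_seq big1 // => x /sP[j [nj xB xj]].
by apply: (nP j x nj).
Qed.

Lemma O_inj M N (f : {linear M -> N}) : injective f -> O N -> O M.
Proof.
move=> fi ON; apply: mkO => [m||al].
- have [n nP] := O_nil ON (f m); exists n => j b nj bj; apply: fi.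
  by rewrite linearZ linear0 /= (nP j).
- exact: wt_inj fi (O_wt ON).
apply: fd_spanned; apply: (@fd_inj _ (kmod M) (kmod N) _ _ f (@gw_subm _ _ _ _ _ T M al) (O_fd al ON)).
- by move=> a x y _ _; rewrite (klinear f).
- by move=> x _; apply: (inj_linear0 fi).
by move=> x; apply: (gw_lin f).
Qed.

Lemma O_surj M N (f : {linear M -> N}) : surj f -> O M -> O N.
Proof.
move=> fs OM; have wM := O_wt OM; have wN := wt_surj fs wM; apply: mkO => // [n|al].
  have [m <-] := fs n; have [l lP] := O_nil OM m; exists l => j b nj bj.
  by rewrite -linearZ /= (lP j) ?linear0.
apply: spanned_sub (spanned_linear (mklin (klinear f)) (O_fd al OM)) => n nal.
have [m mn] := fs n; exists (wproj al m); first exact: wproj_gw.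
by rewrite /= (wproj_lin f al m wM wN) mn wproj_id.
Qed.

Lemma O_prod M N : O M -> O N -> O (M * N)%type.
Proof.
move=> OM ON.
have l1 : linear (fun m : M => (m, 0) : M * N).
  by move=> a x y; apply/eqP; rewrite -pair_eqE /= !addr0 !scaler0 !eqxx.
have l2 : linear (fun m : N => (0, m) : M * N).
  by move=> a x y; apply/eqP; rewrite -pair_eqE /= ?addr0 ?scaler0 ?eqxx.
pose i1 := mklin l1; pose i2 := mklin l2.
have e (x : (M * N)%type) : x = i1 x.1 + i2 x.2.
  by case: x => x y; apply/eqP; rewrite -pair_eqE /= addr0 add0r !eqxx.
apply: mkO => [m|m|al].
- have [n1 P1] := O_nil OM m.1; have [n2 P2] := O_nil ON m.2.
  exists (maxn n1 n2) => j b; rewrite gtn_max => /andP[j1 j2] bj.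
  by rewrite (e m) scalerDr -!linearZ /= (P1 j) // (P2 j) // e /= addr0.
- rewrite (e m); apply: fin_sumD.
    move: (m.1) (O_wt OM m.1); apply: (fin_sum_map (f := i1)) => [|x y|x [al xal]]; rewrite ?linear0 ?linearD //.
    by apply: fin_sum1; exists al; apply: gw_lin.
  move: (m.2) (O_wt ON m.2); apply: (fin_sum_map (f := i2)) => [|x y|x [al xal]]; rewrite ?linear0 ?linearD //.
  by apply: fin_sum1; exists al; apply: gw_lin.
apply: spanned_sub (spanned_add (spanned_linear (mklin (klinear i1)) (O_fd al OM))
                                (spanned_linear (mklin (klinear i2)) (O_fd al ON))).
have f1 : linear (fst : M * N -> M) by [].
have f2 : linear (snd : M * N -> N) by [].
move=> x xal; exists (i1 x.1), (i2 x.2); split; last exact: e.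
  by exists x.1 => //; apply: (gw_lin (mklin f1)).
by exists x.2 => //; apply: (gw_lin (mklin f2)).
Qed.

Lemma O_zero M : (forall x : M, x = 0) -> O M.
Proof.
move=> M0; apply: mkO => [m|m|al].
- by exists 0%N => j b _ _; apply: M0.
- by rewrite (M0 m); apply: fin_sum0.
by exists [::] => x _; rewrite (M0 x) rpred0.
Qed.

Lemma O_abelian : abelian_subcategory O.
Proof. by split; [apply: O_zero|apply: O_prod|apply: O_inj|apply: O_surj]. Qed.

Lemma O_quot M (N : submodClosed M) : O M -> O (quot_mod N).
Proof. exact/O_surj/qpi_surj. Qed.
Lemma O_sub M (N : submodClosed M) : O M -> O (sub_mod N).
Proof. exact/O_inj/(@incl_inj _ _ N). Qed.

Definition killed M (v : M) := forall j b, Bd j.+1 b -> b *: v = 0.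

Lemma killed_lin M N (f : {linear M -> N}) v : killed v -> killed (f v).
Proof. by move=> kv j b bj; rewrite -linearZ /= (kv j) ?linear0. Qed.

Lemma hc_B j b : b \in B -> hc (- j%:Z) b \in B.
Proof.
move: b; apply: B_ind => [|x y xP yP|i x xi].
- by rewrite linear0 rpred0.
- by rewrite linearD rpredD.
have [e|ne] := eqVneq (- j%:Z) (- i%:Z).
  by rewrite e hc_id; case: xi.
by rewrite (hc_neq (Bd_G xi) ne) rpred0.
Qed.

Lemma BH_hom j b h : Bd j b -> h \in H ->
  fin_sum (fun z => exists h' b', [/\ h' \in H, Bd j b' & z = h' * b']) (b * h).
Proof.
move=> bj hH.
have e : b * h \in G (- j%:Z) by apply: (grM (Bd_G bj) (Hgr hH)); rewrite addr0.
rewrite -(hc_id e); move: (b * h) (BH_HB (Bd_B bj) hH).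
apply: fin_sum_map => [|x y|_ [g [c [gH cB ->]]]]; rewrite ?linear0 ?linearD //.
apply: fin_sum1; exists g, (hc (- j%:Z) c); rewrite (hc_mull _ _ (Hgr gH)) subr0.
by split=> //; split; [apply: hc_B|apply: hc_in].
Qed.

Lemma killed0 M : killed (0 : M). Proof. by move=> j b _; rewrite scaler0. Qed.
Lemma killedD M (v w : M) : killed v -> killed w -> killed (v + w).
Proof. by move=> kv kw j b bj; rewrite scalerDr (kv j) ?(kw j) ?addr0. Qed.
Lemma killedH M h (v : M) : h \in H -> killed v -> killed (h *: v).
Proof.
move=> hH kv j b bj; rewrite scalerA; have [s [sP ->]] := BH_hom bj hH.
rewrite scaler_suml big_seq big1 // => _ /sP[h' [b' [_ bj' ->]]].
by rewrite -scalerA (kv j) ?scaler0.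
Qed.

(** The terms of [del'] end in [B^{>0}]. *)
Lemma d_killed M (v : M) : killed v -> d *: v = - (d0 *: v).
Proof.
move=> kv; rewrite (del_decomp T) scalerBl; have [s [sP ->]] := d'_form T.
rewrite scaler_suml big_seq big1 ?sub0r // => _ /sP[i [x [h [y [_ _ yi ->]]]]].
by rewrite -scalerA (kv i) ?scaler0.
Qed.

(** Apply an element of [B] of largest degree that does not annihilate [v]. *)
Lemma exists_killed M (v : M) : locnil M -> v <> 0 ->
  exists m b, [/\ Bd m b, b *: v <> 0 & killed (b *: v)].
Proof.
move=> nM v0; have [n] := nM v; elim: n v v0 => [|n IH] v v0 vP.
  exists 0%N, 1; rewrite scale1r; split=> //; last by move=> j b; apply: vP.
  by split; [apply: rpred1|rewrite oppr0; apply: one_gr].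
have [[b [bn bv]]|no] := EM (exists b, Bd n.+1 b /\ b *: v <> 0).
  exists n.+1, b; split=> // j c cj.
  rewrite scalerA; apply: (vP (j.+1 + n.+1)%N); first by rewrite addSn ltnS leq_addl.
  split; first by rewrite rpredM //; [case: cj|case: bn].
  by apply: (grM (Bd_G cj) (Bd_G bn)); rewrite PoszD opprD.
apply: (IH v) => // j b; rewrite leq_eqVlt => /orP[/eqP <-|nj] bj; last exact: vP bj.
by apply: contrapT => bv; apply: no; exists b.
Qed.

Section Irreducibles.
Variables (I : Type) (Irr : I -> lmodType (sub_alg (Hs T))).
Hypothesis HIrr : simple_representatives (fun _ => True) Irr.

Lemma IrrS i : simple_mod (Irr i). Proof. by case: HIrr => /(_ i)[]. Qed.

Lemma killed_irr M (N : submodClosed (hmod M)) (v : M) :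
    (forall x : M, x \in N -> killed x) -> v \in N -> v <> 0 ->
  exists i (phi : {linear Irr i -> hmod M}), injective phi /\ forall e, phi e \in N.
Proof.
move=> kN vN v0.
have [X [g [Xs gi gP]]] := exists_simple_sub (HH_spanned T) (N := N) vN v0.
have [_ _ /(_ X (Logic.I) Xs)[i iso]] := HIrr; exists i.
have [f fb] := mod_iso_sym iso.
exists (g \o f); split=> [|e]; last exact: gP.
by apply: inj_comp => //; apply: bij_inj.
Qed.

(** The vectors of [N] killed by [B^{>0}] form a nonzero [H]-submodule. *)
Lemma lowest_irr M (N : submodClosed M) v : locnil M -> v \in N -> v <> 0 ->
  exists i (phi : {linear Irr i -> hmod M}),
    [/\ injective phi, forall e, (phi e : M) \in N & forall e, killed (phi e : M)].
Proof.
move=> nM vN v0; have [m [b [_ w0 kw]]] := exists_killed nM v0.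
have Ps : subm (fun x : hmod M => (x : M) \in N /\ killed (x : M)).
  split=> [|a x y [xN kx] [yN ky]]; first by split; [apply: rpred0|apply: killed0].
  split; first by apply: rpredD => //; apply: (rpredZ (a : A)).
  by apply: killedD => //; apply: killedH => //; apply: (valP a).
have [|||i [phi [pi pP]]] := @killed_irr M (mksub Ps) (b *: v).
- by move=> x xN; case: ((in_mksub Ps x).1 xN).
- by apply/(in_mksub Ps); split=> //; apply: rpredZ.
- exact: w0.
by exists i, phi; split=> // e; have [] := (in_mksub Ps _).1 (pP e).
Qed.

Definition cI i := c_ (Irr i).
Lemma cIE i (e : Irr i) : del0 T *: e = (cI i)%:A *: e.
Proof.
rewrite /cI /c_; case: xgetP => [c _ cP|no]; first exact: cP.
by have [c cP] := del0_scalar k_char0 (IrrS i); case: (no c).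
Qed.

(** On vectors killed by [B^{>0}], [del] acts as [- del0]. *)
Lemma killed_gw M i (phi : {linear Irr i -> hmod M}) e :
  killed (phi e : M) -> gw (- cI i) (phi e : M).
Proof.
move=> ke; apply/gwP; exists 1%N; rewrite expr1 pdXC scalerBl d_killed //.
have -> : d0 *: (phi e : M) = (cI i)%:A *: (phi e : M).
  have e1 : phi (del0 T *: e) = del0 T *: phi e by rewrite linearZ.
  have e2 : phi ((cI i)%:A *: e) = (cI i)%:A *: phi e by rewrite linearZ.
  by rewrite -[LHS]/(del0 T *: phi e) -e1 cIE e2.
by rewrite scaleNr scaleNr opprK addNr.
Qed.

(** The killed vectors of weight [be] form an [H]-submodule, which contains a
    simple one; its weight is that of [killed_gw]. *)
Lemma killed_gw_irr M be (v : M) : killed v -> gw be v -> v <> 0 ->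
  exists i (phi : {linear Irr i -> hmod M}), [/\ injective phi, forall e, killed (phi e : M),
    forall e, gw be (phi e : M) & be = - cI i].
Proof.
move=> kv gv v0.
have Ps : subm (fun x : hmod M => gw be (x : M) /\ killed (x : M)).
  split=> [|a x y [xN kx] [yN ky]]; first by split; [apply: gw0|apply: killed0].
  split; first by apply: gwD => //; apply/gw_scale0 => //; apply/Hgr/(valP a).
  by apply: killedD => //; apply: killedH => //; apply: (valP a).
have [|||i [phi [pi pP]]] := @killed_irr M (mksub Ps) v.
- by move=> x xN; case: ((in_mksub Ps x).1 xN).
- by apply/(in_mksub Ps).
- exact: v0.
have gp e : gw be (phi e : M) by have [] := (in_mksub Ps _).1 (pP e).
have kp e : killed (phi e : M) by have [] := (in_mksub Ps _).1 (pP e).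
exists i, phi; split=> //; apply/eqP; apply: contraT => ne.
have [[e e0] _] := IrrS i; case/eqP: e0; apply: (inj_linear0 pi).
by apply: (gw_cw (gp e)); apply: gw_neq_cw (killed_gw (kp e)) _; rewrite eq_sym.
Qed.

Lemma O_lowest M (N : submodClosed M) v : O M -> v \in N -> v <> 0 ->
  exists i x, [/\ x \in N, x <> 0 & gw (- cI i) x].
Proof.
move=> OM vN v0; have [i [phi [pi pN pk]]] := lowest_irr (O_nil OM) vN v0.
have [[e e0] _] := IrrS i; exists i, (phi e); split=> //; last exact: killed_gw.
by move=> /(inj_linear0 pi) z; case/eqP: e0.
Qed.

Lemma finI : exists n (l : I -> 'I_n), injective l.
Proof. by have := finite_irr (HH_spanned T) HIrr. Qed.

(** Every nonzero subquotient has a vector killed by [B^{>0}], whose weight is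
    one of finitely many; the measure is the dimension of these weight spaces. *)
Lemma O_artin M : O M -> artin M.
Proof.
move=> OM; have [n [l linj]] := finI.
apply: (artin_of_spanned (P := fun x => exists i, gw (- cI i) x)).
  apply: (@spanned_sub _ _ _ (fun x : kmod M => exists2 j, (j < n)%N & exists2 i, l i = j :> nat & gw (- cI i) x)).
    by move=> x [i xi]; exists (l i) => //; exists i.
  apply: spanned_bigU => j jn; have [[i lij]|no] := EM (exists i, l i = j :> nat).
    apply: spanned_sub (O_fd (- cI i) OM) => x [i' li' xi'].
    by have -> : i = i' by apply: linj; apply/val_inj; rewrite /= lij li'.
  by exists [::] => x [i li _]; case: no; exists i.
move=> N N' s12 ns21.
have [x [xN' xN]] : exists x, x \in N' /\ x \notin N.
  apply: contrapT => no; apply: ns21 => x xN'.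
  by apply: contraT => xN; case: no; exists x.
have OQ := O_quot N OM.
have [||i [y [/in_mksub[z zN' zy] y0 gy]]] := O_lowest (N := imm (qpi N) N') (v := qpi N x) OQ.
- by apply/in_mksub; exists x.
- by move=> /qpi_eq0; apply/negP.
exists (wproj (- cI i) z); split.
- by exists i; apply: wproj_gw (O_wt OM) _ _.
- exact: wproj_in (O_wt OM) _ _ _ zN'.
apply/negP => /qpi_eq0; rewrite (wproj_lin _ _ _ (O_wt OM) (O_wt OQ)) zy wproj_id //.
exact: O_wt.
Qed.

Lemma O_locally_artinian : locally_artinian O.
Proof.
move=> M OM x; exists (fullm M); first exact/in_mksub.
exact/artin_finite_length/O_artin/O_sub.
Qed.

Lemma irr_spanned i : spanned (fun _ : kmod (Irr i) => True).
Proof.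
have [e [t tE]] := simple_section (HH_spanned T) (HH_casimir k_char0 T) (IrrS i).
by apply: spanned_sub (spanned_cyclic (HH_spanned T) e) => x _; exists (t x).
Qed.

Lemma lt_irr a : ~ irr_lt Irr a a.
Proof. by case=> n; rewrite subrr => /esym/eqP; rewrite natk_eq0. Qed.
Lemma lt_trans a b c : irr_lt Irr a b -> irr_lt Irr b c -> irr_lt Irr a c.
Proof.
move=> [n ab] [m bc]; exists (m + n.+1)%N.
by rewrite -addSn natrD -ab -bc addrA subrK.
Qed.
Lemma finite_I (P : set I) : finite_set P.
Proof.
have [n [l linj]] := finI.
have [[i0 _]|no] := EM (exists i, P i); last first.
  by suff -> : P = set0 by []; apply/seteqP; split=> i // Pi; case: no; exists i.
have /choice[g gP] : forall j : nat, exists i, forall i', l i' = j :> nat -> i' = i.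
  move=> j; have [[i ij]|no'] := EM (exists i, l i = j :> nat).
    by exists i => i' i'j; apply: linj; apply/val_inj; rewrite /= ij.
  by exists i0 => i' i'j; case: no'; exists i'.
apply: (@sub_finite_set _ _ (g @` `I_n)); last exact/finite_image/finite_II.
by move=> i _; exists (l i : nat); [apply: ltn_ord|apply/esym/gP].
Qed.

End Irreducibles.
End CategoryOBasics.

(** * Standard objects *)

Section Values.
Variable k : fieldType.

Lemma spanned_bilin (U V W : lmodType k) (f : U -> V -> W) (P : U -> Prop) (Q : V -> Prop) :
  (forall v, linear (f^~ v)) -> (forall u, linear (f u)) -> spanned P -> spanned Q ->
  spanned (fun w => exists u v, [/\ P u, Q v & w = f u v]).
Proof.
move=> fl fr [s sP] [t tQ]; exists [seq f x y | x <- s, y <- t] => _ [x [y [Px Qy ->]]].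
set N := lspan _.
suff /(_ x (sP x Px)) /in_mksub : {subset lspan s <= prem (mklin (fl y)) N} by [].
apply: lspan_in => u us; apply/in_mksub => /=.
suff /(_ y (tQ y Qy)) /in_mksub : {subset lspan t <= prem (mklin (fr u)) N} by [].
by apply: lspan_in => v vt; apply/in_mksub/genm_gen/allpairs_f.
Qed.

(** The evaluations embed the space in a power of the target. This serves for
    spaces of functions, where no finite spanning set is visible. *)
Lemma spanned_values (V W : lmodType k) (P : V -> Prop) (Q : W -> Prop) n (ev : 'I_n -> V -> W) :
    subm P -> spanned Q -> (forall l, linear (ev l)) ->
    (forall x, P x -> (forall l, ev l x = 0) -> x = 0) -> (forall x l, P x -> Q (ev l x)) ->
  spanned P.
Proof.
move=> Ps Qs evl ev0 evQ.
pose F (x : V) : {ffun 'I_n -> W} := [ffun l => ev l x].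
pose del (l : 'I_n) (w : W) : {ffun 'I_n -> W} := [ffun l' => if l' == l then w else 0].
have dl l : linear (del l).
  move=> a u v; apply/ffunP=> l'; rewrite !ffunE; case: eqP => // _.
  by rewrite scaler0 addr0.
have sF : spanned (fun g : {ffun 'I_n -> W} => forall l, Q (g l)).
  have sp1 : spanned (fun g => exists2 l, (l < n)%N & exists2 l' : 'I_n, l' = l :> nat & exists2 w, Q w & del l' w = g).
    apply: spanned_bigU => l ln.
    apply: spanned_sub (spanned_linear (mklin (dl (Ordinal ln))) Qs) => g [l' ll' [w Qw <-]].
    by exists w => //; congr (del _ w); apply/val_inj.
  apply: spanned_sub (spanned_fin_sum sp1) => g gQ.
  exists [seq del l (g l) | l <- index_enum _]; split.
    by move=> _ /mapP[l _ ->]; exists (l : nat) => //; exists l => //; exists (g l).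
  rewrite big_map; apply/ffunP=> l; rewrite sum_ffunE (bigD1 l) //= ffunE eqxx big1 ?addr0 //.
  by move=> l' ll'; rewrite ffunE eq_sym (negPf ll').
apply: fd_spanned; apply: (fd_inj (f := F) Ps sF).
- move=> a x y _ _; apply/ffunP=> l; rewrite !ffunE; exact: evl.
- by move=> x Px /ffunP Fx; apply: ev0 => // l; have := Fx l; rewrite !ffunE.
by move=> x Px l; rewrite ffunE; apply: evQ.
Qed.
End Values.

Section Standard.
Variables (k0 : closedFieldType) (k : fieldType) (sigma : {rmorphism k0 -> k}).
Hypothesis k_char0 : [pchar k] =i pred0.
Variables (A : algType k) (H0 : falgType k0) (T : triangular_algebra sigma A H0).
Local Notation G := (gr T).
Local Notation B := (Bm T).
Local Notation C := (Bbar T).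
Local Notation H := (Hs T).
Local Notation HH := (sub_alg (Hs T)).
Local Notation d0 := (del0 T : A).
Local Notation Cd := (Cd T).
Local Notation Bd := (Bd T).
Local Notation hc := (hc T).
Local Notation tpi := (tpi T).
Hint Resolve Cd_C Bd_B Cd_G Bd_G : core.
Local Notation gw := (gen_weight T).
Local Notation wt := (wt T).
Local Notation wproj := (wproj T).
Local Notation zk := (@zk k).
Local Notation hmod M := (hmod_of (Hs T) M).
Local Notation O := (category_O T).
Local Notation killed := (@killed _ _ _ _ _ T _).
Implicit Types M N : lmodType A.

Lemma Bd0_scalar b : Bd 0 b -> exists c : k, b = c%:A.
Proof.
move=> b0; have [c e] := hc0_B (Bd_B b0); exists c.
by rewrite -e hc_id //; have := Bd_G b0; rewrite oppr0.
Qed.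
Lemma Cd0_scalar x : Cd 0 x -> exists c : k, x = c%:A.
Proof.
move=> x0; have [c e] := hc0_C (Cd_C x0); exists c.
by rewrite -e hc_id //; apply: Cd_G x0.
Qed.

(** The projection of [A] onto [H] along [Bbar_{>0} A + A B^{>0}]. *)
Definition rho (a : A) : A := hc 0 (tpi a).
Lemma rho_in a : rho a \in H.
Proof.
rewrite /rho; have [s [sP ->]] := tpi_span T 0 a.
rewrite big_seq; apply: rpred_sum => _ /sP[x [h [x0 hH ->]]].
by have [c ->] := Cd0_scalar x0; rewrite rpredM ?kH.
Qed.
Definition rhoH (a : A) : HH := SubAlg (rho_in a).
Lemma rhoD a b : rhoH (a + b) = rhoH a + rhoH b.
Proof. by apply/val_inj; rewrite /= /rho !linearD. Qed.
Lemma rho_Hl (h : HH) a : rhoH ((h : A) * a) = h * rhoH a.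
Proof.
have hH : (h : A) \in H := valP h.
by apply/val_inj; rewrite /= /rho tpi_H // (hc_mull _ _ (Hgr hH)) subr0.
Qed.
Lemma rho_Hr (h : HH) a : rhoH (a * (h : A)) = rhoH a * h.
Proof.
have hH : (h : A) \in H := valP h.
by apply/val_inj; rewrite /= /rho tpi_rH // (hc_mulr _ _ (Hgr hH)) subr0.
Qed.
Lemma rho_B a j b : Bd j.+1 b -> rhoH (a * b) = 0.
Proof. by move=> bj; apply/val_inj; rewrite /= /rho (tpi_B _ bj) linear0. Qed.
Lemma rho_C j x a : Cd j.+1 x -> rhoH (x * a) = 0.
Proof.
move=> xj; apply/val_inj; rewrite /= /rho tpi_C; last exact: Cd_C xj.
by rewrite (hc_mull _ _ (Cd_G xj)) sub0r tpi_neg mulr0.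
Qed.
Lemma rho1 : rhoH 1 = 1.
Proof. by apply/val_inj; rewrite /= /rho tpi_1 hc_id // one_gr. Qed.
Lemma rho_G i a : a \in G i -> i != 0 -> rhoH a = 0.
Proof.
move=> ai i0; apply/val_inj; rewrite /= /rho tpi_hc (hc_neq ai) ?linear0 //.
by rewrite eq_sym.
Qed.
Lemma rhoN0 : rhoH 0 = 0. Proof. by apply/val_inj; rewrite /= /rho !linear0. Qed.

Lemma zk_inj (i j : int) : zk i = zk j -> i = j.
Proof.
suff z (n : int) : zk n = 0 -> n = 0.
  by rewrite /zk => /eqP; rewrite -subr_eq0 -rmorphB => /eqP/z/eqP; rewrite subr_eq0 => /eqP.
rewrite /zk; case: n => n.
  by rewrite -pmulrn => /eqP; rewrite (natk_eq0 k_char0) => /eqP ->.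
by rewrite NegzE mulrNz => /eqP; rewrite oppr_eq0 -pmulrn (natk_eq0 k_char0).
Qed.

(** Maps that commute with [S] and [H] and preserve weights: for [S = Bbar] the
    morphisms for which standard objects are free on their generating space,
    for [S = B] those for which costandard objects are cofree on their socle. *)
Record eqmap (S : subalgClosed A) M N (f : M -> N) : Prop := Eqmap {
  eqmD : {morph f : x y / x + y};
  eqmS : forall s m, s \in S -> f (s *: m) = s *: f m;
  eqmH : forall h m, h \in H -> f (h *: m) = h *: f m;
  eqmW : forall al m, gw al m -> gw al (f m) }.
Local Notation bhmap := (eqmap C).

Lemma eqmap_lin S M N (f : {linear M -> N}) : eqmap S f.
Proof.
split=> [x y|x m _|h m _|al m]; rewrite ?linearD ?linearZ //.
exact: gw_lin.
Qed.
Lemma eqmap_comp S M N (P : lmodType A) (f : M -> N) (g : N -> P) :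
  eqmap S f -> eqmap S g -> eqmap S (g \o f).
Proof.
move=> [fD fS fH fW] [gD gS gH gW]; split=> [x y|x m xS|h m hH|al m mal] /=.
- by rewrite fD gD.
- by rewrite fS ?gS.
- by rewrite fH ?gH.
exact/gW/fW.
Qed.
Lemma eqmap0 S M N (f : M -> N) : eqmap S f -> f 0 = 0.
Proof. by move=> fb; apply: (addrI (f 0)); rewrite -(eqmD fb) !addr0. Qed.
Lemma eqmapN S M N (f : M -> N) x : eqmap S f -> f (- x) = - f x.
Proof.
move=> fb; apply: (addrI (f x)); rewrite -(eqmD fb) !subrr.
exact: eqmap0 fb.
Qed.
Lemma eqmapB S M N (f : M -> N) x y : eqmap S f -> f (x - y) = f x - f y.
Proof. by move=> fb; rewrite (eqmD fb) (eqmapN _ fb). Qed.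

(** Functionals with values in an [H]-module on which [Bbar_{>0}] acts by 0
    and which is placed in weight [al]. They classify the maps to costandard
    objects. *)
Record bhfun M (E : lmodType HH) (al : k) (f : M -> E) : Prop := BHfun {
  fnD : {morph f : x y / x + y};
  fnH : forall (h : HH) m, f ((h : A) *: m) = h *: f m;
  fnC : forall j x m, Cd j.+1 x -> f (x *: m) = 0;
  fnW : forall be m, gw be m -> be != al -> f m = 0 }.

Lemma fn0 M (E : lmodType HH) al (f : M -> E) : bhfun al f -> f 0 = 0.
Proof. by move=> [fD _ _ _]; apply: (addrI (f 0)); rewrite -fD !addr0. Qed.
Lemma fnB M (E : lmodType HH) al (f : M -> E) x y : bhfun al f -> f (x - y) = f x - f y.
Proof.
move=> fb; rewrite (fnD fb); congr (_ + _); apply: (addrI (f y)); rewrite -(fnD fb) !subrr.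
exact: fn0 fb.
Qed.
Lemma bhfun_comp M N (E : lmodType HH) al (f : M -> N) (g : N -> E) : bhmap f -> bhfun al g -> bhfun al (g \o f).
Proof.
move=> [fD fC fH fW] [gD gH gC gW]; split=> [x y|h m|j x m xj|be m mbe ne] /=.
- by rewrite fD gD.
- by rewrite fH ?gH //; apply: (valP h).
- by rewrite fC ?(gC j) //; apply: Cd_C xj.
exact: gW (fW _ _ mbe) ne.
Qed.
Lemma fn_wproj M (E : lmodType HH) al (f : M -> E) m : wt M -> bhfun al f -> f m = f (wproj al m).
Proof.
move=> wM fb; suff : f (m - wproj al m) = 0 by rewrite (fnB _ _ fb) => /eqP; rewrite subr_eq0 => /eqP.
have e : wproj al (m - wproj al m) = 0.
  have [g c] := wprojP wM al m.
  by apply: wproj_uniq; [apply: wM|apply: gw0|rewrite subr0].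
have [s [us ->]] := wproj_sum wM (m - wproj al m).
elim: s {us} => [|be s IH]; first by rewrite big_nil (fn0 fb).
rewrite big_cons (fnD fb) IH addr0; have [->|ne] := eqVneq be al.
  by rewrite e (fn0 fb).
by apply: (fnW fb _ ne); apply: wproj_gw.
Qed.

Section OneModule.
Variable E : lmodType HH.

(** The generators [1 (x) e] of the standard object. *)
Definition iot (e : E) : standard E := qpi _ (<< 1 *g e >> : {malg A[E]}).

Lemma malgZU (a b : A) (e : E) : a *: << b *g e >> = << (a * b) *g e >> :> {malg A[E]}.
Proof.
apply/malgP=> x; rewrite mcoeffZ !mcoeffU.
by case: eqP; rewrite ?mulr1n ?mulr0n ?mulr0.
Qed.

Lemma std_rel0 (x : {malg A[E]}) : standard_rel x -> qpi (span_mod (@standard_rel _ _ _ _ _ T E)) x = 0.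
Proof.
move=> rx; apply/qpi_eq0/asboolP/fin_sum1; exists 1, x.
by rewrite scale1r.
Qed.

Lemma iotD e e' : iot (e + e') = iot e + iot e'.
Proof.
have := std_rel0 (Or31 _ _ (ex_intro _ e (ex_intro _ e' erefl))).
by rewrite !linearB /= => /eqP; rewrite -addrA -opprD subr_eq0 => /eqP.
Qed.
Lemma iotH (h : HH) e : iot (h *: e) = (h : A) *: iot e.
Proof.
have := std_rel0 (Or32 _ _ (ex_intro _ h (ex_intro _ e erefl))).
rewrite linearB => /eqP; rewrite subr_eq0 => /eqP e1; apply: (etrans e1).
by rewrite /iot -linearZ malgZU mulr1.
Qed.
Lemma iot_killed e : killed (iot e).
Proof.
move=> j b [bB bj]; rewrite /iot -linearZ malgZU mulr1; apply: std_rel0.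
by apply: Or33; exists b, e; split=> //; apply: fin_sum1; exists j.+1.
Qed.
Lemma iot_lin : linear (iot : E -> hmod (standard E)).
Proof. by move=> h x y; rewrite /= iotD iotH. Qed.
Definition iotl : {linear E -> hmod (standard E)} := mklin iot_lin.

Lemma std_span (x : standard E) : fin_sum (fun x => exists a e, x = a *: iot e) x.
Proof.
have [y <-] := qpi_surj x; rewrite [y]monalgE linear_sum /=.
elim: (enum_fset _) => [|e s IH]; first by rewrite big_nil; apply: fin_sum0.
rewrite big_cons; apply: fin_sumD => //; apply: fin_sum1.
by exists y@_e, e; rewrite /iot -linearZ malgZU mulr1.
Qed.

(** Additive maps out of [A (x)_{BH} E]. *)
Lemma std_map (Z : zmodType) (Psi : A -> E -> Z) :
    (forall e, {morph Psi^~ e : a b / a + b}) -> (forall a, {morph Psi a : e e' / e + e'}) ->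
    (forall a (h : HH) e, Psi (a * (h : A)) e = Psi a (h *: e)) ->
    (forall a j b e, Bd j.+1 b -> Psi (a * b) e = 0) ->
  exists g : standard E -> Z, {morph g : x y / x + y} /\ forall a e, g (a *: iot e) = Psi a e.
Proof.
move=> P1 P2 PH PB.
have P0 e : Psi 0 e = 0 by apply: (addrI (Psi 0 e)); rewrite -P1 !addr0.
have P20 a : Psi a 0 = 0 by apply: (addrI (Psi a 0)); rewrite -P2 !addr0.
have P2N a e : Psi a (- e) = - Psi a e by apply: (addrI (Psi a e)); rewrite -P2 !subrr P20.
have P1N a e : Psi (- a) e = - Psi a e by apply: (addrI (Psi a e)); rewrite -P1 !subrr P0.
pose g0 (x : {malg A[E]}) := \sum_(e <- msupp x) Psi x@_e e.
have g0w (x : {malg A[E]}) (D : {fset E}) : (msupp x `<=` D)%fset ->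
    g0 x = \sum_(e <- D) Psi x@_e e.
  by move=> sD; apply: big_fset_incl => // e _ ex; rewrite mcoeff_outdom ?P0.
have g0D : {morph g0 : x y / x + y}.
  move=> x y; rewrite (g0w _ (msupp x `|` msupp y)%fset) ?msuppD_le //.
  rewrite (g0w x (msupp x `|` msupp y)%fset) ?fsubsetUl //.
  rewrite (g0w y (msupp x `|` msupp y)%fset) ?fsubsetUr // -big_split.
  by apply: eq_bigr => e _; rewrite mcoeffD P1.
have g00 : g0 0 = 0 by apply: (addrI (g0 0)); rewrite -g0D !addr0.
have g0N x : g0 (- x) = - g0 x by apply: (addrI (g0 x)); rewrite -g0D !subrr g00.
have g0U a e : g0 << a *g e >> = Psi a e.
  by rewrite (g0w _ [fset e]%fset) ?msuppU_le // big_seq_fset1 mcoeffUU.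
have g0r a x : standard_rel x -> g0 (a *: x) = 0.
  case=> [[e [e' ->]]|[h [e ->]]|[b [e [[s [sP ->]] ->]]]].
  - by rewrite !scalerBr !malgZU mulr1 !g0D !g0N !g0U P2 -addrA -opprD subrr.
  - by rewrite scalerBr !malgZU mulr1 g0D g0N !g0U PH subrr.
  rewrite malgZU g0U mulr_sumr big_seq.
  elim/big_ind: _ => [|u v|b' /sP[[|j] [j0 bB bj]]] //; first by rewrite P1 => -> ->; rewrite addr0.
  by apply: (PB _ j).
have g0k x : x \in span_mod (@standard_rel _ _ _ _ _ T E) -> g0 x = 0.
  move=> /asboolP[s [sP ->]]; rewrite big_seq; elim/big_ind: _ => // [u v|y /sP[a [z [zr ->]]]].
    by rewrite g0D => -> ->; rewrite addr0.
  exact: g0r.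
have g0q x y : qpi (span_mod (@standard_rel _ _ _ _ _ T E)) x = qpi _ y -> g0 x = g0 y.
  move=> e; apply/eqP; rewrite -subr_eq0 -g0N -g0D; apply/eqP/g0k/qpi_eq0.
  by rewrite linearB e subrr.
pose q := qpi (span_mod (@standard_rel _ _ _ _ _ T E)).
have rq x : q (repr x) = x by apply: quot_projK.
exists (fun x => g0 (repr x)); split=> [x y|a e].
  by rewrite -g0D; apply: g0q; rewrite linearD -![qpi _ (repr _)]/(q (repr _)) !rq.
rewrite -g0U; apply: g0q; rewrite -[LHS]/(q (repr _)) rq.
by rewrite /iot -linearZ malgZU mulr1.
Qed.

(** As [A = Bbar H B] and [B^{>0}] kills the generators, they generate over
    [Bbar]. *)
Lemma std_ind (P : standard E -> Prop) : P 0 -> (forall x y, P x -> P y -> P (x + y)) ->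
  (forall i u e, Cd i u -> P (u *: iot e)) -> forall x, P x.
Proof.
move=> P0 PD PC x; have [s [sP ->]] := std_span x.
rewrite big_seq; elim/big_ind: _ => // _ /sP[a [e ->]].
move: a; apply: (tri_ind (T := T)) => [|a b Pa Pb|i [|j] u h b ui hH bj].
- by rewrite scale0r.
- by rewrite scalerDl; apply: PD.
- have [c ->] := Bd0_scalar bj.
  have hH' : h * c%:A \in H by rewrite rpredM ?kH.
  by rewrite -mulrA -scalerA -[_ *: iot e](iotH (SubAlg hH')); apply: PC ui.
by rewrite -scalerA (iot_killed _ bj) scaler0.
Qed.

(** The relations of [Delta(E)] say that [E] is an [H]-module killed by
    [B^{>0}]. *)
Lemma std_hom M (phi : {linear E -> hmod M}) : (forall e, killed (phi e : M)) ->
  exists g : {linear standard E -> M}, forall e, g (iot e) = phi e.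
Proof.
move=> kphi; have [|||a j b e bj|g [gD gE]] := @std_map M (fun a e => a *: (phi e : M)).
- by move=> e a b; rewrite scalerDl.
- by move=> a e e'; rewrite linearD -scalerDr.
- move=> a h e; have -> : phi (h *: e) = h *: phi e by rewrite linearZ.
  by rewrite -scalerA.
- by rewrite -scalerA (kphi e j b bj) scaler0.
have gl : linear g.
  move=> a x y; rewrite gD; congr (_ + _).
  have g0 : g 0 = 0 by apply: (addrI (g 0)); rewrite -gD !addr0.
  have [s [sP ->]] := std_span x; rewrite big_seq.
  elim/big_ind: _ => [|u v IHu IHv|_ /sP[b [e ->]]]; first by rewrite scaler0 g0 scaler0.
    by rewrite scalerDr !gD scalerDr IHu IHv.
  have -> : a *: (b *: iot e) = (a * b) *: iot e by rewrite scalerA.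
  apply: (etrans (gE (a * b) e)); apply: (etrans (esym (scalerA a b _))).
  by congr (_ *: _); apply/esym/gE.
by exists (mklin gl) => e; rewrite /= -[iot e]scale1r gE scale1r.
Qed.

Lemma std_hom_uniq M (f g : {linear standard E -> M}) :
  (forall e, f (iot e) = g (iot e)) -> f =1 g.
Proof.
move=> fg x; have [s [sP ->]] := std_span x; rewrite !linear_sum !big_seq.
by apply: eq_bigr => _ /sP[a [e ->]]; rewrite !linearZ /= fg.
Qed.

(** Over [Bbar] the standard object is already generated by [E]. *)
Lemma bh_uniq M (f g : standard E -> M) : bhmap f -> bhmap g ->
  (forall e, f (iot e) = g (iot e)) -> f =1 g.
Proof.
move=> fb gb fg; apply: std_ind => [|x y IHx IHy|i u e ui].
- by rewrite (eqmap0 fb) (eqmap0 gb).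
- by rewrite (eqmD fb) (eqmD gb) IHx IHy.
by rewrite (eqmS fb) ?(eqmS gb) ?fg //; apply: Cd_C ui.
Qed.

(** The projection [ev0] of a standard object onto its lowest weight space is
    induced by [rho]. *)
Lemma ev0_ex : exists g : standard E -> E, {morph g : x y / x + y} /\
  forall a e, g (a *: iot e) = rhoH a *: e.
Proof.
apply: std_map => [e a b|a e e'|a h e|a j b e bj].
- by rewrite rhoD scalerDl.
- by rewrite scalerDr.
- by rewrite rho_Hr scalerA.
by rewrite (rho_B _ bj) scale0r.
Qed.
Definition ev0 := projT1 (cid ev0_ex).
Lemma ev0D : {morph ev0 : x y / x + y}. Proof. by case: (projT2 (cid ev0_ex)). Qed.
Lemma ev0E a e : ev0 (a *: iot e) = rhoH a *: e.
Proof. by case: (projT2 (cid ev0_ex)). Qed.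
Lemma ev0_iot e : ev0 (iot e) = e.
Proof. by rewrite -[iot e]scale1r ev0E rho1 scale1r. Qed.
Lemma ev00 : ev0 0 = 0. Proof. by apply: (addrI (ev0 0)); rewrite -ev0D !addr0. Qed.

Variable c : k.
Hypothesis cE : forall e : E, del0 T *: e = c%:A *: e.

Lemma killed_weight M (phi : {linear E -> hmod M}) e :
  killed (phi e : M) -> gw (- c) (phi e : M).
Proof.
move=> ke; apply/gwP; exists 1%N; rewrite expr1 pdXC scalerBl d_killed //.
have -> : d0 *: (phi e : M) = c%:A *: (phi e : M).
  have e1 : phi (del0 T *: e) = del0 T *: phi e by rewrite linearZ.
  have e2 : phi (c%:A *: e) = c%:A *: phi e by rewrite linearZ.
  by rewrite -[LHS]/(del0 T *: phi e) -e1 cE e2.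
by rewrite scaleNr scaleNr opprK addNr.
Qed.
Lemma iot_gw e : gw (- c) (iot e).
Proof. exact: (killed_weight (phi := iotl)) (iot_killed e). Qed.
Lemma iotC_gw i u e : Cd i u -> gw (- c + zk i%:Z) (u *: iot e).
Proof. by move=> ui; apply: (gw_scale (Cd_G ui) (iot_gw e)). Qed.

Lemma std_wt : wt (standard E).
Proof.
apply: std_ind => [|x y|i u e ui]; [exact: fin_sum0|exact: fin_sumD|].
by apply: fin_sum1; eexists; apply: iotC_gw ui.
Qed.


Lemma std_gw al (x : standard E) : gw al x ->
  fin_sum (fun x => exists i u e, [/\ - c + zk i%:Z = al, Cd i u & x = u *: iot e]) x.
Proof.
move=> xal; rewrite -(wproj_id std_wt xal); move: x {xal}.
apply: std_ind => [|x y IHx IHy|i u e ui].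
- by rewrite wproj0; [apply: fin_sum0|apply: std_wt].
- by rewrite wprojD; [apply: fin_sumD|apply: std_wt].
have [ei|ne] := eqVneq (- c + zk i%:Z) al; last first.
  by rewrite (wproj_neq std_wt (iotC_gw e ui) ne); apply: fin_sum0.
rewrite wproj_id; [|exact: std_wt|by rewrite -ei; apply: iotC_gw].
by apply: fin_sum1; exists i, u, e.
Qed.

Lemma std_gw_lowest (x : standard E) : gw (- c) x -> exists e, x = iot e.
Proof.
move=> /std_gw[s [sP ->]]; rewrite big_seq; elim/big_ind: _ => [|_ _ [e ->] [e' ->]|_ /sP[i [u [e [ei ui ->]]]]].
- by exists 0; apply: esym (linear0 iotl).
- by exists (e + e'); rewrite iotD.
have i0 : i%:Z = 0 by apply: zk_inj; apply: (addrI (- c)); rewrite ei /zk addr0.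
move: ui; case: i0 => -> /Cd0_scalar[a ->].
by exists (a%:A *: e); rewrite iotH.
Qed.

Lemma std_gw_neq0 al (x : standard E) : gw al x -> x <> 0 -> exists i : nat, al = - c + zk i%:Z.
Proof.
move=> /std_gw[s [sP ->]] x0; have [[i ->]|no] := EM (exists i : nat, al = - c + zk i%:Z); first by exists i.
case: x0; rewrite big_seq big1 // => y /sP[i [u [e [ei _ _]]]].
by case: no; exists i.
Qed.

Lemma ev0_bhfun : bhfun (- c) ev0.
Proof.
split=> [|h m|j x m xj|be m mbe ne]; first exact: ev0D.
- have [s [sP ->]] := std_span m; rewrite big_seq.
  elim/big_ind: _ => [|u v IHu IHv|_ /sP[b [e ->]]]; first by rewrite scaler0 ev00 scaler0.
    by rewrite scalerDr !ev0D IHu IHv scalerDr.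
  have -> : (h : A) *: (b *: iot e) = ((h : A) * b) *: iot e by rewrite scalerA.
  apply: (etrans (ev0E _ e)); rewrite rho_Hl; apply: (etrans (esym (scalerA h (rhoH b) e))).
  by congr (_ *: _); apply/esym/ev0E.
- have [s [sP ->]] := std_span m; rewrite big_seq.
  elim/big_ind: _ => [|u v IHu IHv|_ /sP[b [e ->]]]; first by rewrite scaler0 ev00.
    by rewrite scalerDr !ev0D IHu IHv addr0.
  by rewrite [_ *: (b *: _)]scalerA ev0E (rho_C _ xj) scale0r.
have [s [sP ->]] := std_gw mbe; rewrite big_seq.
elim/big_ind: _ => [|u v IHu IHv|_ /sP[i [u [e [ei ui ->]]]]]; first exact: ev00.
  by rewrite ev0D IHu IHv addr0.
rewrite ev0E; case: i ei ui => [|i] ei ui.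
  by case/eqP: ne; rewrite -ei /zk addr0.
by rewrite -[u]mulr1 (rho_C _ ui) scale0r.
Qed.

Hypothesis Esp : spanned (fun _ : kmod E => True).

Lemma neg_killed M (v : M) n a : killed v -> a \in G (- n.+1%:Z) -> a *: v = 0.
Proof.
move=> kv an; rewrite -(hc_id an) {an}; move: a; apply: (tri_ind (T := T)) => [|x y|i j x h b xi hH bj].
- by rewrite linear0 scale0r.
- by rewrite linearD scalerDl => -> ->; rewrite addr0.
have g := @tri_gr _ _ _ _ _ T _ _ _ _ _ xi hH bj.
have [e|ne] := eqVneq (- n.+1%:Z) (i%:Z - j%:Z); last by rewrite (hc_neq g ne) scale0r.
rewrite e hc_id // -scalerA; case: j bj {g} e => [|j] bj e; last by rewrite (kv j) ?scaler0.
by move: e; rewrite subr0; case: i {xi}.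
Qed.

Lemma std_O : O (standard E).
Proof.
apply: mkO; last first.
- move=> al; have [[i ei]|no] := EM (exists i : nat, al = - c + zk i%:Z); last first.
    exists [::] => x xal; have [->|x0] := EM (x = 0); first by rewrite rpred0.
    by case: no; have [i ->] := std_gw_neq0 xal x0; exists i.
  have fl (e : kmod E) : linear ((fun u => u *: iot e) : A -> kmod (standard E)).
    by move=> a x y; rewrite scalerDl kscaleE scalerA mulr_algl.
  have fr u : linear ((fun e => u *: iot e) : kmod E -> kmod (standard E)).
    move=> a x y; rewrite iotD scalerDr; congr (_ + _).
    by rewrite kscaleE iotH kscaleE !scalerA kmulC.
  apply: spanned_sub (spanned_fin_sum (spanned_bilin fl fr (Cd_spanned k_char0 T i) Esp)) => x /std_gw.
  move=> [s [sP ->]]; exists s; split=> // y /sP[i' [u [e [ei' ui ->]]]]; exists u, e; split=> //.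
  suff -> : i = i' by [].
  by have := etrans ei' ei => /addrI/zk_inj[->].
- exact: std_wt.
apply: std_ind => [|x y [n nP] [m mP]|i u e ui].
- by exists 0%N => j b _ _; rewrite scaler0.
- exists (maxn n m) => j b; rewrite gtn_max => /andP[jn jm] bj.
  by rewrite scalerDr (nP j) ?(mP j) ?addr0.
exists i => j b ij bj; rewrite scalerA; apply: (@neg_killed _ _ (j - i.+1)%N); first exact: iot_killed.
apply: (grM (Bd_G bj) (Cd_G ui)).
by rewrite subnSK // -subzn ?(ltnW ij) // opprB addrC.
Qed.
End OneModule.
End Standard.

(** * Costandard objects *)

Section Costandard.
Variables (k0 : closedFieldType) (k : fieldType) (sigma : {rmorphism k0 -> k}).
Hypothesis k_char0 : [pchar k] =i pred0.
Variables (A : algType k) (H0 : falgType k0) (T : triangular_algebra sigma A H0).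
Local Notation G := (gr T).
Local Notation B := (Bm T).
Local Notation H := (Hs T).
Local Notation HH := (sub_alg (Hs T)).
Local Notation d := (del T).
Local Notation d' := (del' T).
Local Notation d0 := (del0 T : A).
Local Notation Cd := (Cd T).
Local Notation Bd := (Bd T).
Local Notation hc := (hc T).
Hint Resolve Cd_C Bd_B Cd_G Bd_G : core.
Local Notation gw := (gen_weight T).
Local Notation wt := (wt T).
Local Notation wproj := (wproj T).
Local Notation zk := (@zk k).
Local Notation hmod M := (hmod_of (Hs T) M).
Local Notation O := (category_O T).
Local Notation killed := (@killed _ _ _ _ _ T _).
Local Notation rhoH := (rhoH T).
Implicit Types M N : lmodType A.
Variable E : lmodType HH.
Variable c : k.
Hypothesis cE : forall e : E, del0 T *: e = c%:A *: e.
Hypothesis Esp : spanned (fun _ : kmod E => True).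
Local Notation nab := (@costandard _ _ _ _ _ T E).
Local Notation std := (@standard _ _ _ _ _ T E).

Lemma nabD (f : nab) x y : f (x + y) = f x + f y. Proof. exact: costdD. Qed.
Lemma nab0 (f : nab) : f 0 = 0. Proof. by apply: (addrI (f 0)); rewrite -nabD !addr0. Qed.
Lemma nabB (f : nab) x y : f (x - y) = f x - f y.
Proof.
rewrite nabD; congr (_ + _); apply: (addrI (f y)).
by rewrite -nabD !subrr nab0.
Qed.

(** The functional through which all others factor; see [nab_hom]. *)
Definition ev1 (f : nab) : E := f 1.
Lemma nabE a (f : nab) x : @costd_val _ _ _ _ _ T E (a *: f) x = f (x * a). Proof. by []. Qed.
Lemma nab_ev a (f : nab) : f a = ev1 (a *: f). Proof. by rewrite /ev1 nabE mul1r. Qed.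
Lemma nabP (f g : nab) : (forall a, f a = g a) -> f = g.
Proof. by move=> fg; apply/val_inj/funext. Qed.
Lemma nab00 (f : nab) x : f = 0 -> f x = 0. Proof. by move->. Qed.
Lemma nabP0 (f : nab) : (forall a, f a = 0) -> f = 0.
Proof. by move=> f0; apply: nabP => a; rewrite f0 nab00. Qed.

Definition hgr i (f : nab) := homgr i (f : A -> E).

Lemma nab_ind (P : nab -> Prop) : P 0 -> (forall x y, P x -> P y -> P (x + y)) ->
  (forall i f, hgr i f -> P f) -> forall f, P f.
Proof.
move=> P0 PD PG f; have [s [sP fE]] : fin_sum (fun g => exists i, homgr i g) (f : A -> E).
  by case: f => f /= /asboolP.
elim: s f sP fE => [|g s IH] f sP fE.
  by rewrite (_ : f = 0) //; apply/val_inj; rewrite /= fE big_nil.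
have [i gi] := sP g (mem_head _ _).
have gP : g \in @costd_pred _ _ _ _ _ T E by apply/asboolP/fin_sum1; exists i.
rewrite -[f](subrK (Costd gP : nab)); apply: PD; last exact: (PG i).
apply: IH => [h hs|]; first by apply: sP; rewrite inE hs orbT.
by rewrite /= fE big_cons addrAC subrr add0r.
Qed.

Lemma nabH (f : nab) (h : HH) x : f ((h : A) * x) = h *: f x.
Proof.
move: f; apply: nab_ind => [|f g IHf IHg|i f fi]; last exact: (homgrH fi).
  by rewrite !(nab00 _ erefl) scaler0.
by rewrite -[LHS]/(f _ + g _) IHf IHg -scalerDr.
Qed.
Lemma nab_k (f : nab) (a : k) x : f (x * a%:A) = (a%:A : HH) *: f x.
Proof. by rewrite kmulC -nabH. Qed.
Lemma nabC (f : nab) j b x : Cd j.+1 b -> f (b * x) = 0.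
Proof.
move=> [bC bj]; move: f; apply: nab_ind => [|f g IHf IHg|i f fi] //.
  by rewrite -[LHS]/(f _ + g _) IHf IHg addr0.
exact: (homgrBbar fi) bC bj.
Qed.

Lemma hgr_scale i j a f : hgr i f -> a \in G j -> hgr (i + j) (a *: f).
Proof.
case=> fD fH fC fd aj; split=> [x y|h x|l b x bC bl|l x xl ne]; rewrite nabE.
- by rewrite mulrDl fD.
- by rewrite -mulrA fH.
- by rewrite -mulrA (fC l).
by rewrite (fd (l + j)) //; [apply: (grM xl aj)|rewrite [l + j]addrC addrA].
Qed.

Lemma nab_pos j (f : nab) x : x \in G j.+1%:Z -> f x = 0.
Proof.
move=> xj; rewrite -(hc_id xj) {xj}; move: x; apply: (tri_ind (T := T)) => [|x y|l m x h b xl hH bm].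
- by rewrite linear0 nab0.
- by rewrite linearD nabD => -> ->; rewrite addr0.
have g := tri_gr xl hH bm.
have [e|ne] := eqVneq (j.+1%:Z) (l%:Z - m%:Z); last by rewrite (hc_neq g ne) nab0.
rewrite e hc_id // -mulrA; case: l xl {g} e => [|l] xl e; last exact: (nabC _ _ xl).
by move: e; rewrite sub0r; case: m {bm}.
Qed.

Lemma hgr_neg n f : hgr (- n.+1%:Z) f -> f = 0.
Proof.
move=> fn; apply: nabP0 => a.
move: a; apply: (gr_ind (T := T)) => [|x y|i x xi]; first exact: nab0.
  by rewrite nabD => -> ->; rewrite addr0.
have [e|ne] := eqVneq (- n.+1%:Z + i) 0; last exact: (homgr_deg fn) xi ne.
by apply: (@nab_pos n); move/eqP: e; rewrite addrC subr_eq0 => /eqP <-; exact: xi.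
Qed.

Lemma hgr_gw i f : hgr i f -> gw (- c + zk i) f.
Proof.
move=> fi; apply/gwP; exists 1%N; rewrite expr1 pdXC; apply: nabP0 => x.
rewrite nabE; move: x; apply: (gr_ind (T := T)) => [|x y|j x xj].
- by rewrite mul0r nab0.
- by rewrite mulrDl nabD => -> ->; rewrite addr0.
have xd : x * (d - (- c + zk i)%:A) \in G j.
  apply: (grM xj (_ : _ \in G 0)); last by rewrite addr0.
  by apply: grD; [apply: del_gr|rewrite -scaleN1r; apply/grZ/kG].
have [e|ne] := eqVneq (i + j) 0; last exact: (homgr_deg fi) xd ne.
have -> : x * (d - (- c + zk i)%:A) = d' * x - d0 * x + c *: x.
  rewrite mulrBr -mulrBl -(del_decomp T) (d_shift xj) mulrDr !mulr_algr -addrA; congr (_ + _).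
  rewrite scalerDl opprD scaleNr opprK addrC -scalerDl -scaleNr -scalerDl; congr (_ *: _).
  have -> : j = - i by apply/eqP; rewrite -addr_eq0 addrC; apply/eqP.
  by rewrite /zk mulrNz addrC.
rewrite nabD nabB -[d0 * x]/((del0 T : A) * x) nabH.
have -> : f (d' * x) = 0.
  have [s [sP ->]] := d'_form T; rewrite mulr_suml big_seq.
  elim/big_ind: _ => [|u v|_ /sP[l [y [h [b [yl _ _ ->]]]]]]; first exact: nab0.
    by rewrite nabD => -> ->; rewrite addr0.
  by rewrite -!mulrA (nabC _ _ yl).
have -> : f (c *: x) = c%:A *: f x.
  by rewrite -nabH; congr (f _); rewrite /= mulr_algl.
by rewrite sub0r cE addNr.
Qed.

Lemma nab_wt : wt nab.
Proof.
apply: nab_ind => [|x y|i f fi]; [exact: fin_sum0|exact: fin_sumD|].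
by apply: fin_sum1; eexists; apply: hgr_gw fi.
Qed.

Lemma hgr0 i : hgr i 0.
Proof. by split=> [x y|h x|j b x _ _|j x _ _]; rewrite !(nab00 _ erefl) ?addr0 ?scaler0. Qed.
Lemma hgrD i f g : hgr i f -> hgr i g -> hgr i (f + g).
Proof.
case=> fD fH fC fd [gD gH gC gd].
have e x : @costd_val _ _ _ _ _ T E (f + g) x = f x + g x by [].
split=> [x y|h x|l b x bC bl|l x xl ne]; rewrite !e.
- by rewrite fD gD addrACA.
- by rewrite fH gH scalerDr.
- by rewrite (fC l) ?(gC l) ?addr0.
by rewrite (fd l) ?(gd l) ?addr0.
Qed.

(** Weight spaces of a costandard object are its graded pieces. *)
Lemma nab_gw al (f : nab) : gw al f -> f = 0 \/ exists i : nat, al = - c + zk i%:Z /\ hgr i f.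
Proof.
move=> fal; have [i [ei fi]] : exists i, (al <> - c + zk i -> f = 0) /\ hgr i f.
  rewrite -(wproj_id nab_wt fal); have [[i ei]|no] := EM (exists i, al = - c + zk i).
    exists i; split=> //; move: f {fal}.
    apply: nab_ind => [|f g IHf IHg|j f fj]; first by rewrite wproj0; [apply: hgr0|apply: nab_wt].
      by rewrite wprojD; [apply: hgrD|apply: nab_wt].
    have [eij|ne] := eqVneq (- c + zk j) al.
      have <- : j = i by apply: (zk_inj k_char0); apply: (addrI (- c)); rewrite eij.
      rewrite wproj_id //; [exact: nab_wt|rewrite -eij; exact: hgr_gw].
    by rewrite (wproj_neq nab_wt (hgr_gw fj) ne); apply: hgr0.
  exists 0; suff -> : wproj al f = 0 by split=> //; apply: hgr0.
  move: f {fal}; apply: nab_ind => [|f g IHf IHg|j f fj]; first by rewrite wproj0 //; apply: nab_wt.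
    by rewrite wprojD ?IHf ?IHg ?addr0 //; apply: nab_wt.
  apply: (wproj_neq nab_wt (hgr_gw fj)); apply/eqP => ej; apply: no; exists j.
  by rewrite ej.
have [e|ne] := EM (al = - c + zk i); last by left; apply: ei.
case: i fi e {ei} => [i|n] fi e; first by right; exists i.
by left; apply: (@hgr_neg n).
Qed.

(** By linearity over [Bbar H], a map of degree [i] is determined by its
    values on [B^i]. *)
Lemma nab_vals i (f : nab) : hgr i%:Z f -> (forall b, Bd i b -> f b = 0) -> f = 0.
Proof.
move=> fi f0; apply: nabP0 => a; move: a.
apply: (tri_ind (T := T)) => [|x y|j l x h b xj hH bl]; first exact: nab0.
  by rewrite nabD => -> ->; rewrite addr0.
case: j xj => [|j] xj; last by rewrite -mulrA (nabC _ _ xj).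
have [a ->] := Cd0_scalar xj; rewrite -mulrA mulr_algl.
have ahH : a *: h \in H by apply: rpredZ.
rewrite scalerAl -[a *: h]/(SubAlg ahH : A) nabH; have [e|ne] := eqVneq i l.
  by rewrite f0 ?scaler0 // e.
rewrite (homgr_deg fi (Bd_G bl)) ?scaler0 // subr_eq0 eqz_nat //.
Qed.

Lemma nab_O : O nab.
Proof.
apply: mkO; last first.
- move=> al; have [[i ei]|no] := EM (exists i : nat, al = - c + zk i%:Z); last first.
    exists [::] => x xal; have [->|x0] := EM (x = 0); first by rewrite rpred0.
    by have [//|[i [ei _]]] := nab_gw xal; case: no; exists i.
  have [s sB] := Bd_spanned k_char0 T i.
  apply: (@spanned_values _ (kmod nab) (kmod E) _ (fun _ => True) (size s)
    (fun l f => (f : nab) (hc (- i%:Z) s`_l)) (@gw_subm _ _ _ _ _ T nab al) Esp) => //.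
    move=> l a f g; rewrite kscaleE -[LHS]/((a%:A *: (f : nab)) _ + g _) nabE nab_k.
    by [].
  move=> f fal f0; have [//|[i' [ei' fi]]] := nab_gw fal.
  have e : i' = i.
    by have := etrans (esym ei') ei => /addrI/(zk_inj k_char0)[].
  rewrite {}e in fi; apply: (nab_vals fi) => b bi.
  have Ps : subm (fun a : A => f (hc (- i%:Z) a) = 0).
    split=> [|a x y xP yP]; first by rewrite linear0 nab0.
    by rewrite linearP nabD yP addr0 -mulr_algr nab_k xP scaler0.
  have /in_mksub : b \in mksub Ps.
    apply: (lspan_in _ (sB b bi)) => x xs; apply/in_mksub.
    have xi : (index x s < size s)%N by rewrite index_mem.
    by have := f0 (Ordinal xi); rewrite /= nth_index.
  by rewrite hc_id //; apply: Bd_G bi.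
- exact: nab_wt.
apply: nab_ind => [|x y [n nP] [m mP]|i f fi].
- by exists 0%N => j b _ _; rewrite scaler0.
- exists (maxn n m) => j b; rewrite gtn_max => /andP[jn jm] bj.
  by rewrite scalerDr (nP j) ?(mP j) ?addr0.
exists `|i|%N => j b ij bj; have := hgr_scale fi (Bd_G bj).
suff [n ->] : exists n : nat, i - j%:Z = - n.+1%:Z by exact: hgr_neg.
case: i {fi} ij => [i|i] /= ij.
  by exists (j - i.+1)%N; rewrite subnSK // -subzn ?(ltnW ij) // opprB.
by exists (i + j)%N; rewrite NegzE -opprD -PoszD.
Qed.

Lemma ev1_bhfun : bhfun (- c) ev1.
Proof.
split=> [x y|h f|j x f xj|be f fbe ne] //.
- by rewrite /ev1 nabE mul1r -{1}[h : A]mulr1 nabH.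
- by rewrite /ev1 nabE mul1r -[x]mulr1 (nabC _ _ xj).
have [->//|[[|i] [ei fi]]] := nab_gw fbe; first by case/eqP: ne; rewrite ei /zk addr0.
by apply: (homgr_deg fi (one_gr T)); rewrite addr0.
Qed.

(** Frobenius reciprocity: a morphism to the costandard object is a functional
    that is linear over [H] and killed by [Bbar_{>0}]. *)
Lemma nab_hom M (f : M -> E) : wt M -> bhfun (- c) f ->
  exists g : {linear M -> nab}, forall m, ev1 (g m) = f m.
Proof.
move=> wM fb.
have fP m : (fun a => f (a *: m)) \in @costd_pred _ _ _ _ _ T E.
  apply/asboolP; move: m (wM m).
  pose F (m : M) : A -> E := fun a => f (a *: m).
  apply: (fin_sum_map (f := F)) => [|x y|m [be mbe]].
  - by apply/funext => a; rewrite /F scaler0 (fn0 fb).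
  - by apply/funext => a; rewrite /F scalerDr (fnD fb).
  apply: fin_sum1.
  have base i : (forall j x, x \in G j -> i + j != 0 -> F m x = 0) -> exists i, homgr i (F m).
    move=> Hi; exists i; split=> // [x y|h x|j b x bC bj]; rewrite /F.
    - by rewrite scalerDl (fnD fb).
    - by rewrite -scalerA (fnH fb).
    by rewrite -scalerA (fnC fb (j := j)).
  have [[i ei]|no] := EM (exists i, be = - c + zk i).
    apply: (base i) => j x xj ij; apply: (fnW fb (gw_scale xj mbe)); rewrite ei -addrA.
    apply: contra ij => /eqP; rewrite -{2}[- c]addr0 => /addrI.
    by rewrite /zk -rmorphD => /(@zk_inj k k_char0 _ 0) ->.
  apply: (base 0) => j x xj _; apply: (fnW fb (gw_scale xj mbe)).
  apply/eqP => e; apply: no; exists (- j); rewrite -e /zk mulrNz addrK //.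
pose g m : nab := Costd (fP m).
have gl : linear g.
  move=> a x y; apply: nabP => b.
  rewrite -[RHS]/((a *: g x) b + g y b) nabE -[LHS]/(f _) -[g x _]/(f _) -[g y _]/(f _).
  by rewrite scalerDr (fnD fb) scalerA.
by exists (mklin gl) => m; rewrite -[LHS]/(f (1 *: m)) scale1r.
Qed.


(** The maps [kap e] vanish on [A B^{>0}]: they form the socle over [B], which
    is a copy of [E]. *)
Lemma kap_subproof (e : E) : (fun a => rhoH a *: e) \in @costd_pred _ _ _ _ _ T E.
Proof.
apply/asboolP/fin_sum1; exists 0; split=> [x y|h x|j b x bC bj|j x xj].
- by rewrite rhoD scalerDl.
- by rewrite rho_Hl scalerA.
- by rewrite (rho_C (j := j)) ?scale0r.
by rewrite add0r => j0; rewrite (rho_G xj j0) scale0r.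
Qed.
Definition kap (e : E) : nab := Costd (kap_subproof e).
Lemma kapE e a : kap e a = rhoH a *: e. Proof. by []. Qed.
Lemma kap1 e : ev1 (kap e) = e. Proof. by rewrite /ev1 kapE rho1 scale1r. Qed.
Lemma kap_lin : linear (kap : E -> hmod nab).
Proof.
move=> h x y; apply: nabP => a; rewrite kapE scalerDr scalerA -rho_Hr.
by rewrite -[RHS]/(kap x (a * (h : A)) + kap y a) !kapE.
Qed.
Definition kapl : {linear E -> hmod nab} := mklin kap_lin.
Lemma kap_killed e : killed (kap e).
Proof.
by move=> j b bj; apply: nabP0 => a; rewrite nabE kapE (rho_B _ bj) scale0r.
Qed.

Lemma nab_low (f : nab) : (forall (j : nat) h b, h \in H -> Bd j.+1 b -> f (h * b) = 0) ->
  f = kap (ev1 f).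
Proof.
move=> fB; apply: nabP => a; move: a; apply: (tri_ind (T := T)) => [|x y IHx IHy|i j x h b xi hH bj].
- by rewrite nab0 kapE rhoN0 scale0r.
- by rewrite !nabD IHx IHy.
case: i xi => [|i] xi; last by rewrite -mulrA (nabC _ _ xi) kapE (rho_C _ xi) scale0r.
have [u ->] := Cd0_scalar xi; rewrite -mulrA mulr_algl.
case: j bj => [|j] bj; last first.
  have uH : u *: h \in H by apply: rpredZ.
  by rewrite scalerAl (fB j) // kapE (rho_B _ bj) scale0r.
have [v ->] := Bd0_scalar bj; rewrite mulr_algr.
have uH : u *: (v *: h) \in H by do 2!apply: rpredZ.
by rewrite -[_ *: _](mulr1 (SubAlg uH : A)) nabH [kap _ _]nabH kapE rho1 scale1r.
Qed.

Lemma nab_killed (f : nab) : killed f -> f = kap (ev1 f).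
Proof.
move=> kf; apply: nab_low => j h b hH bj; rewrite -[h]/(SubAlg hH : A) nabH.
by rewrite nab_ev (kf j) // /ev1 scaler0.
Qed.

Lemma nab_gw_lowest (f : nab) : gw (- c) f -> f = kap (ev1 f).
Proof.
move=> /nab_gw[->|[i [ei fi]]].
  by rewrite /ev1 (nab00 _ erefl); apply: esym (linear0 kapl).
have i0 : i%:Z = 0 by apply: (zk_inj k_char0); apply: (addrI (- c)); rewrite -ei /zk addr0.
apply: nab_low => j h b hH bj; apply: (homgr_deg fi (grM (Hgr hH) (Bd_G bj) erefl)).
by rewrite i0 !add0r oppr_eq0.
Qed.

Hypothesis Es : simple_mod E.

(** If [f] does not vanish at [a], then [a *: f] has a nonzero component in the
    lowest weight space. *)
Lemma nab_socle (N : submodClosed nab) f : f \in N -> f <> 0 -> forall e, kap e \in N.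
Proof.
move=> fN f0 e.
have [a fa] : exists a, f a <> 0.
  by apply: contrapT => no; apply: f0; apply: nabP => a; apply: contrapT => fa; apply: no; exists a.
pose g := wproj (- c) (a *: f).
have gN : g \in N by apply: wproj_in; [apply: nab_wt|apply: rpredZ].
have g1 : ev1 g <> 0.
  by rewrite /g -(fn_wproj _ nab_wt ev1_bhfun) -nab_ev.
have gk : g = kap (ev1 g) by apply/nab_gw_lowest/wproj_gw/nab_wt.
have Ks : subm (fun e : E => kap e \in N).
  split=> [|h x y xN yN]; first by rewrite -[kap 0]/(kapl 0) linear0; apply: rpred0.
  rewrite -[kap _]/(kapl _) linearP; apply: rpredD => //.
  by apply: (rpredZ (h : A)).
have /in_mksub // : e \in mksub Ks.
apply: (simple_sub_all Es (x := ev1 g)) => //.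
by apply/in_mksub; rewrite -gk.
Qed.

Lemma std_to_costd_ex : exists g : {linear std -> nab}, forall e, g (iot e) = kap e.
Proof. exact: (std_hom (phi := kapl)) kap_killed. Qed.
Definition std_to_costd := projT1 (cid std_to_costd_ex).
Lemma std_to_costd_iot e : std_to_costd (iot e) = kap e. Proof. exact: (projT2 (cid std_to_costd_ex)). Qed.

(** The simple object [L(E)], as the image of [Delta(E)] in [nabla(E)]. *)
Definition smod : lmodType A := sub_mod (image_mod std_to_costd).
Definition smodi : {linear smod -> nab} := incl (image_mod std_to_costd).
Lemma smodi_inj : injective smodi. Proof. exact: incl_inj. Qed.

Lemma std_to_costd_in x : std_to_costd x \in image_mod std_to_costd.
Proof. by apply/in_image_mod; exists x. Qed.

Lemma smod_simple : simple_mod smod.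
Proof.
have [[e e0] _] := Es; split.
  have [x xE] := in_incl (std_to_costd_in (iot e)); exists x; apply/eqP => x0.
  case/eqP: e0; rewrite -(kap1 e) -std_to_costd_iot -xE x0 linear0.
  by [].
move=> N; have [N0|/existsNP[x /not_implyP[xN x0]]] := EM (forall x, x \in N -> x = 0); [by left|right=> y].
have kN : forall e, kap e \in imm smodi N.
  apply: (@nab_socle _ (smodi x)); first by apply/in_mksub; exists x.
  by move=> /(inj_linear0 smodi_inj).
have /in_image_mod[z zy] := incl_in y.
have : smodi y \in imm smodi N.
  rewrite -[smodi y]zy; have [s [sP ->]] := std_span z.
  rewrite linear_sum big_seq; apply: rpred_sum => _ /sP[a [e' ->]].
  by rewrite linearZ; apply: rpredZ; rewrite /= std_to_costd_iot.
by move=> /in_mksub[y' y'N /smodi_inj <-].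
Qed.

Lemma smod_proj : exists p : {linear std -> smod}, surj p /\ forall x, smodi (p x) = std_to_costd x.
Proof.
have [p pE] := corestrict std_to_costd_in; exists p; split=> // y.
have /in_image_mod[x xy] := incl_in y; exists x; apply: smodi_inj.
by rewrite pE.
Qed.

Lemma nab_unique_simple : unique_simple_submodule nab smod.
Proof.
have inkap (S' : lmodType A) (g : {linear S' -> nab}) : simple_mod S' -> injective g ->
    forall x, (exists y, g y = x) <-> (exists y, smodi y = x).
  move=> S's gi x; have [[y y0] _] := S's.
  have kN e : kap e \in image_mod g.
    apply: (@nab_socle (image_mod g) (g y)); first by apply/in_image_mod; exists y.
    by move=> /(inj_linear0 gi) e0; case/eqP: y0.
  split=> [[z zx]|[z zx]]; last first.
    have /in_image_mod[w wz] := incl_in z; apply/in_image_mod.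
    rewrite -zx -[smodi z]wz; have [s [sP ->]] := std_span w.
    rewrite linear_sum big_seq; apply: rpred_sum => _ /sP[a [e ->]].
    by rewrite linearZ; apply: rpredZ; rewrite /= std_to_costd_iot.
  have [[e e0] _] := Es.
  have e1 : (iot e : std) <> 0.
    by move=> i0; case/eqP: e0; rewrite -(ev0_iot e) i0 ev00.
  have /in_mksub : z \in prem g (image_mod std_to_costd).
    have /in_image_mod[u uE] := kN e.
    apply: (simple_sub_all S's (x := u)).
      by apply/in_mksub; rewrite uE -std_to_costd_iot; apply: std_to_costd_in.
    by move=> u0; case/eqP: e0; rewrite -(kap1 e) -uE u0 linear0.
  by move=> /in_incl[y' y'E]; exists y'; rewrite -zx.
by split; [apply: smod_simple|exists smodi; [apply: smodi_inj|]].
Qed.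
End Costandard.

(** * Projective objects representing the weight spaces *)

Section Projectives.
Variables (k0 : closedFieldType) (k : fieldType) (sigma : {rmorphism k0 -> k}).
Hypothesis k_char0 : [pchar k] =i pred0.
Variables (A : algType k) (H0 : falgType k0) (T : triangular_algebra sigma A H0).
Local Notation G := (gr T).
Local Notation B := (Bm T).
Local Notation Bd := (Bd T).
Hint Resolve Cd_C Bd_B Cd_G Bd_G : core.
Local Notation JB := (JB T).
Local Notation JC := (JC T).
Local Notation pd := (pd T).
Local Notation gw := (gen_weight T).
Local Notation wt := (wt T).
Local Notation wproj := (wproj T).
Local Notation zk := (@zk k).
Local Notation O := (category_O T).
Local Notation killed := (@killed _ _ _ _ _ T _).
Implicit Types M N : lmodType A.
Variables (I : Type) (Irr : I -> lmodType (sub_alg (Hs T))).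
Hypothesis HIrr : simple_representatives (fun _ => True) Irr.
Local Notation cI := (cI Irr).

(** For modules built from graded pieces on which [del] has a single generalized
    eigenvalue. *)
Lemma gw_graded M (al : k) (X : int -> M -> Prop) :
    (forall i, X i 0) -> (forall i x y, X i x -> X i y -> X i (x + y)) ->
    (forall i x, X i x -> gw (al + zk i) x) ->
    (forall m, fin_sum (fun x => exists i, X i x) m) ->
  wt M /\ forall be m, gw be m -> m = 0 \/ exists2 i, be = al + zk i & X i m.
Proof.
move=> X0 XD Xg Xs.
have wM : wt M.
  move=> m; have [s [sP ->]] := Xs m; rewrite big_seq.
  elim/big_ind: _ => [|x y|x /sP[i xi]]; [exact: fin_sum0|exact: fin_sumD|].
  by apply: fin_sum1; exists (al + zk i); apply: Xg.
split=> // be m mbe; rewrite -(wproj_id wM mbe); have [s [sP ->]] := Xs m.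
have [[i ei]|no] := EM (exists i, be = al + zk i).
  right; exists i => //; rewrite big_seq; elim/big_ind: _ => [|x y|x /sP[j xj]].
  - by rewrite wproj0.
  - by rewrite wprojD //; apply: XD.
  have [e|ne] := eqVneq (al + zk j) be; last by rewrite (wproj_neq wM (Xg _ _ xj) ne).
  have <- : j = i by apply: (zk_inj k_char0); apply: (addrI al); rewrite e.
  by rewrite wproj_id // -e; apply: Xg.
left; rewrite big_seq; elim/big_ind: _ => [|x y|x /sP[j xj]].
- by rewrite wproj0.
- by rewrite wprojD // => -> ->; rewrite addr0.
by apply: (wproj_neq wM (Xg _ _ xj)); apply/eqP => e; apply: no; exists j.
Qed.

(** In characteristic zero the finitely many lowest weights bound below the
    weights of all objects of the category. *)
Lemma low_bound (al : k) : exists n, forall m i, al - zk m%:Z = - cI i -> (m <= n)%N.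
Proof.
have [n [l linj]] := finI HIrr.
have /choice[g gP] : forall j : 'I_n, exists m0, forall i m, l i = j -> al - zk m%:Z = - cI i -> (m <= m0)%N.
  move=> j; have [[i [m [lij em]]]|no] := EM (exists i m, l i = j /\ al - zk m%:Z = - cI i).
    exists m => i' m' li' em'; have ei : i' = i by apply: linj; rewrite lij.
    rewrite ei -em in em'; move: em' => /addrI.
    by move=> /oppr_inj/(zk_inj k_char0)[->].
  by exists 0%N => i m li em; case: no; exists i, m.
exists (\max_j g j) => m i e; apply: leq_trans (gP (l i) i m erefl e) _.
exact: leq_bigmax.
Qed.

Definition lowb al := projT1 (cid (low_bound al)).

(** An element of [B] would carry [x] to a vector killed by [B^{>0}], of a
    weight excluded by [low_bound]. *)
Lemma lowbP al M m (x : M) : O M -> (lowb al < m)%N -> gw (al - zk m%:Z) x -> x = 0.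
Proof.
move=> OM lm gx; apply: contrapT => x0.
have [m' [b [bm' bx0 kbx]]] := exists_killed (O_nil OM) x0.
have gb := gw_scale (Bd_G bm') gx.
have [i [_ [_ _ _ e]]] := killed_gw_irr k_char0 HIrr kbx gb bx0.
have : (m + m' <= lowb al)%N.
  apply: (projT2 (cid (low_bound al)) _ i).
  by rewrite -e PoszD /zk rmorphD opprD addrA mulrNz.
by rewrite leqNgt ltn_addr.
Qed.

Lemma lowb_B al M m b (x : M) : O M -> (lowb al < m)%N -> Bd m b -> gw al x -> b *: x = 0.
Proof.
move=> OM lm bm gx; apply: (lowbP OM lm).
by have := gw_scale (Bd_G bm) gx; rewrite /zk mulrNz.
Qed.

Lemma JB_kill al M a (x : M) : O M -> JB (lowb al) a -> gw al x -> a *: x = 0.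
Proof.
move=> OM [s [sP ->]] gx; rewrite scaler_suml big_seq big1 // => _ /sP[y [b [m [lm bm ->]]]].
by rewrite -scalerA (lowb_B OM lm bm gx) scaler0.
Qed.

Lemma JBD n x y : JB n x -> JB n y -> JB n (x + y).
Proof. exact: fin_sumD. Qed.

Lemma JB_subm n : subm (JB n).
Proof.
split=> [|a x y xP yP]; first exact: JB0.
by rewrite -mulr_algl; apply/JBD/yP/JB_mull.
Qed.
Lemma JC_subm n : subm (JC n).
Proof.
split=> [|a x y xP yP]; first exact: JC0.
by rewrite -mulr_algr; apply: fin_sumD yP; apply: JC_mulr.
Qed.

(** Polynomials in [del] have degree 0, and [A_0] is finite-dimensional modulo
    [J]. *)
Lemma slice_poly (J W : A -> Prop) : subm J -> spanned W ->
  (forall a, a \in G 0 -> exists2 w, W w & J (a - w)) -> exists2 Q : {poly k}, Q != 0 & J (pd Q).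
Proof.
move=> Js Wsp aW; pose q := qpi (mksub Js).
have ql : linear (fun p => q (pd p)).
  by move=> a p r; rewrite -mul_polyC pdD pdM pdC mulr_algl linearP.
have [|Q Q0 /qpi_eq0/in_mksub] := spanned_dependent (f := mklin ql); last by exists Q.
apply: spanned_sub (spanned_linear q Wsp) => _ [p _ <-].
have [w Ww Jw] := aW _ (pd_gr0 T p); exists w => //.
by apply/eqP; rewrite eq_sym -subr_eq0 -[mklin ql p]/(q (pd p)) -linearB; apply/eqP/qpi_eq0/in_mksub.
Qed.

Lemma root_split (Q : {poly k}) al : Q != 0 ->
  exists n R, R.[al] != 0 /\ Q = R * ('X - al%:P) ^+ n.
Proof.
move=> Q0; have [n [R /implyP/(_ Q0) nr e]] := multiplicity_XsubC Q al.
by exists n, R.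
Qed.

(** The exponent by which [del - al] is nilpotent on the weight space [al],
    uniformly over the category, with the cofactor [R] prime to [X - al]. The
    ideal [JB] serves for the projective objects and [JC] for the injective
    ones. *)
Lemma nil_ex al : exists NR : nat * {poly k}, [/\ NR.2.[al] != 0,
  JB (lowb al) (pd (NR.2 * ('X - al%:P) ^+ NR.1)) & JC (lowb al) (pd (NR.2 * ('X - al%:P) ^+ NR.1))].
Proof.
have [W [Wsp _ aW]] := slice_B k_char0 T (lowb al) 0.
have [V [Vsp _ aV]] := slice_C k_char0 T (lowb al) 0.
have [Q Q0 JQ] := slice_poly (JB_subm _) Wsp aW.
have [P P0 JP] := slice_poly (JC_subm _) Vsp aV.
have [n [R [Ra QE]]] := root_split al (mulf_neq0 P0 Q0).
exists (n, R); rewrite -QE; split=> //=; rewrite pdM; first exact: JB_mull.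
exact: JC_mulr.
Qed.
Definition nilN al := (projT1 (cid (nil_ex al))).1.
Definition nilR al := (projT1 (cid (nil_ex al))).2.
Lemma nilR_neq0 al : (nilR al).[al] != 0. Proof. by case: (projT2 (cid (nil_ex al))). Qed.
Lemma nilRN al : JB (lowb al) (pd (nilR al * ('X - al%:P) ^+ nilN al)).
Proof. by case: (projT2 (cid (nil_ex al))). Qed.
Lemma nilRN_C al : JC (lowb al) (pd (nilR al * ('X - al%:P) ^+ nilN al)).
Proof. by case: (projT2 (cid (nil_ex al))). Qed.
(** On every object of [O] the weight space [al] is the kernel of this
    element. *)
Definition dN al : A := pd (('X - al%:P) ^+ nilN al).

Lemma dN_kill al M (x : M) : O M -> gw al x -> dN al *: x = 0.
Proof.
move=> OM gx; apply: (@gw_cw _ _ _ _ _ T _ al).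
  by apply: gw_scale0 => //; apply: pd_gr0.
exists (nilR al); split; first exact: nilR_neq0.
by rewrite scalerA -pdM (JB_kill OM (nilRN al) gx).
Qed.

Lemma weight_proj_subproof al : subm (fun x : A^o => exists u y, JB (lowb al) u /\ x = u + y * dN al).
Proof.
split=> [|a _ _ [u [y [Ju ->]]] [v [z [Jv ->]]]].
  by exists 0, 0; rewrite mul0r addr0; split=> //; apply: JB0.
exists (a * u + v), (a * y + z); split; first by apply/JBD/Jv/JB_mull.
by rewrite -[a *: _]/(a * _) mulrDr mulrDl addrACA mulrA.
Qed.
(** On an object of [O], the left ideal [A B^{>n} + A (del - al)^N]
    annihilates the weight space [al] for suitable [n] and [N]. Hence the
    quotient of [A] by this ideal represents the functor of vectors of weight
    [al]. *)
Definition weight_proj_rel al : submodClosed (A^o : lmodType A) := mksub (weight_proj_subproof al).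
Definition weight_proj al : lmodType A := quot_mod (weight_proj_rel al).
Definition pq al : {linear A^o -> weight_proj al} := qpi (weight_proj_rel al).
Definition pgen al : weight_proj al := pq al 1.

Lemma pqE al (a : A) : pq al a = a *: pgen al.
Proof. by rewrite /pgen -linearZ -[a *: (1 : A^o)]/(a * 1) mulr1. Qed.
Lemma pq0 al (a : A) : JB (lowb al) a -> pq al a = 0.
Proof. by move=> Ja; apply/qpi_eq0/in_mksub; exists a, 0; rewrite mul0r addr0. Qed.
Lemma pq_span al (x : weight_proj al) : exists a : A, x = a *: pgen al.
Proof. by have [a <-] := qpi_surj x; exists a; rewrite -pqE. Qed.

Lemma pgen_gw al : gw al (pgen al).
Proof.
apply/gwP; exists (nilN al); rewrite -pqE; apply/qpi_eq0/in_mksub.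
by exists 0, 1; rewrite mul1r add0r; split=> //; apply: JB0.
Qed.

Lemma low_JB n l a : a \in G (- (n + l).+1%:Z) -> JB n a.
Proof.
move=> al; rewrite -(hc_id al) {al}; move: a; apply: (tri_ind (T := T)) => [|x y|i j x h b xi hH bj].
- by rewrite linear0; apply: JB0.
- by rewrite linearD; apply: JBD.
have g := tri_gr xi hH bj.
have [e|ne] := eqVneq (- (n + l).+1%:Z) (i%:Z - j%:Z); last by rewrite (hc_neq g ne); apply: JB0.
rewrite e hc_id //; apply: JB_gen bj.
have : j%:Z = i%:Z + (n + l).+1%:Z.
  by rewrite -[X in _ = _ + X]opprK e opprB addrC subrK.
by rewrite -PoszD => -[->]; rewrite addnS ltnS addnCA leq_addr.
Qed.

Lemma weight_proj_graded al : wt (weight_proj al) /\ forall be m, gw be m ->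
  m = 0 \/ exists2 i, be = al + zk i & exists2 a : A, a \in G i & m = pq al a.
Proof.
apply: (@gw_graded (weight_proj al) al (fun i m => exists2 a : A, a \in G i & m = pq al a)).
- by move=> i; exists 0; [apply: gr0|rewrite linear0].
- by move=> i _ _ [a ai ->] [b bi ->]; exists (a + b); [apply: grD|rewrite linearD].
- by move=> i _ [a ai ->]; rewrite pqE; apply/gw_scale/pgen_gw.
move=> m; have [a ->] := pq_span m; move: a; apply: (gr_ind (T := T)) => [|x y|i x xi].
- by rewrite scale0r; apply: fin_sum0.
- by rewrite scalerDl; apply: fin_sumD.
by apply: fin_sum1; exists i; exists x => //; rewrite pqE.
Qed.

Lemma weight_proj_O al : O (weight_proj al).
Proof.
have [wP gP] := weight_proj_graded al; apply: mkO => // [m|be].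
  have [a ->] := pq_span m; move: a; apply: (gr_ind (T := T)) => [|x y|i x xi].
  - by exists 0%N => j b _ _; rewrite scale0r scaler0.
  - move=> [n nP] [n' nP']; exists (maxn n n') => j b; rewrite gtn_max => /andP[j1 j2] bj.
    by rewrite scalerDl scalerDr (nP j) ?(nP' j) ?addr0.
  exists (`|i| + (lowb al))%N => j b ij bj; rewrite scalerA -pqE; apply: pq0.
  have g : b * x \in G (- j%:Z + i) by apply: grM (Bd_G bj) xi erefl.
  have [l e] : exists l : nat, - j%:Z + i = - (lowb al + l).+1%:Z.
    have := ij; rewrite -subn_gt0; case: i {xi g} ij => i /= ij _.
      exists (j - i - (lowb al).+1)%N; rewrite -addSn subnKC; last by rewrite ltn_subRL.
      rewrite -subzn; first by rewrite opprB addrC.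
      exact: leq_trans (leq_addr _ _) (ltnW ij).
    exists (j + i - lowb al)%N; rewrite subnKC; last first.
      by apply: leq_trans (leq_addl i.+1 _) (leq_trans (ltnW ij) (leq_addr _ _)).
    by rewrite NegzE -opprD -PoszD addnS.
  by apply: (@low_JB _ l); rewrite -e.
have [[i ei]|no] := EM (exists i, be = al + zk i); last first.
  by exists [::] => m /gP[->|[i ei _]]; [rewrite rpred0|case: no; exists i].
have [W [[s sW] WG Wa]] := slice_B k_char0 T (lowb al) i.
have ql : linear (pq al : A -> kmod (weight_proj al)).
  move=> a x y; rewrite kscaleE !pqE scalerDl; congr (_ + _).
  by rewrite [RHS]scalerA mulr_algl.
apply: spanned_sub (spanned_linear (mklin ql) (ex_intro _ s sW)) => m /gP[->|[i' ei' [a ai ->]]].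
  have [w Ww Jw] := Wa 0 (gr0 T i); exists w => //; rewrite sub0r in Jw.
  rewrite -[mklin ql w]/(pq al w) -[w]opprK linearN (pq0 Jw) oppr0 //.
have {}ei' : i' = i by apply: (zk_inj k_char0); apply: (addrI al); rewrite -ei' -ei.
rewrite ei' in ai; have [w Ww Jw] := Wa a ai; exists w => //.
by apply/esym/eqP; rewrite -[mklin ql w]/(pq al w) -subr_eq0 -linearB (pq0 Jw).
Qed.

Lemma weight_proj_hom al M (m : M) : O M -> gw al m ->
  exists f : {linear weight_proj al -> M}, forall a : A, f (pq al a) = a *: m.
Proof.
move=> OM gm; have fl : linear ((fun a : A => a *: m) : A^o -> M).
  by move=> a x y; rewrite scalerDl scalerA.
have [|f fE] := @factor_surj _ _ _ _ (pq al) (mklin fl) (@qpi_surj _ _ _).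
  move=> x /qpi_eq0/in_mksub[u [y [Ju ->]]] /=.
  by rewrite scalerDl -scalerA (dN_kill OM gm) scaler0 (JB_kill OM Ju gm) addr0.
by exists f.
Qed.

(** The functor represented by this object is exact, because maps between
    weight modules commute with the weight projections. *)
Lemma weight_proj_projective al : projective_in O (weight_proj al).
Proof.
split=> [|M N p f OM ON ps]; first exact: weight_proj_O.
have [m0 m0E] := ps (f (pgen al)).
have gm : gw al (wproj al m0) by apply/wproj_gw/O_wt.
have [g gE] := weight_proj_hom OM gm; exists g => x; have [a ->] := pq_span x.
rewrite !linearZ; congr (_ *: _); have := gE 1; rewrite scale1r -/(pgen al) => ->.
rewrite (wproj_lin _ _ _ (O_wt OM) (O_wt ON)) m0E wproj_id //; first exact: O_wt.
exact/gw_lin/pgen_gw.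
Qed.
End Projectives.

(** * Injective objects corepresenting the duals of the weight spaces *)

Section Coinduced.
Variables (k : fieldType) (A : algType k).

Definition coind_pred : {pred A -> k^o} := [pred f : A -> k^o | `[< linear f >]].
Lemma coind_zmod : zmod_closed coind_pred.
Proof.
split.
  apply/asboolP => a x y; change ((0 : k^o) = a *: 0 + 0).
  by rewrite scaler0 addr0.
move=> f g /asboolP fl /asboolP gl; apply/asboolP => a x y.
change (f (a *: x + y) - g (a *: x + y) = a *: (f x - g x) + (f y - g y)).
by rewrite fl gl scalerBr opprD addrACA.
Qed.
HB.instance Definition _ := GRing.isZmodClosed.Build (A -> k^o) coind_pred coind_zmod.

(** The linear functionals on [A], with [A] acting through right
    multiplication. *)
Record coind := Coind { coind_val :> A -> k^o; _ : coind_val \in coind_pred }.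
HB.instance Definition _ := [isSub for coind_val].
HB.instance Definition _ := [Choice of coind by <:].
HB.instance Definition _ := [SubChoice_isSubZmodule of coind by <:].

Lemma coind_lin (f : coind) : linear (f : A -> k^o).
Proof. by case: f => f /= /asboolP. Qed.
Lemma coind_scale_subproof (a : A) (f : coind) : (fun x => f (x * a)) \in coind_pred.
Proof. by apply/asboolP => b x y; rewrite mulrDl -scalerAl coind_lin. Qed.
Definition coind_scale a f : coind := Coind (coind_scale_subproof a f).
Fact coind_scaleA a b f : coind_scale a (coind_scale b f) = coind_scale (a * b) f.
Proof. by apply/val_inj/funext => x /=; rewrite mulrA. Qed.
Fact coind_scale1 : left_id 1 coind_scale.
Proof. by move=> f; apply/val_inj/funext => x /=; rewrite mulr1. Qed.
Fact coind_scaleDr : right_distributive coind_scale +%R.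
Proof. by move=> a f g; apply/val_inj/funext => x. Qed.
Fact coind_scaleDl f : {morph coind_scale^~ f : a b / a + b}.
Proof.
move=> a b; apply/val_inj/funext => x /=; rewrite mulrDr.
by have := coind_lin f 1 (x * a) (x * b); rewrite !scale1r.
Qed.
HB.instance Definition _ := GRing.Zmodule_isLmodule.Build A coind
  coind_scaleA coind_scale1 coind_scaleDr coind_scaleDl.

Lemma coindE a (f : coind) x : (a *: f) x = f (x * a). Proof. by []. Qed.
Lemma coindD (f g : coind) x : (f + g) x = f x + g x. Proof. by []. Qed.
Lemma coind_0 x : (0 : coind) x = 0. Proof. by []. Qed.
Lemma coind_ev0 (f : coind) : f 0 = 0.
Proof.
have := coind_lin f (-1) 0 0; rewrite scaler0 addr0 scaleN1r addNr.
by [].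
Qed.
Lemma coind_evD (f : coind) x y : f (x + y) = f x + f y.
Proof. by have := coind_lin f 1 x y; rewrite !scale1r. Qed.
Lemma coind_evZ (f : coind) (a : k) x : f (a *: x) = a * f x.
Proof. by have := coind_lin f a x 0; rewrite coind_ev0 !addr0. Qed.
Lemma coindP (f g : coind) : (forall x, f x = g x) -> f = g.
Proof. by move=> fg; apply/val_inj/funext. Qed.
End Coinduced.

Section LinearForm.
Variable k : fieldType.

Lemma exists_form (V : lmodType k) (Q : V -> Prop) (v : V) : subm Q -> spanned Q -> Q v -> v <> 0 ->
  exists l : V -> k, l v = 1 /\ forall a x y, Q x -> Q y -> l (a *: x + y) = a * l x + l y.
Proof.
move=> Qs Qsp Qv v0.
have Ps : subm (fun x => exists a : k, x = a *: v).
  split=> [|a _ _ [b ->] [c ->]]; first by exists 0; rewrite scale0r.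
  by exists (a * b + c); rewrite scalerDl scalerA.
have [|p [pP pid pl]] := fd_proj Ps Qs Qsp.
  by move=> _ [a ->]; have := Qs.2 a v 0 Qv Qs.1; rewrite addr0.
have /choice[l lE] : forall x, exists a : k, Q x -> p x = a *: v.
  move=> x; have [Qx|] := EM (Q x); last by exists 0.
  by have [a pa] := pP x Qx; exists a.
have vI a b : a *: v = b *: v -> a = b.
  move=> /eqP; rewrite -subr_eq0 -scalerBl scaler_eq0 => /orP[|/eqP //].
  by rewrite subr_eq0 => /eqP.
exists l; split=> [|a x y Qx Qy].
  by apply: vI; rewrite -lE // pid ?scale1r //; exists 1; rewrite scale1r.
apply: vI; rewrite -lE; last exact: Qs.2.
by rewrite pl // !lE // scalerA -scalerDl.
Qed.
End LinearForm.

Section Injectives.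
Variables (k0 : closedFieldType) (k : fieldType) (sigma : {rmorphism k0 -> k}).
Hypothesis k_char0 : [pchar k] =i pred0.
Variables (A : algType k) (H0 : falgType k0) (T : triangular_algebra sigma A H0).
Local Notation G := (gr T).
Local Notation hc := (hc T).
Hint Resolve Cd_C Bd_B Cd_G Bd_G : core.
Local Notation JC := (JC T).
Local Notation gw := (gen_weight T).
Local Notation wt := (wt T).
Local Notation wproj := (wproj T).
Local Notation zk := (@zk k).
Local Notation O := (category_O T).
Implicit Types M N : lmodType A.
Variables (I : Type) (Irr : I -> lmodType (sub_alg (Hs T))).
Hypothesis HIrr : simple_representatives (fun _ => True) Irr.
Local Notation lowb := (lowb k_char0 HIrr).
Local Notation dN := (dN k_char0 HIrr).
Local Notation weight_proj := (weight_proj k_char0 HIrr).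
Variable al : k.
Local Notation J := (coind A).

(** Functionals of degree [i] that vanish on the right ideal generated by the
    [Bbar_m] for large [m] and by a power of [del - al]: the dual of
    [weight_proj]. *)
Record cohom (i : int) (f : J) : Prop := Cohom {
  co_deg : forall j x, x \in G j -> i + j != 0 -> f x = 0;
  co_JC : forall x, JC (lowb al) x -> f x = 0;
  co_dN : forall x, f (dN al * x) = 0 }.

Lemma cohom0 i : cohom i 0. Proof. by []. Qed.
Lemma cohomD i f g : cohom i f -> cohom i g -> cohom i (f + g).
Proof.
case=> f1 f2 f3 [g1 g2 g3]; split=> [j x xj ij|x Jx|x]; rewrite coindD.
- by rewrite (f1 j) ?(g1 j) ?addr0.
- by rewrite f2 ?g2 ?addr0.
by rewrite f3 ?g3 ?addr0.
Qed.
Lemma cohom_scale i j a f : cohom i f -> a \in G j -> cohom (i + j) (a *: f).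
Proof.
case=> f1 f2 f3 aj; split=> [l x xl ne|x Jx|x]; rewrite coindE.
- by rewrite (f1 (l + j)) //; [apply: (grM xl aj)|rewrite [l + j]addrC addrA].
- by rewrite f2 //; apply: JC_mulr.
by rewrite -mulrA f3.
Qed.

Lemma weight_inj_subproof : subm (fin_sum (fun f : J => exists i, cohom i f)).
Proof.
split=> [|a x y xP yP]; first exact: fin_sum0.
apply: fin_sumD => //; move: x xP; apply: fin_sum_map => [|x z|f [i fi]]; rewrite ?scaler0 ?scalerDr //.
move: a; apply: (gr_ind (T := T)) => [|a b|j a aj]; rewrite ?scale0r ?scalerDl; [exact: fin_sum0|exact: fin_sumD|].
by apply: fin_sum1; exists (i + j); apply: cohom_scale.
Qed.
Definition weight_injN : submodClosed J := mksub weight_inj_subproof.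
Definition weight_inj : lmodType A := sub_mod weight_injN.
Definition weight_inj_val : {linear weight_inj -> J} := incl weight_injN.
Lemma weight_inj_val_inj : injective weight_inj_val. Proof. exact: incl_inj. Qed.

Lemma cohom_gw i f : cohom i f -> gw (al + zk i) f.
Proof.
move=> fi; apply/gwP; exists (nilN k_char0 HIrr al); apply: coindP => x.
rewrite coindE coind_0; move: x; apply: (gr_ind (T := T)) => [|x y|j x xj].
- by rewrite mul0r coind_ev0.
- by rewrite mulrDl coind_evD => -> ->; rewrite addr0.
have [e|ne] := eqVneq (i + j) 0; last first.
  by apply: (co_deg fi (grM xj (pd_gr0 T _) erefl)); rewrite addr0.
rewrite -(pd_shift _ xj) (_ : shiftp _ _ = ('X - al%:P) ^+ nilN k_char0 HIrr al); first exact: (co_dN fi).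
have -> : j = - i by apply/eqP; rewrite -addr_eq0 addrC; apply/eqP.
rewrite /shiftp rmorphXn /= rmorphB /= comp_polyX comp_polyC !zkE mulrNz polyCN opprK polyCD.
by rewrite opprD addrACA subrr addr0.
Qed.

Lemma weight_inj_graded : wt weight_inj /\ forall be (m : weight_inj), gw be m ->
  m = 0 \/ exists2 i, be = al + zk i & cohom i (weight_inj_val m).
Proof.
apply: (gw_graded k_char0 (M := weight_inj) (al := al) (X := fun i m => cohom i (weight_inj_val m))) => [i|i x y xi yi|i x xi|m].
- by rewrite linear0.
- by rewrite linearD; apply: cohomD.
- by apply: (gw_inj weight_inj_val_inj); apply: cohom_gw.
have /in_mksub[s [sP e]] := incl_in m.
elim: s m sP e => [|f s IH] m sP e.
  rewrite (_ : m = 0); first exact: fin_sum0.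
  by apply: weight_inj_val_inj; rewrite linear0 -[LHS]/(incl weight_injN m) e big_nil.
have [i fi] := sP f (mem_head _ _).
have fN : f \in weight_injN by apply/in_mksub/fin_sum1; exists i.
have [f' f'E] := in_incl fN.
rewrite -[m](subrK f'); apply: fin_sumD.
  apply: IH => [g gs|]; first by apply: sP; rewrite inE gs orbT.
  by rewrite linearB /= -[sub_mod_val m]/(incl weight_injN m) -[sub_mod_val f']/(incl weight_injN f') e f'E big_cons addrAC subrr add0r.
by apply: fin_sum1; exists i; rewrite -[weight_inj_val f']/(incl weight_injN f') f'E.
Qed.

Lemma high_JC n l a : a \in G (n + l).+1%:Z -> JC n a.
Proof.
move=> ga; rewrite -(hc_id ga) {ga}; move: a; apply: (tri_ind (T := T)) => [|x y|i j x h b xi hH bj].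
- by rewrite linear0; apply: JC0.
- by rewrite linearD; apply: fin_sumD.
have g := tri_gr xi hH bj.
have [e|ne] := eqVneq ((n + l).+1%:Z) (i%:Z - j%:Z); last by rewrite (hc_neq g ne); apply: JC0.
rewrite e hc_id // -mulrA; apply: JC_gen xi.
have : i%:Z = (n + l).+1%:Z + j%:Z by rewrite e subrK.
by rewrite -PoszD => -[->]; rewrite addSn ltnS -addnA leq_addr.
Qed.

Lemma weight_inj_O : O weight_inj.
Proof.
have [wI gI] := weight_inj_graded; apply: mkO => // [m|be].
  move: m; apply: (wt_ind wI) => [|x y [n nP] [n' nP']|be m /gI[->|[i _ mi]]].
  - by exists 0%N => j b _ _; rewrite scaler0.
  - exists (maxn n n') => j b; rewrite gtn_max => /andP[j1 j2] bj.
    by rewrite scalerDr (nP j) ?(nP' j) ?addr0.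
  - by exists 0%N => j b _ _; rewrite scaler0.
  exists (`|i| + lowb al)%N => j b ij bj; apply: weight_inj_val_inj; rewrite linear0 linearZ.
  have ci := cohom_scale mi (Bd_G bj); apply: coindP => x; rewrite coind_0.
  move: x; apply: (gr_ind (T := T)) => [|x y|l x xl].
  - exact: coind_ev0.
  - by rewrite coind_evD => -> ->; rewrite addr0.
  have [e|ne] := eqVneq (i - j%:Z + l) 0; last exact: (co_deg ci xl ne).
  have [l' le] : exists l' : nat, l = (lowb al + l').+1%:Z.
    have le : l = j%:Z - i by apply/eqP; rewrite -subr_eq0 opprB addrC e.
    rewrite le; case: i {mi ci e le} ij => i /= ij.
      exists (j - i - (lowb al).+1)%N; rewrite -addSn subnKC; last by rewrite ltn_subRL.
      rewrite -subzn //; exact: leq_trans (leq_addr _ _) (ltnW ij).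
    exists (j + i - lowb al)%N; rewrite subnKC; last first.
      by apply: leq_trans (leq_addl i.+1 _) (leq_trans (ltnW ij) (leq_addr _ _)).
    by rewrite NegzE opprK -PoszD addnS.
  by apply: (co_JC ci); apply: (@high_JC _ l'); rewrite -le.
have [[i ei]|no] := EM (exists i, be = al + zk i); last first.
  by exists [::] => m /gI[->|[i ei _]]; [rewrite rpred0|case: no; exists i].
have [W [[s sW] WG Wa]] := slice_C k_char0 T (lowb al) (- i).
have ksp : spanned (fun _ : k^o => True).
  by exists [:: (1 : k^o)] => x _; rewrite -[x]mulr1; apply: (rpredZ (x : k)); apply/genm_gen/mem_head.
apply: (@spanned_values _ (kmod weight_inj) k^o _ (fun _ => True) (size s)
    (fun l f => (weight_inj_val f : J) (hc (- i) s`_l)) (@gw_subm _ _ _ _ _ T weight_inj be) ksp) => //.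
  move=> l a f g; rewrite kscaleE linearD linearZ coindD coindE mulr_algr coind_evZ.
  by [].
move=> f /gI[//|[i' ei' fi]] f0.
have {}ei' : i' = i by apply: (zk_inj k_char0); apply: (addrI al); rewrite -ei' -ei.
rewrite {i'}ei' in fi; apply: weight_inj_val_inj; rewrite linear0; apply: coindP => x; rewrite coind_0.
move: x; apply: (gr_ind (T := T)) => [|x y|j x xj].
- exact: coind_ev0.
- by rewrite coind_evD => -> ->; rewrite addr0.
have [e|ne] := eqVneq (i + j) 0; last exact: (co_deg fi xj ne).
have ej : j = - i by apply/eqP; rewrite -addr_eq0 addrC; apply/eqP.
rewrite ej in xj; have [w Ww Jw] := Wa x xj.
rewrite -[x](subrK w) coind_evD (co_JC fi Jw) add0r.
have Ps : subm (fun a : A => (weight_inj_val f : J) (hc (- i) a) = 0).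
  split=> [|a u v uP vP]; first by rewrite linear0 coind_ev0.
  by rewrite linearP coind_evD coind_evZ uP vP mulr0 addr0.
have /in_mksub : w \in mksub Ps.
  apply: (lspan_in _ (sW w Ww)) => u us; apply/in_mksub.
  have ui : (index u s < size s)%N by rewrite index_mem.
  by have := f0 (Ordinal ui); rewrite /= nth_index.
by rewrite hc_id //; apply: WG.
Qed.

Lemma weight_inj_ev1 be (m : weight_inj) : gw be m -> be != al -> (weight_inj_val m : J) 1 = 0.
Proof.
have [_ gI] := weight_inj_graded; move=> /gI[->|[i ei mi]] ne.
  by rewrite linear0 coind_0.
apply: (co_deg mi (one_gr T)); rewrite addr0; apply: contra ne => /eqP i0.
by rewrite ei i0 !zkE addr0.
Qed.

(** Morphisms to [weight_inj] are linear forms on the weight space [al]. *)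
Lemma weight_inj_hom M (l : M -> k) : O M ->
    (forall (a : k) x y, l (a%:A *: x + y) = a * l x + l y) ->
    (forall be m, gw be m -> be != al -> l m = 0) ->
  exists g : {linear M -> weight_inj}, forall m, (weight_inj_val (g m) : J) 1 = l m.
Proof.
move=> OM ll lW; have wM := O_wt OM.
have lD x y : l (x + y) = l x + l y by have := ll 1 x y; rewrite !scale1r mul1r.
have l0 : l 0 = 0 by apply: (addrI (l 0)); rewrite -lD !addr0.
have lN x : l (- x) = - l x by apply: (addrI (l x)); rewrite -lD !subrr l0.
have lwp m : l m = l (wproj al m).
  have [s [us e]] := wproj_sum wM (m - wproj al m).
  suff : l (m - wproj al m) = 0 by rewrite lD lN => /eqP; rewrite subr_eq0 => /eqP.
  have z : wproj al (m - wproj al m) = 0.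
    have [g c] := wprojP wM al m.
    by apply: wproj_uniq; [apply: wM|apply: gw0|rewrite subr0].
  rewrite e; elim: (s) => [|be t IH]; first by rewrite big_nil l0.
  rewrite big_cons lD IH addr0; have [->|ne] := eqVneq be al; first by rewrite z l0.
  by apply: lW ne; apply: wproj_gw.
have Fl m : (fun a => l (a *: m) : k^o) \in @coind_pred _ A.
  by apply/asboolP => a x y; rewrite scalerDl -mulr_algl -scalerA ll.
pose F m : J := Coind (Fl m).
have FE m a : F m a = l (a *: m) by [].
have F1 m : (forall z, JC (lowb al) z -> F m z = 0) /\ (forall x, F m (dN al * x) = 0).
  split=> [z [s [sP ->]]|x]; rewrite FE.
    rewrite scaler_suml big_seq; elim/big_ind: _ => // [x y|_ /sP[x [b [j [lj xj ->]]]]].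
      by rewrite lD => -> ->; rewrite addr0.
    rewrite lwp -scalerA.
    have := wproj_scale wM (al - zk j%:Z) (b *: m) (Cd_G xj); rewrite subrK => ->.
    by rewrite (lowbP OM lj (wproj_gw wM _ _)) scaler0.
  rewrite lwp -scalerA (wproj_scale0 wM al _ (pd_gr0 T _)).
  by rewrite (dN_kill k_char0 HIrr OM) //; apply: wproj_gw.
have FN m : F m \in weight_injN.
  apply/in_mksub; move: m (wM m); apply: (fin_sum_map (f := F)) => [|x y|m [be mbe]].
  - by apply: coindP => a; rewrite FE scaler0 l0.
  - by apply: coindP => a; rewrite coindD !FE scalerDr lD.
  have [j1 j2] := F1 m.
  apply: fin_sum1; have [[i ei]|no] := EM (exists i, be = al + zk i).
    exists i; split=> // j x xj ij; rewrite FE; apply: (lW _ _ (gw_scale xj mbe)); rewrite ei -addrA.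
    apply: contra ij => /eqP; rewrite -{2}[al]addr0 => /addrI.
    by rewrite !zkE -rmorphD => /(@zk_inj k k_char0 _ 0) ->.
  exists 0; split=> // j x xj _; rewrite FE; apply: (lW _ _ (gw_scale xj mbe)).
  by apply/eqP => e; apply: no; exists (- j); rewrite -e !zkE mulrNz addrK.
have gl : linear F.
  by move=> a x y; apply: coindP => b; rewrite coindD coindE !FE scalerDr lD scalerA.
have [g gE] := corestrict (f := mklin gl) FN.
by exists g => m; rewrite -[weight_inj_val (g m)]/(incl weight_injN (g m)) gE -[LHS]/(l (1 *: m)) scale1r.
Qed.

Lemma weight_inj_hom_uniq M (f g : {linear M -> weight_inj}) :
  (forall m, (weight_inj_val (f m) : J) 1 = (weight_inj_val (g m) : J) 1) -> f =1 g.
Proof.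
move=> fg m; apply: weight_inj_val_inj; apply: coindP => a.
by rewrite -[a]mul1r -!coindE -!linearZ fg.
Qed.

(** Linear forms on the weight space [al] of a submodule extend. *)
Lemma weight_inj_injective : injective_in O weight_inj.
Proof.
split=> [|M N u f OM ON ui]; first exact: weight_inj_O.
pose P (n : kmod N) := exists2 m : M, gw al m & u m = n.
have Ps : subm P.
  split=> [|a _ _ [x gx <-] [y gy <-]]; first by exists 0; [apply: gw0|rewrite linear0].
  exists (a%:A *: x + y); last by rewrite linearP.
  by apply/gwD/gy/gw_scale0/gx/kG.
have [|p [pP pid pl]] := fd_proj Ps (@gw_subm _ _ _ _ _ T N al) (O_fd al ON).
  by move=> _ [m gm <-]; apply: gw_lin.
have wN := O_wt ON.
have /choice[v vE] : forall n : N, exists m : M, u m = p (wproj al n).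
  by move=> n; have [m _ mE] := pP _ (wproj_gw wN al n); exists m.
pose l n := (weight_inj_val (f (v n)) : J) 1.
have ll a x y : l (a%:A *: x + y) = a * l x + l y.
  rewrite /l.
  have -> : v (a%:A *: x + y) = a%:A *: v x + v y.
    apply: ui; rewrite linearP !vE wprojD // (wproj_scale0 wN _ _ (kG T a)).
    by rewrite -[_ *: wproj al x]/(a *: (wproj al x : kmod N)) pl //; apply: wproj_gw.
  by rewrite linearP linearP coindD coindE mul1r coind_evZ.
have lW be n : gw be n -> be != al -> l n = 0.
  move=> gn ne; rewrite /l (_ : v n = 0) ?linear0 ?coind_0 // .
  apply: ui; rewrite vE (wproj_neq wN gn ne) linear0 pid //.
  exact: Ps.1.
have [g gE] := weight_inj_hom ON ll lW; exists g.
apply: (weight_inj_hom_uniq (f := g \o u)) => m; rewrite [LHS](gE (u m)) /l.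
have -> : v (u m) = wproj al m.
  apply: ui; rewrite vE -(wproj_lin u al m (O_wt OM) wN) pid //.
  by exists (wproj al m) => //; apply/wproj_gw/O_wt.
have fb be x : gw be x -> be != al -> (weight_inj_val (f x) : J) 1 = 0.
  by move=> gx ne; apply: (weight_inj_ev1 (be := be)) => //; apply: gw_lin.
have wM := O_wt OM.
have [s [us e]] := wproj_sum wM (m - wproj al m).
apply/eqP; rewrite eq_sym -subr_eq0; apply/eqP.
have -> : (weight_inj_val (f m) : J) 1 - (weight_inj_val (f (wproj al m)) : J) 1 = (weight_inj_val (f (m - wproj al m)) : J) 1.
  by rewrite !linearB.
have z : wproj al (m - wproj al m) = 0.
  have [g' c] := wprojP wM al m.
  by apply: wproj_uniq; [apply: wM|apply: gw0|rewrite subr0].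
rewrite e; elim: (s) => [|be t IH]; first by rewrite big_nil !linear0 coind_0.
rewrite big_cons !linearD coindD IH addr0; have [->|ne] := eqVneq be al.
  by rewrite z !linear0 coind_0.
by apply: fb ne; apply: wproj_gw.
Qed.

(** Extend a linear form on the weight space [al] that does not vanish on
    [m]. *)
Lemma weight_inj_nonzero M (m : M) : O M -> gw al m -> m <> 0 ->
  exists f : {linear M -> weight_inj}, f m <> 0.
Proof.
move=> OM gm m0.
have [l [lm ll]] := exists_form (@gw_subm _ _ _ _ _ T M al) (O_fd al OM) gm m0.
have wM := O_wt OM; pose l' x := l (wproj al x).
have [||f fE] := @weight_inj_hom M l' OM.
- move=> a x y; rewrite /l' wprojD // (wproj_scale0 wM _ _ (kG T a)).
  by rewrite -[_ *: wproj al x]/(a *: (wproj al x : kmod M)) ll //; apply: wproj_gw.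
- move=> be x gx ne; rewrite /l' (wproj_neq wM gx ne).
  have := ll 0 m m gm gm; rewrite scale0r mul0r !add0r => _.
  have := ll (-1) m m gm gm; rewrite scaleN1r addNr mulN1r addNr.
  by [].
exists f => fm0; have := fE m; rewrite fm0 linear0 coind_0 /l' wproj_id // lm.
by move/esym/eqP; rewrite oner_eq0.
Qed.
End Injectives.

(** * Simple objects *)

Section Simples.
Variables (k0 : closedFieldType) (k : fieldType) (sigma : {rmorphism k0 -> k}).
Hypothesis k_char0 : [pchar k] =i pred0.
Variables (A : algType k) (H0 : falgType k0) (T : triangular_algebra sigma A H0).
Local Notation B := (Bm T).
Local Notation C := (Bbar T).
Local Notation HH := (sub_alg (Hs T)).
Hint Resolve Cd_C Bd_B Cd_G Bd_G : core.
Local Notation gw := (gen_weight T).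
Local Notation wproj := (wproj T).
Local Notation zk := (@zk k).
Local Notation hmod M := (hmod_of (Hs T) M).
Local Notation O := (category_O T).
Local Notation killed := (@killed _ _ _ _ _ T _).
Implicit Types M N : lmodType A.
Variables (I : Type) (Irr : I -> lmodType (sub_alg (Hs T))).
Hypothesis HIrr : simple_representatives (fun _ => True) Irr.
Local Notation cI := (cI Irr).
Local Notation st i := (@standard _ _ _ _ _ T (Irr i)).
Local Notation co i := (@costandard _ _ _ _ _ T (Irr i)).
Local Notation lt := (irr_lt Irr).
Let cE i := cIE k_char0 HIrr (i := i).
Let Esp i := irr_spanned k_char0 HIrr i.
Let Es i := IrrS HIrr i.

Lemma st_O i : O (st i). Proof. exact: (std_O k_char0 (cE (i := i)) (Esp i)). Qed.
Lemma co_O i : O (co i). Proof. exact: (nab_O k_char0 (cE (i := i)) (Esp i)). Qed.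

Definition Lm i : lmodType A := smod (Irr i).
Lemma Lm_O i : O (Lm i). Proof. exact: O_inj (@smodi_inj _ _ _ _ _ T (Irr i)) (co_O i). Qed.
Lemma Lm_simple i : simple_mod (Lm i).
Proof. exact: (smod_simple k_char0 (cE (i := i)) (Es i)). Qed.

Definition Lp i : {linear st i -> Lm i} := projT1 (cid (smod_proj (Irr i))).
Lemma Lp_surj i : surj (Lp i). Proof. by case: (projT2 (cid (smod_proj (Irr i)))). Qed.
Lemma LpE i x : smodi (Irr i) (Lp i x) = std_to_costd (Irr i) x.
Proof. by case: (projT2 (cid (smod_proj (Irr i)))). Qed.

Lemma gw_st i (e : Irr i) : gw (- cI i) (iot e).
Proof. exact: (iot_gw (cE (i := i))). Qed.

Lemma Lp_iot0 i (e : Irr i) : Lp i (iot e) = 0 -> e = 0.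
Proof.
move=> e0; rewrite -(kap1 e) -std_to_costd_iot -LpE e0 linear0.
exact: (fn0 (ev1_bhfun k_char0 (cE (i := i)))).
Qed.

Lemma irr_neq0 i : exists e : Irr i, e <> 0.
Proof. by have [[e /eqP e0] _] := Es i; exists e. Qed.

Lemma ev1_std_to_costd i (x : st i) : ev1 (std_to_costd (Irr i) x) = ev0 x.
Proof.
have fb := ev1_bhfun k_char0 (cE (i := i)).
have [s [sP ->]] := std_span x; rewrite big_seq.
elim/big_ind: _ => [|u v|_ /sP[a [e ->]]]; first by rewrite linear0 (fn0 fb) ev00.
  by rewrite linearD (fnD fb) ev0D => -> ->.
by rewrite linearZ_LR std_to_costd_iot -nab_ev kapE ev0E.
Qed.

(** The standard object is local: proper submodules miss its lowest weight. *)
Lemma st_local i (N : submodClosed (st i)) x : x \notin N -> forall y, y \in N -> Lp i y = 0.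
Proof.
move=> xN y yN; apply: contrapT => ty0.
have [a ta] : exists a, std_to_costd (Irr i) y a <> 0.
  apply: contrapT => no; apply: ty0; apply: (@smodi_inj _ _ _ _ _ T (Irr i)).
  rewrite LpE linear0; apply: nabP0 => a; apply: contrapT => ta.
  by apply: no; exists a.
have fb := ev0_bhfun (cE (i := i)).
have wS := O_wt (st_O i).
pose z := wproj (- cI i) (a *: y).
have zN : z \in N by apply: (wproj_in wS); apply: rpredZ.
have z0 : ev0 z <> 0 by rewrite /z -(fn_wproj _ wS fb) -ev1_std_to_costd linearZ_LR -nab_ev.
have [e ze] := std_gw_lowest k_char0 (cE (i := i)) (wproj_gw wS (- cI i) (a *: y)).
have Ks : subm (fun e : Irr i => iot e \in N).
  split=> [|h u v uN vN]; first by rewrite -[iot 0]/(iotl (Irr i) 0) linear0; apply: rpred0.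
  rewrite -[iot _]/(iotl (Irr i) _) linearP; apply: rpredD => //.
  by apply: (rpredZ (h : A)).
have eN : e \in mksub Ks by apply/in_mksub; rewrite -ze.
have e0 : e <> 0 by move=> e0; apply: z0; rewrite /z ze ev0_iot.
case/negP: xN; have [s [sP ->]] := std_span x.
rewrite big_seq; apply: rpred_sum => _ /sP[b [e' ->]]; apply: rpredZ.
by have /in_mksub := simple_sub_all (Es i) eN e0 e'.
Qed.

Lemma st_head i : unique_simple_quotient (st i) (Lm i).
Proof.
split; first exact: Lm_simple.
exists (Lp i); first exact: Lp_surj.
move=> S' g S's gs x.
have [[y0 y00] _] := S's; have [x0 x0E] := gs y0.
have kg y : g y = 0 -> Lp i y = 0.
  move=> gy; apply: (@st_local i (kerm g) x0); last exact/in_mksub.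
  by apply/negP => /in_mksub gx0; case/eqP: y00; rewrite -x0E.
split; first exact: kg.
move=> px; apply: contrapT => gx.
have [e e0] := irr_neq0 i; apply: e0; apply: Lp_iot0.
have sK : surj (g \o incl (kerm (Lp i))).
  have /in_incl[x' x'E] : x \in kerm (Lp i) by apply/in_mksub.
  apply: (simple_surj S's (x := x')); rewrite -[X in X <> _]/(g (incl _ x')) x'E.
  exact: gx.
have [z zE] := sK (g (iot e)).
have kz : Lp i (incl (kerm (Lp i)) z) = 0 by have /in_mksub := incl_in z.
rewrite -[iot e](subrK (incl (kerm (Lp i)) z)) linearD kz addr0; apply: kg.
rewrite linearB -[X in _ - X]/((g \o incl (kerm (Lp i))) z) zE subrr.
by [].
Qed.

Lemma co_socle i : unique_simple_submodule (co i) (Lm i).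
Proof. exact: (nab_unique_simple k_char0 (cE (i := i)) (Es i)). Qed.

(** The generating space of [L(i)] is the space of its vectors killed by
    [B^{>0}]. *)
Lemma Lm_inj i j : mod_iso (Lm i) (Lm j) -> i = j.
Proof.
case=> f fb; have [_ Iinj _] := HIrr; apply: Iinj.
have fbj := ev1_bhfun k_char0 (cE (i := j)).
pose x e := smodi (Irr j) (f (Lp i (iot e))).
have kx e : killed (x e) by do 3!apply: killed_lin; apply: iot_killed.
pose phi e := ev1 (x e).
have pl : linear phi.
  move=> h u v; rewrite /phi /x iotD iotH !linearD !linearZ (fnD fbj) (fnH fbj).
  by [].
have p0 e : phi e = 0 -> e = 0.
  move=> pe; apply: Lp_iot0; apply: (inj_linear0 (bij_inj fb)).
  apply: (inj_linear0 (@smodi_inj _ _ _ _ _ T (Irr j))).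
  rewrite -/(x e) (nab_killed (kx e)) -/(phi e) pe -[kap 0]/(kapl (Irr j) 0).
  exact: linear0.
have [e e0] := irr_neq0 i.
exists (mklin pl); apply: inj_surj_bij; first exact: linear_inj.
by apply: (simple_surj (Es j) (x := e)) => /p0.
Qed.

(** A vector killed by [B^{>0}] in a simple object identifies it. *)
Lemma simple_lowest X i (phi : {linear Irr i -> hmod X}) : simple_mod X -> injective phi ->
  (forall e, killed (phi e : X)) -> mod_iso X (Lm i).
Proof.
move=> Xs pi kp; have [g gE] := std_hom kp; have [e e0] := irr_neq0 i.
have gs : surj g.
  apply: (simple_surj Xs (x := iot e)); rewrite gE => /(inj_linear0 pi).
  exact: e0.
have [_ [f fs fu]] := st_head i.
have kfg x : g x = 0 <-> f x = 0 := fu X g Xs gs x.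
have [h hE] := factor_surj gs (fun x => (kfg x).1).
exists h; apply: inj_surj_bij.
  by apply: linear_inj => y; have [x <-] := gs y; rewrite hE => /kfg.
by move=> y; have [x <-] := fs y; exists (g x).
Qed.

Lemma Lm_reps : simple_representatives O Lm.
Proof.
split=> [i|i j|X OX Xs]; [by split; [apply: Lm_O|apply: Lm_simple]|exact: Lm_inj|].
have [[x /eqP x0] _] := Xs.
have [|i [phi [pi _ kp]]] := lowest_irr HIrr (N := fullm X) (v := x) (O_nil OX) _ x0.
  exact/in_mksub.
by exists i; apply: simple_lowest kp.
Qed.

Lemma factor_weight M (N1 N2 : submodClosed M) b : O M -> subquotient N1 N2 (Lm b) ->
  exists x, [/\ x \in N2, x <> 0 & gw (- cI b) x].
Proof.
move=> OM [_ [f [fs fk]]]; have [e e0] := irr_neq0 b.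
have [y0 y0E] := fs (Lp b (iot e)).
have O2 := O_sub N2 OM; pose y := wproj (- cI b) y0.
have fy : f y = Lp b (iot e).
  rewrite /y (wproj_lin _ _ _ (O_wt O2) (O_wt (Lm_O b))) y0E wproj_id //.
    exact/O_wt/Lm_O.
  exact/gw_lin/gw_st.
exists (incl N2 y); split; first exact: incl_in.
  move=> /(inj_linear0 (@incl_inj _ _ N2)) y00; apply: e0; apply: Lp_iot0.
  by rewrite -fy y00 linear0.
exact/gw_lin/wproj_gw/O_wt.
Qed.

Lemma lt_weight a b (n : nat) : - cI b = - cI a + zk n.+1%:Z -> lt b a.
Proof.
move=> e; exists n; rewrite -[c_ (Irr a)]/(cI a) -[c_ (Irr b)]/(cI b).
by rewrite e addrA subrr add0r.
Qed.

Lemma co_weight a be (x : co a) : gw be x -> x <> 0 -> exists n : nat, be = - cI a + zk n%:Z.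
Proof.
by move=> /(nab_gw k_char0 (cE (i := a)))[//|[n [-> _]] _]; exists n.
Qed.

(** The weights of [nabla(a)] are of the form [- c_a + n], and the weight
    space for [n = 0] lies in the socle. *)
Lemma co_factors a : exists2 u : {linear Lm a -> co a}, injective u &
  forall b, composition_factor (quot_mod (image_mod u)) (Lm b) -> lt b a.
Proof.
exists (smodi (Irr a)); first exact: smodi_inj.
move=> b [_ [N1 [N2 sq]]]; set u := smodi (Irr a) in N1 N2 sq *.
have OQ := O_quot (image_mod u) (co_O a).
have [y [yN y0 gy]] := factor_weight OQ sq.
have [z0 z0E] := @qpi_surj _ _ (image_mod u) y; pose z := wproj (- cI b) z0.
have zE : qpi (image_mod u) z = y.
  by rewrite (wproj_lin _ _ _ (O_wt (co_O a)) (O_wt OQ)) z0E wproj_id //; apply: O_wt.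
have gz : gw (- cI b) z by apply/wproj_gw/O_wt/co_O.
have [|[|n] e] := co_weight gz; first by move=> z00; apply: y0; rewrite -zE z00 linear0.
  case: y0; rewrite -zE; apply/qpi_eq0/in_image_mod.
  rewrite e !zkE addr0 in gz.
  exists (Lp a (iot (ev1 z))); rewrite /u LpE std_to_costd_iot.
  by rewrite -(nab_gw_lowest k_char0 (cE (i := a)) gz).
exact: lt_weight e.
Qed.

Lemma co_mult a b : finite_multiplicity (co a) (Lm b).
Proof. exact: artin_multiplicity (O_artin k_char0 HIrr (co_O a)) (Lm_simple b). Qed.

(** A morphism is determined by a functional on the weight space [- c_b],
    which is finite-dimensional. *)
Lemma co_hom M b : O M -> finite_dim_hom M (co b).
Proof.
move=> OM; have wM := O_wt OM; have fbb := ev1_bhfun k_char0 (cE (i := b)).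
have fnk (c : k) (x : co b) : ev1 (c%:A *: x) = (c%:A : HH) *: ev1 x := fnH fbb c%:A x.
pose P (f : M -> kmod (Irr b)) := exists g : {linear M -> co b}, forall m, f m = ev1 (g m).
have Ps : subm P.
  split=> [|a f f' [g gE] [g' g'E]].
    have zl : linear (fun _ : M => 0 : co b) by move=> a x y; rewrite scaler0 addr0.
    by exists (mklin zl) => m; rewrite -[LHS]/(0 : Irr b) (fn0 fbb).
  have hl : linear (fun m => a%:A *: g m + g' m).
    move=> c x y; rewrite !linearP scalerDr scalerDr !scalerA kmulC addrACA.
    by rewrite -!scalerA.
  exists (mklin hl) => m; rewrite -[LHS]/(a%:A *: (f m : Irr b) + f' m) gE g'E.
  by rewrite (fnD fbb) fnk.
have [s sP] := O_fd (- cI b) OM.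
have [n [w [wP wE]]] : fd P.
  apply: (fd_sub Ps (Q := P)) => //.
  apply: (@spanned_values _ _ (kmod (Irr b)) P (fun _ => True) (size s) (fun l f => f s`_l) Ps (Esp b)) => //.
  move=> f [g gE] f0; apply/funext => m; rewrite gE -[RHS]/(0 : Irr b).
  rewrite [LHS](fn_wproj m wM (bhfun_comp (eqmap_lin T C g) fbb)) /=.
  have Ks : subm (fun m : kmod M => ev1 (g m) = 0).
    split=> [|a x y x0 y0]; first by rewrite linear0 (fn0 fbb).
    by rewrite kscaleE linearP (fnD fbb) y0 addr0 fnk x0 scaler0.
  apply: (in_mksub Ks (wproj (- cI b) m)).1.
  apply: (lspan_in _ (sP _ (wproj_gw wM _ m))) => x xs; apply/(in_mksub Ks).
  have xi : (index x s < size s)%N by rewrite index_mem.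
  by have := f0 (Ordinal xi); rewrite /= nth_index // gE.
have /choice[g gE] := wP.
exists n, g => f; have [|a aE] := wE (fun m => ev1 (f m)); first by exists f.
exists a => m; apply: nabP => x; rewrite nab_ev -linearZ.
have := congr1 (fun h => h (x *: m)) aE; rewrite /= => ->.
have sumE (h : 'I_n -> co b) (h' : 'I_n -> (M -> kmod (Irr b))) y :
    (forall i, (h' i y : Irr b) = ev1 (x *: h i)) ->
    (\sum_i a i *: h' i) y = ev1 (x *: (\sum_i (a i)%:A *: h i)).
  move=> hh; elim: (index_enum _) => [|i t IH].
    by rewrite !big_nil scaler0 (fn0 fbb).
  rewrite !big_cons -[LHS]/((a i)%:A *: (h' i y : Irr b) + (\sum_(j <- t) a j *: h' j) y) IH hh.
  rewrite scalerDr (fnD fbb); congr (_ + _).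
  by rewrite scalerA kmulC -scalerA fnk.
rewrite (sumE (fun i => g i m)) // => [|i]; first by rewrite [in RHS]nab_ev.
by rewrite gE linearZ.
Qed.
End Simples.

(** * Relative freeness of the projective objects *)

Section ProjectiveCovers.
Variables (k0 : closedFieldType) (k : fieldType) (sigma : {rmorphism k0 -> k}).
Hypothesis k_char0 : [pchar k] =i pred0.
Variables (A : algType k) (H0 : falgType k0) (T : triangular_algebra sigma A H0).
Local Notation G := (gr T).
Local Notation B := (Bm T).
Local Notation C := (Bbar T).
Local Notation H := (Hs T).
Local Notation HH := (sub_alg (Hs T)).
Hint Resolve Cd_C Bd_B Cd_G Bd_G : core.
Local Notation JB := (JB T).
Local Notation pd := (pd T).
Local Notation gw := (gen_weight T).
Local Notation wt := (wt T).
Local Notation wproj := (wproj T).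
Local Notation zk := (@zk k).
Local Notation bhmap := (eqmap T (Bbar T)).
Implicit Types M N : lmodType A.
Variables (I : Type) (Irr : I -> lmodType (sub_alg (Hs T))).
Hypothesis HIrr : simple_representatives (fun _ => True) Irr.
Local Notation cI := (cI Irr).
Local Notation lowb := (lowb k_char0 HIrr).
Local Notation weight_proj := (weight_proj k_char0 HIrr).
Local Notation pq := (pq k_char0 HIrr).
Local Notation st i := (@standard _ _ _ _ _ T (Irr i)).
Let cE i := cIE k_char0 HIrr (i := i).

(** Freeness over [Bbar], relative to [H] and the weights: functionals lift to
    the standard objects.  Unlike an explicit basis, this passes at once to
    direct summands. *)
Definition relfree M := forall i (phi : M -> Irr i), bhfun (- cI i) phi ->
  exists psi : M -> st i, bhmap psi /\ forall m, ev0 (psi m) = phi m.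

Lemma relfree_retract M N (u : {linear M -> N}) (r : {linear N -> M}) :
  (forall m, r (u m) = m) -> relfree N -> relfree M.
Proof.
move=> ru gN i phi fb.
have [psi [pb pE]] := gN i _ (bhfun_comp (eqmap_lin T C r) fb).
exists (psi \o u); split; first exact: eqmap_comp (eqmap_lin T C u) pb.
by move=> m /=; rewrite pE /= ru.
Qed.

Lemma bh_factor M N (Z : lmodType A) (p : {linear M -> N}) (f : M -> Z) :
    wt M -> wt N -> surj p -> bhmap f -> (forall x, p x = 0 -> f x = 0) ->
  exists g : N -> Z, bhmap g /\ forall x, g (p x) = f x.
Proof.
move=> wM wN ps fb kf; have [s sK] := choice ps.
have fp x y : p x = p y -> f x = f y.
  move=> e; apply/eqP; rewrite -subr_eq0 -(eqmapN _ fb) -(eqmD fb); apply/eqP/kf.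
  by rewrite linearB e subrr.
exists (f \o s); split=> [|x] /=; last by apply: fp; rewrite sK.
split=> [x y|x m xC|h m hH|al m mal] /=.
- by rewrite -(eqmD fb); apply: fp; rewrite linearD !sK.
- by rewrite -(eqmS fb) //; apply: fp; rewrite linearZ /= !sK.
- by rewrite -(eqmH fb) //; apply: fp; rewrite linearZ /= !sK.
rewrite (fp _ (wproj al (s m))); first exact/(eqmW fb)/wproj_gw.
by rewrite (wproj_lin _ _ _ wM wN) !sK wproj_id.
Qed.

Section RelfreeWeightProj.
Variables (al : k) (i : I) (phi : weight_proj al -> Irr i).
Hypothesis fb : bhfun (- cI i) phi.

Lemma fn_k (c : k) m : phi (c%:A *: m) = (c%:A : HH) *: phi m.
Proof. exact: (fnH fb (c%:A : HH) m). Qed.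

(** On [A = Bbar H B] the lift of [phi] sends [x h b] to [x h (1 (x) phi(b))].
    It need not vanish on the relation [(del - al)^N]; this is repaired in
    [weight_proj_relfree]. *)
Lemma pre_ex : exists f : {linear A -> kmod (st i)}, forall x h b, x \in C -> h \in H -> b \in B ->
  f (x * h * b) = (x * h) *: iot (phi (pq al b)).
Proof.
apply: (@tri_map _ _ _ _ _ T (kmod (st i)) (fun x h b => (x * h) *: iot (phi (pq al b)))).
- move=> h b c u v.
  have -> : (c *: u + v) * h = c%:A * (u * h) + v * h.
    by rewrite mulrDl -scalerAl mulr_algl.
  rewrite -[RHS]/(c%:A *: ((u * h) *: iot (phi (pq al b)) : st i) + (v * h) *: iot (phi (pq al b))).
  by rewrite [LHS]scalerDl; congr (_ + _); rewrite [RHS]scalerA.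
- move=> x b c u v.
  have -> : x * (c *: u + v) = c%:A * (x * u) + x * v.
    by rewrite mulrDr mulr_algl scalerAr.
  rewrite -[RHS]/(c%:A *: ((x * u) *: iot (phi (pq al b)) : st i) + (x * v) *: iot (phi (pq al b))).
  by rewrite [LHS]scalerDl; congr (_ + _); rewrite [RHS]scalerA.
move=> x y c u v.
rewrite -[RHS]/(c%:A *: ((x * y) *: iot (phi (pq al u)) : st i) + (x * y) *: iot (phi (pq al v))).
have -> : pq al (c *: u + v) = c%:A *: pq al u + pq al v.
  by rewrite !pqE scalerDl scalerA mulr_algl.
have -> : phi (c%:A *: pq al u + pq al v) = (c%:A : HH) *: phi (pq al u) + phi (pq al v).
  by rewrite (fnD fb) fn_k.
rewrite iotD iotH.
have fin z (X Y : st i) : z *: (c%:A *: X + Y) = c%:A *: (z *: X) + z *: Y.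
  by rewrite scalerDr !scalerA kmulC.
exact: fin.
Qed.
Definition pre := projT1 (cid pre_ex).
Lemma preE x h b : x \in C -> h \in H -> b \in B ->
  pre (x * h * b) = (x * h) *: iot (phi (pq al b)).
Proof. exact: (projT2 (cid pre_ex)). Qed.

Lemma pre_C x a : x \in C -> pre (x * a) = x *: (pre a : st i).
Proof.
move=> xC; move: a; apply: (tri_ind (T := T)) => [|a b|j m y h b /Cd_C yC hH /Bd_B bB].
- by rewrite mulr0 linear0; apply/esym/(scaler0 (st i)).
- by rewrite mulrDr !linearD => -> ->; apply/esym/(scalerDr (x : A) (pre a : st i)).
rewrite !mulrA !preE ?rpredM //; first by rewrite scalerA mulrA.
Qed.

Lemma pre_H h a : h \in H -> pre (h * a) = h *: (pre a : st i).
Proof.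
move=> hH; move: a; apply: (tri_ind (T := T)) => [|a b|j m y g b /Cd_C yC gH /Bd_B bB].
- by rewrite mulr0 linear0; apply/esym/(scaler0 (st i)).
- by rewrite mulrDr !linearD => -> ->; apply/esym/(scalerDr (h : A) (pre a : st i)).
rewrite (preE yC gH bB) !mulrA [RHS]scalerA mulrA; have [s [sP ->]] := HC_CH hH yC.
rewrite !mulr_suml linear_sum scaler_suml; rewrite !big_seq.
apply: eq_bigr => _ /sP[x [l [xC lH ->]]].
by rewrite -[x * l * g]mulrA preE ?rpredM // mulrA.
Qed.

Lemma pre_JB a : JB (lowb al) a -> pre a = 0.
Proof.
move=> [s [sP ->]]; rewrite linear_sum big_seq big1 // => _ /sP[y [b [m [lm bm ->]]]].
move: y; apply: (tri_ind (T := T)) => [|u v|j l x h c /Cd_C xC hH /Bd_B cB].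
- by rewrite mul0r linear0.
- by rewrite mulrDl linearD => -> ->; rewrite addr0.
rewrite -mulrA preE ?rpredM //; last by case: bm.
by rewrite (pq0 (JB_gen c lm bm)) (fn0 fb) -[iot 0]/(iotl (Irr i) 0) linear0 scaler0.
Qed.

Lemma pre_ev0 a : ev0 (pre a) = phi (pq al a).
Proof.
have eb := ev0_bhfun (cE (i := i)).
move: a; apply: (tri_ind (T := T)) => [|u v|j l x h b xj hH /Bd_B bB].
- by rewrite !linear0 (fn0 fb); apply: ev00.
- by rewrite !linearD (fnD fb) ev0D => -> ->.
rewrite preE //; last exact: Cd_C xj.
have -> : pq al (x * h * b) = x *: (h *: pq al b) by rewrite !pqE !scalerA ?mulrA.
rewrite -[(x * h) *: _]scalerA; case: j xj => [|j] xj; last by rewrite (fnC eb _ xj) (fnC fb _ xj).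
have [c ->] := Cd0_scalar xj; rewrite fn_k (fnH eb (c%:A : HH)).
by rewrite (fnH eb (SubAlg hH)) (fnH fb (SubAlg hH)) ev0_iot.
Qed.

Lemma pre_gw j a : a \in G j -> gw (al + zk j) (pre a : st i).
Proof.
move=> aj; rewrite -(hc_id aj); move: a {aj}; apply: (tri_ind (T := T)) => [|u v|l m x h b xl hH bm].
- by rewrite !linear0; apply: (gw0 T (st i)).
- by rewrite !linearD; apply: gwD.
have g := tri_gr xl hH bm.
have [e|ne] := eqVneq j (l%:Z - m%:Z); last first.
  by rewrite (hc_neq g ne) linear0; apply: (gw0 T (st i)).
rewrite e hc_id // preE //; [|exact: Cd_C xl|exact: Bd_B bm].
have gb : gw (al + zk (- m%:Z)) (pq al b) by rewrite pqE; apply: gw_scale (Bd_G bm) (pgen_gw _ _ _).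
have [ei|ne] := eqVneq (al + zk (- m%:Z)) (- cI i); last first.
  by rewrite (fnW fb gb ne) -[iot 0]/(iotl (Irr i) 0) linear0 scaler0; apply: gw0.
have -> : al + zk (l%:Z - m%:Z) = - cI i + zk l%:Z.
  by rewrite -ei !zkE -addrA -intrD [(- _ + _)%R]addrC.
apply: gw_scale; last exact: gw_st.
by apply: (grM (Cd_G xl) (Hgr hH)); rewrite addr0.
Qed.
End RelfreeWeightProj.

(** Right multiplication by a polynomial in [del] that is 1 modulo [(X -
    al)^N], and divisible by the cofactor of [(X - al)^N], makes the lift
    vanish on the relations and does not change the values of [phi]. *)
Lemma weight_proj_relfree al : relfree (weight_proj al).
Proof.
move=> i phi fb.
set N := nilN k_char0 HIrr al; set R := nilR k_char0 HIrr al.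
have : coprimep (('X - al%:P) ^+ N) R.
  by rewrite coprimep_expl // coprimep_sym coprimep_XsubC; apply: nilR_neq0.
move=> /Bezout_eq1_coprimepP[[u v] /= uv]; 
(* [e] is 1 modulo [(X - al)^N] and divisible by [R] *)
pose e := v * R.
pose ps (a : A) : st i := pre fb (a * pd e).
have psD x y : ps (x + y) = ps x + ps y by rewrite /ps mulrDl linearD.
have JBe a : JB (lowb al) a -> JB (lowb al) (a * pd e).
  move=> [s [sP ->]]; rewrite mulr_suml big_seq.
  elim/big_ind: _ => [|x y|_ /sP[y [b [m [lm bm ->]]]]]; [exact: JB0|exact: JBD|].
  by rewrite -mulrA -(pd_shift _ (Bd_G bm)) mulrA; apply: JB_gen bm.
have ps0 a : pq al a = 0 -> ps a = 0.
  move=> /qpi_eq0/in_mksub[w [y [Jw ->]]]; rewrite psD.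
  rewrite {1}/ps pre_JB ?add0r; last exact: JBe.
  rewrite /ps pre_JB // -mulrA -pdM mulrC /e -mulrA pdM mulrA; apply: JB_mull.
  exact: nilRN.
have psE x y : pq al x = pq al y -> ps x = ps y.
  move=> xy; apply/eqP; rewrite -subr_eq0.
  have -> : ps x - ps y = ps (x - y).
    rewrite psD; congr (_ + _); apply: (addrI (ps y)); rewrite -psD !subrr.
    by rewrite ps0 ?linear0.
  by apply/eqP/ps0; rewrite linearB xy subrr.
have [s sK] := choice (@qpi_surj _ _ (weight_proj_rel k_char0 HIrr al)).
have pqs x : pq al (s x) = x := sK x.
have [wP gP] := weight_proj_graded k_char0 HIrr al.
exists (ps \o s); split.
  split=> [x y|x m xC|h m hH|be m mbe] /=.
  - by rewrite -psD; apply: psE; rewrite linearD !pqs.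
  - rewrite -[RHS]pre_C // mulrA; apply: psE.
    by rewrite [LHS]pqs [RHS]pqE -scalerA -[s m *: _]pqE pqs.
  - rewrite -[RHS]pre_H // mulrA; apply: psE.
    by rewrite [LHS]pqs [RHS]pqE -scalerA -[s m *: _]pqE pqs.
  have [->|[j ej [a aj mE]]] := gP _ _ mbe.
    rewrite (psE _ 0) ?pqs ?linear0 //; rewrite ps0 ?linear0 //; exact: gw0.
  rewrite (psE _ a) ?pqs // ej; apply: pre_gw.
  by apply: (grM aj (pd_gr0 T e)); rewrite addr0.
move=> m /=; rewrite /ps pre_ev0; congr phi; rewrite -{2}(pqs m).
apply/eqP; rewrite -subr_eq0 -linearB; apply/eqP/qpi_eq0/in_mksub.
exists 0, (- (s m * pd u)); split; first exact: JB0.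
rewrite add0r mulNr -mulrA -pdM.
have -> : u * ('X - al%:P) ^+ N = 1 - e by rewrite -uv /e addrK.
have -> : pd (1 - e) = 1 - pd e by apply/eqP; rewrite eq_sym subr_eq -pdD subrK pd1.
by rewrite mulrBr mulr1 opprB.
Qed.
End ProjectiveCovers.

(** * Standard filtrations and projective covers *)

Section StandardFiltrations.
Variables (k0 : closedFieldType) (k : fieldType) (sigma : {rmorphism k0 -> k}).
Hypothesis k_char0 : [pchar k] =i pred0.
Variables (A : algType k) (H0 : falgType k0) (T : triangular_algebra sigma A H0).
Local Notation C := (Bbar T).
Local Notation H := (Hs T).
Local Notation HH := (sub_alg (Hs T)).
Hint Resolve Cd_C Bd_B Cd_G Bd_G : core.
Local Notation gw := (gen_weight T).
Local Notation wproj := (wproj T).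
Local Notation zk := (@zk k).
Local Notation hmod M := (hmod_of (Hs T) M).
Local Notation O := (category_O T).
Local Notation killed := (@killed _ _ _ _ _ T _).
Local Notation bhmap := (eqmap T (Bbar T)).
Implicit Types M N : lmodType A.
Variables (I : Type) (Irr : I -> lmodType (sub_alg (Hs T))).
Hypothesis HIrr : simple_representatives (fun _ => True) Irr.
Local Notation cI := (cI Irr).
Local Notation lowb := (lowb k_char0 HIrr).
Local Notation weight_proj := (weight_proj k_char0 HIrr).
Local Notation pq := (pq k_char0 HIrr).
Local Notation st i := (@standard _ _ _ _ _ T (Irr i)).
Local Notation lt := (irr_lt Irr).
Local Notation Lm := (Lm Irr).
Local Notation Lp i := (Lp Irr i).
Let cE i := cIE k_char0 HIrr (i := i).
Let Es i := IrrS HIrr i.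

Lemma bhmap_id M : bhmap (idfun : M -> M).
Proof. by split. Qed.

Lemma ev1_Lp i (x : st i) : ev1 (smodi (Irr i) (Lp i x)) = ev0 x.
Proof. by rewrite LpE (ev1_std_to_costd k_char0 HIrr). Qed.

Lemma Lp_fun i : bhfun (- cI i) (fun x : Lm i => ev1 (smodi (Irr i) x)).
Proof.
exact: bhfun_comp (eqmap_lin T C (smodi (Irr i))) (ev1_bhfun k_char0 (cE (i := i))).
Qed.

Lemma head_uniq a b (g : {linear st b -> Lm a}) : surj g -> a = b.
Proof.
move=> gs; have [_ [f fs fu]] := st_head k_char0 HIrr b.
have kfg x : g x = 0 <-> f x = 0 := fu _ g (Lm_simple k_char0 HIrr a) gs x.
have [h hE] := factor_surj gs (fun x => (kfg x).1).
apply: (Lm_inj k_char0 HIrr); exists h; apply: inj_surj_bij.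
  by apply: linear_inj => y; have [x <-] := gs y; rewrite hE => /kfg.
by move=> y; have [x <-] := fs y; exists (g x).
Qed.

(** A map out of a standard object which is split on its generating space
    splits as a map of [Bbar H]-modules. *)
Lemma relfree_split M i (th : {linear st i -> M}) (phi : M -> Irr i) :
    relfree Irr M -> bhfun (- cI i) phi -> (forall e, phi (th (iot e)) = e) ->
  exists psi : M -> st i, bhmap psi /\ forall x, psi (th x) = x.
Proof.
move=> gM fb pth; have [psi [pb pE]] := gM i _ fb; exists psi; split=> //.
have cb := eqmap_comp (eqmap_lin T C th) pb.
apply: (bh_uniq cb (bhmap_id _)) => e /=.
have [e' e'E] := std_gw_lowest k_char0 (cE (i := i)) (eqmW cb (gw_st k_char0 HIrr e)).
rewrite /= in e'E; have := pE (th (iot e)).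
by rewrite e'E ev0_iot pth => ->.
Qed.

(** Subtracting from a lift its values on the image of [th] makes it vanish
    there. *)
Lemma relfree_coker M N i (th : {linear st i -> M}) (psi : M -> st i) (p : {linear M -> N}) :
    relfree Irr M -> O M -> O N -> bhmap psi -> (forall x, psi (th x) = x) -> surj p ->
    (forall x, p x = 0 <-> exists y, th y = x) ->
  relfree Irr N.
Proof.
move=> gM OM ON pb pth ps pk j phi fb.
have [ps1 [p1b p1E]] := gM j _ (bhfun_comp (eqmap_lin T C p) fb).
have cb : bhmap (fun x => x - th (psi x)).
  have tb := eqmap_comp pb (eqmap_lin T C th).
  split=> [x y|x m xC|h m hH|al m mal].
  - by rewrite (eqmD pb) linearD opprD addrACA.
  - by rewrite (eqmS pb) // linearZ scalerBr.
  - by rewrite (eqmH pb) // linearZ scalerBr.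
  by apply: gwD => //; apply: gwN; apply: (eqmW tb).
have [|g [gb gE]] := bh_factor (O_wt OM) (O_wt ON) ps (eqmap_comp cb p1b).
  by move=> x /pk[y <-] /=; rewrite pth subrr (eqmap0 p1b).
exists g; split=> // y; have [x <-] := ps y; rewrite gE /= p1E /= linearB.
by have -> : p (th (psi x)) = 0; [apply/pk; exists (psi x)|rewrite subr0].
Qed.

(** All proper submodules lie in the kernel of [p]; a surjective [p] is then
    an essential epimorphism. *)
Definition local_map M N (p : {linear M -> N}) :=
  forall (P : submodClosed M) x, x \notin P -> forall y, y \in P -> p y = 0.

Lemma local_quot M N (X : lmodType A) (p : {linear M -> X}) (f : {linear M -> N}) (g : {linear N -> X}) :
  surj f -> (forall x, g (f x) = p x) -> local_map p -> local_map g.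
Proof.
move=> fs gf pl P x xP y yP; have [x' x'E] := fs x; have [y' y'E] := fs y.
rewrite -y'E gf; apply: (pl (prem f P) x').
  by apply/negP => /in_mksub; rewrite x'E; apply/negP.
by apply/in_mksub; rewrite y'E.
Qed.

(** Among the weights that differ from [al] by integers; the weight [al]
    itself need not occur. *)
Definition lowest M (al : k) := forall (j : nat) (x : M), gw (al - zk j.+1%:Z) x -> x = 0.

Lemma lowest_weight M al (v : M) : O M -> gw al v -> v <> 0 ->
  exists n (w : M), [/\ gw (al - zk n%:Z) w, w <> 0 & lowest M (al - zk n%:Z)].
Proof.
move=> OM gv v0; pose occurs n := exists2 w : M, gw (al - zk n%:Z) w & w <> 0.
have ex : exists n, `[< occurs n >].
  by exists 0%N; apply/asboolP; exists v; rewrite ?subr0.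
have bd n : `[< occurs n >] -> (n <= lowb al)%N.
  move=> /asboolP[w gw_w w0]; rewrite leqNgt; apply/negP => ln.
  exact: w0 (lowbP OM ln gw_w).
case: (ex_maxnP ex bd) => n /asboolP[w gw_w w0] nmax.
exists n, w; split=> // j x gx; apply: contrapT => x0.
have /nmax : `[< occurs (n + j.+1)%N >].
  by apply/asboolP; exists x => //; rewrite zkE PoszD intrD opprD addrA.
by rewrite -[X in (_ <= X)%N]addn0 leq_add2l.
Qed.

Lemma lowest_killed M al (v : M) : lowest M al -> gw al v -> killed v.
Proof.
move=> lM gv j b bj; apply: (lM j).
have -> : al - zk j.+1%:Z = al + zk (- j.+1%:Z) by rewrite !zkE mulrNz.
exact: gw_scale (Bd_G bj) gv.
Qed.

(** The lowest weight space is a semisimple [H]-module, and its functionals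
    extend by zero. *)
Lemma lowest_functional M b (phi : {linear Irr b -> hmod M}) : O M -> lowest M (- cI b) ->
    injective phi -> (forall e, gw (- cI b) (phi e : M)) ->
  exists f : M -> Irr b, bhfun (- cI b) f /\ forall e, f (phi e) = e.
Proof.
move=> OM lM pi pg.
have Ws : subm (fun x : hmod M => gw (- cI b) (x : M)).
  split=> [|h x y gx gy]; first exact: gw0.
  by apply: gwD => //; apply/gw_scale0 => //; apply/Hgr/valP.
have PW : {subset image_mod phi <= mksub Ws}.
  by move=> x /in_image_mod[e <-]; apply/(in_mksub Ws).
have Wsp : spanned (fun x : kmod (hmod M) => x \in mksub Ws).
  have [s sP] := O_fd (- cI b) OM; exists s => x /(in_mksub Ws)/sP; exact.
have [r [rP rid rl]] := maschke (HH_casimir k_char0 T) Wsp PW.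
have inW x : (wproj (- cI b) x : hmod M) \in mksub Ws.
  exact/(in_mksub Ws)/wproj_gw/O_wt.
have /choice[f fE] x : exists e, phi e = r (wproj (- cI b) x).
  exact/in_image_mod/rP/inW.
have fb : bhfun (- cI b) f.
  have wM := O_wt OM; have r0 : r 0 = 0.
    by have /in_image_mod z := rpred0 (image_mod phi); rewrite rid // rpred0.
  have rD x y : x \in mksub Ws -> y \in mksub Ws -> r (x + y) = r x + r y.
    by move=> xW yW; have := rl 1 x y xW yW; rewrite !scale1r.
  have rH h x : x \in mksub Ws -> r (h *: x) = h *: r x.
    by move=> xW; have := rl h x 0 xW (rpred0 _); rewrite r0 !addr0.
  split=> [x y|h x|j x m xj|al m mal ne]; apply: pi.
  - by rewrite linearD !fE wprojD // [LHS]rD.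
  - rewrite linearZ_LR !fE wproj_scale0; [|exact: wM|exact/Hgr/valP].
    by rewrite [LHS](rH h).
  - rewrite fE linear0.
    have -> : - cI b = - cI b - zk j.+1%:Z + zk j.+1%:Z by rewrite subrK.
    rewrite wproj_scale; [|exact: wM|exact: Cd_G xj].
    suff -> : wproj (- cI b - zk j.+1%:Z) m = 0 by rewrite scaler0 r0.
    exact: (lM j) (wproj_gw wM _ _).
  by rewrite fE (wproj_neq wM mal ne) r0 linear0.
exists f; split=> // e; apply: pi; rewrite fE wproj_id; [|exact/O_wt|exact: pg].
by rewrite rid //; apply/in_image_mod; exists e.
Qed.

Section Peel.
Variables (M : lmodType A) (a : I) (p : {linear M -> Lm a}).
Hypotheses (OM : O M) (gM : relfree Irr M) (ps : surj p) (pl : local_map p).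

Lemma lowest_lift : exists e (t : {linear Irr a -> HH^o}) (w : M),
  [/\ e <> 0, forall x, (t x : HH) *: e = x, gw (- cI a) w & p w = Lp a (iot e)].
Proof.
have [e [t te]] := simple_section (HH_spanned T) (HH_casimir k_char0 T) (Es a).
have [w0 w0E] := ps (Lp a (iot e)).
exists e, t, (wproj (- cI a) w0); split=> //.
- by move=> e0; have [x x0] := irr_neq0 HIrr a; apply: x0; rewrite -(te x) e0 scaler0.
- exact/wproj_gw/O_wt.
rewrite (wproj_lin _ _ _ (O_wt OM) (O_wt (Lm_O k_char0 HIrr a))) w0E wproj_id //.
  exact/O_wt/(Lm_O k_char0 HIrr).
exact/gw_lin/(gw_st k_char0 HIrr).
Qed.

(** The lowest weight space contains a copy of [Irr a] that maps onto the
    generators of [L(a)]; it generates a quotient of [Delta(a)], which is all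
    of [M] by locality and is [Delta(a)] by relative freeness. *)
Lemma peel_top : lowest M (- cI a) -> mod_iso M (st a).
Proof.
move=> lM; have [e [t [w [e0 te gw_w pw]]]] := lowest_lift.
have el : linear (fun x : Irr a => (t x : A) *: w : hmod M).
  move=> h x y; rewrite linearP -[LHS]/(((h : A) * (t x : A) + (t y : A)) *: w).
  by rewrite scalerDl -scalerA.
have kl x : killed (mklin el x : M).
  by apply: (lowest_killed lM); apply: gw_scale0 (gw_w); apply/Hgr/valP.
have [th thE] := std_hom kl.
have pth x : p (th x) = Lp a x.
  apply: (@std_hom_uniq _ _ _ _ _ T (Irr a) _ (p \o th)) => x' /=.
  by rewrite thE -[mklin el x']/((t x' : A) *: w) linearZ pw -linearZ -iotH te.
have ths : surj th.
  move=> y; apply: contrapT => ny; apply: e0; apply: (Lp_iot0 k_char0 HIrr).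
  rewrite -pth; apply: (pl (P := image_mod th) (x := y)); last by apply/in_image_mod; exists (iot e).
  by apply/negP => /in_image_mod.
have [|psi [_ psiE]] := relfree_split (th := th) gM (bhfun_comp (eqmap_lin T C p) (Lp_fun a)).
  by move=> x; rewrite /= pth ev1_Lp ev0_iot.
apply: mod_iso_sym; exists th; apply: inj_surj_bij => //; exact: can_inj psiE.
Qed.

(** A simple [H]-module of lowest weight generates a standard submodule, which
    splits off over [Bbar H] by relative freeness. *)
Lemma peel_low n (v : M) : gw (- cI a - zk n.+1%:Z) v -> v <> 0 -> lowest M (- cI a - zk n.+1%:Z) ->
  exists b (th : {linear st b -> M}) psi, [/\ lt a b, bhmap psi & forall x, psi (th x) = x].
Proof.
move=> gv v0 lM; have kv := lowest_killed lM gv.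
have [b [phi [pi pk pg be]]] := killed_gw_irr k_char0 HIrr kv gv v0.
have [th thE] := std_hom pk; rewrite be in lM pg.
have [f [fb fE]] := lowest_functional OM lM pi pg.
have [e|psi [pb psiE]] := relfree_split (th := th) gM fb; first by rewrite thE fE.
exists b, th, psi; split=> //; apply: (@lt_weight _ _ _ _ _ T _ Irr b a n).
by rewrite -be subrK.
Qed.
End Peel.

(** Standard submodules are split off from quotients of [M] until the weight
    of the head is the lowest one; what remains is then [Delta(a)]. *)
Lemma standard_filtration M a (p : {linear M -> Lm a}) (N : submodClosed M) :
    O M -> surj p -> local_map p -> relfree Irr (quot_mod N) -> (exists x, x \notin N) ->
  exists n (F : nat -> submodClosed M), [/\ F 0%N = N, F n.+1 = fullm M,
    subquotient (F n) (F n.+1) (st a) &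
    forall i, (i < n)%N -> exists2 b, lt a b & subquotient (F i) (F i.+1) (st b)].
Proof.
move=> OM ps pl; have [m [mu [mum mulin]]] := O_artin k_char0 HIrr OM.
elim: (m - mu N).+1 {-2}N (ltnSn (m - mu N)) => // l IH {}N ml gN [x0 x0N].
have pN x : qpi N x = 0 -> p x = 0 by move=> /qpi_eq0; apply: pl x0N x.
have [g gE] := factor_surj (@qpi_surj _ _ N) pN.
have gs : surj g by move=> y; have [x <-] := ps y; exists (qpi N x).
have gl := local_quot (@qpi_surj _ _ N) gE pl.
have OQ := O_quot N OM.
have [w0 w00 gw0] : exists2 w0 : quot_mod N, w0 <> 0 & gw (- cI a) w0.
  have [e [t [w0 [e0 te gw0 pw]]]] := lowest_lift OQ gs; exists w0 => // w00.
  by apply: e0; apply: (Lp_iot0 k_char0 HIrr); rewrite -pw w00 linear0.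
have [[|n] [w [gw_w w_neq0 lQ]]] := lowest_weight OQ gw0 w00.
  rewrite zkE subr0 in lQ.
  have [f fb] := peel_top OQ gN gs gl lQ.
  exists 0%N, (fun i => if i is 0%N then N else fullm M); split=> //.
  apply: (@subquotient_full _ _ _ _ (f \o qpi N)).
    by move=> y; have [x <-] := bij_surj fb y; have [x' <-] := qpi_surj x; exists x'.
  move=> x; split=> [/qpi_eq0 /= ->|]; first exact: linear0.
  by move=> /(inj_linear0 (bij_inj fb))/qpi_eq0.
have [b [th [psi [ab pb psiE]]]] := peel_low OQ gN gw_w w_neq0 lQ.
pose N' := prem (qpi N) (image_mod th).
have sq : subquotient N N' (st b) := lift_subquotient (can_inj psiE).
have N'P x : x \in N' <-> exists y, th y = qpi N x.
  by split=> [/in_mksub/in_image_mod|/in_image_mod z]; last apply/in_mksub.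
have [x1 x1N'] : exists x, x \notin N'.
  apply: contrapT => no; apply: (@lt_irr _ _ _ k_char0 _ _ T _ Irr a).
  suff e : a = b by rewrite {2}e.
  apply: (@head_uniq a b (g \o th)) => y; have [x <-] := gs y.
  have [x' x'E] := qpi_surj x; have [z zE] : exists z, th z = qpi N x'.
    by apply/N'P; apply: contrapT => /negP x'N; apply: no; exists x'.
  by exists z; rewrite /= zE x'E.
have gN' : relfree Irr (quot_mod N').
  have [q qE] := factor_surj (f := qpi N') (@qpi_surj _ _ N) 
    (fun x h => (qpi_eq0 N' x).2 (sq.1 x ((qpi_eq0 N x).1 h))).
  apply: (relfree_coker gN OQ (O_quot N' OM) pb psiE (p := q)).
    by move=> y; have [x <-] := qpi_surj y; exists (qpi N x).
  by move=> x; have [x' <-] := qpi_surj x; rewrite qE qpi_eq0.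
have [|||n' [F [F0 F1 F2 F3]]] := IH N'.
- have lt_mu : (mu N < mu N')%N.
    apply: mulin sq.1 _; apply: (subquotient_strict sq).
    have [e e0] := irr_neq0 HIrr b; exists (iot e); apply/eqP => z; apply: e0.
    by rewrite -(ev0_iot e) z ev00.
  by rewrite ltnS in ml; apply: leq_trans ml; apply: ltn_sub2l => //; apply: leq_trans lt_mu (mum _).
- exact: gN'.
- by exists x1.
exists n'.+1, (fun i => if i is j.+1 then F j else N); split=> // -[_|i il].
  by exists b => //; rewrite F0.
by apply: F3.
Qed.

(** A minimal submodule of a projective object of [O] among those that map onto
    a simple quotient is a direct summand. *)
Lemma exists_cover a : exists (P : lmodType A) (p : {linear P -> Lm a}),
  [/\ projective_in O P, surj p, local_map p & relfree Irr P].
Proof.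
pose al := - cI a; have OP := weight_proj_O k_char0 HIrr al; have OL := Lm_O k_char0 HIrr a.
have Ls := Lm_simple k_char0 HIrr a.
have [e e0] := irr_neq0 HIrr a.
have [f fE] := weight_proj_hom k_char0 HIrr OL (gw_lin (Lp a) (gw_st k_char0 HIrr e)).
have f1 : f (pq al 1) <> 0.
  by rewrite fE scale1r => /(Lp_iot0 k_char0 HIrr).
pose Q (N : submodClosed (weight_proj al)) := exists2 x, x \in N & f x <> 0.
have [|P [x1 x1P fx1] Pmin] := artin_min (Q := Q) (N := fullm (weight_proj al)) (O_artin k_char0 HIrr OP).
  by exists (pq al 1) => //; apply/in_mksub.
have [y1 y1E] := in_incl x1P.
pose p := f \o incl P : {linear sub_mod P -> Lm a}.
have ps : surj p by apply: (simple_surj Ls (x := y1)); rewrite -[p y1]/(f (incl P y1)) y1E.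
have pl : local_map p.
  move=> N x xN y yN; apply: contrapT => py; case/negP: xN.
  have /(_ (incl P x)) : {subset P <= imm (incl P) N}.
    apply: Pmin.
      by exists (incl P y) => //; apply/in_mksub; exists y.
    by move=> _ /in_mksub[z zN <-]; apply: incl_in.
  move=> /(_ (incl_in x))/in_mksub[z zN /(@incl_inj _ _ P)] <-; exact: zN.
have OS := O_sub P OP.
have [g gE] := (weight_proj_projective k_char0 HIrr al).2 _ _ p f OS OL ps.
pose u := g \o incl P : {linear sub_mod P -> sub_mod P}.
have us : surj u.
  move=> y; apply: contrapT => ny.
  have nyu : y \notin image_mod u by apply/negP => /in_image_mod.
  have /(pl _ _ nyu) : u y1 \in image_mod u by apply/in_image_mod; exists y1.
  by rewrite -[u y1]/(g (incl P y1)) gE y1E.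
have [h [hK Kh]] := bij_inverse (artin_surj_inj (O_artin k_char0 HIrr OS) us) us.
pose r := h \o g : {linear weight_proj al -> sub_mod P}.
have rE x : r (incl P x) = x by rewrite -[LHS]/(h (u x)) hK.
exists (sub_mod P), p; split=> //.
  split=> // M N q v OM ON qs.
  have [w wE] := (weight_proj_projective k_char0 HIrr al).2 _ _ q (v \o r) OM ON qs.
  by exists (w \o incl P) => x; rewrite -[LHS]/(q (w (incl P x))) wE -[LHS]/(v (r (incl P x))) rE.
apply: (relfree_retract rE); exact: weight_proj_relfree.
Qed.

Theorem projective_cover_filtered a : exists2 X, projective_cover O (Lm a) X &
  exists n (F : nat -> submodClosed X),
    [/\ filtration n.+1 F, subquotient (F n) (F n.+1) (st a) &
        forall i, (i < n)%N -> exists2 b, lt a b & subquotient (F i) (F i.+1) (st b)].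
Proof.
have [P [p [Pp ps pl gP]]] := exists_cover a.
exists P.
  split=> //; exists p => // N g ON pgs y; apply: contrapT => ny.
  have nyg : y \notin image_mod g by apply/negP => /in_image_mod.
  have [e e0] := irr_neq0 HIrr a; apply: e0; apply: (Lp_iot0 k_char0 HIrr).
  have [x <-] := pgs (Lp a (iot e)).
  by apply: (pl _ _ nyg); apply/in_image_mod; exists x.
have OP := Pp.1.
have gQ : relfree Irr (quot_mod (zerom P)).
  have qi : injective (qpi (zerom P)) by apply: linear_inj => x /qpi_eq0/in_mksub.
  have [h [hK Kh]] := bij_inverse qi (@qpi_surj _ _ (zerom P)).
  exact: relfree_retract Kh gP.
have [|n [F [F0 F1 F2 F3]]] := standard_filtration OP ps pl gQ.
  have [e e0] := irr_neq0 HIrr a; have [x xE] := ps (Lp a (iot e)); exists x.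
  apply/negP => /in_mksub x0; apply: e0; apply: (Lp_iot0 k_char0 HIrr).
  by rewrite -xE x0 linear0.
exists n, F; split=> //; split=> [x|x|i].
- by rewrite F0 => /in_mksub.
- by rewrite F1; apply/in_mksub.
rewrite ltnS leq_eqVlt => /orP[/eqP->|/F3[b _ []//]].
by case: F2.
Qed.
End StandardFiltrations.

(** * Relative cofreeness of the injective objects *)

Section InjectiveHulls.
Variables (k0 : closedFieldType) (k : fieldType) (sigma : {rmorphism k0 -> k}).
Hypothesis k_char0 : [pchar k] =i pred0.
Variables (A : algType k) (H0 : falgType k0) (T : triangular_algebra sigma A H0).
Local Notation G := (gr T).
Local Notation B := (Bm T).
Local Notation C := (Bbar T).
Local Notation H := (Hs T).
Local Notation HH := (sub_alg (Hs T)).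
Local Notation Cd := (Cd T).
Local Notation Bd := (Bd T).
Hint Resolve Cd_C Bd_B Cd_G Bd_G : core.
Local Notation JC := (JC T).
Local Notation pd := (pd T).
Local Notation gw := (gen_weight T).
Local Notation zk := (@zk k).
Local Notation hmod M := (hmod_of (Hs T) M).
Local Notation killed := (@killed _ _ _ _ _ T _).
Local Notation bmap := (eqmap T (Bm T)).
Local Notation rhoH := (rhoH T).
Implicit Types M N : lmodType A.
Variables (I : Type) (Irr : I -> lmodType (sub_alg (Hs T))).
Hypothesis HIrr : simple_representatives (fun _ => True) Irr.
Local Notation cI := (cI Irr).
Local Notation lowb := (lowb k_char0 HIrr).
Local Notation dN := (dN k_char0 HIrr).
Local Notation co i := (@costandard _ _ _ _ _ T (Irr i)).
Local Notation weight_inj := (weight_inj k_char0 HIrr).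
Local Notation J := (coind A).
Let cE i := cIE k_char0 HIrr (i := i).

(** Cofreeness over [B], relative to [H] and the weights; dual to [relfree]. *)
Definition relcofree M := forall i (phi : {linear Irr i -> hmod M}), (forall e, killed (phi e : M)) ->
  exists psi : co i -> M, bmap psi /\ forall e, psi (kap e) = phi e.

Lemma relcofree_retract M N (u : {linear M -> N}) (r : {linear N -> M}) :
  (forall m, r (u m) = m) -> relcofree N -> relcofree M.
Proof.
move=> ru cN i phi kp.
have hl : linear (fun e => u (phi e) : hmod N) by move=> h x y; rewrite !linearP.
have [|psi [pb pE]] := cN i (mklin hl); first by move=> e; apply: killed_lin (kp e).
exists (r \o psi); split; first exact: eqmap_comp pb (eqmap_lin T B r).
by move=> e /=; rewrite pE; apply: ru.
Qed.

Section RelcofreeWeightInj.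
Variables (al : k) (i : I) (phi : {linear Irr i -> hmod (weight_inj al)}).
Hypothesis kphi : forall e, killed (phi e : weight_inj al).
Local Notation iv f x := ((weight_inj_val k_char0 HIrr al f : J) x).

Lemma iv_JC (f : weight_inj al) x : JC (lowb al) x -> iv f x = 0.
Proof.
move=> Jx; have /in_mksub[s [sP ->]] := incl_in f.
rewrite big_seq; elim/big_ind: _ => // [u v|g /sP[j gj]]; last exact: co_JC gj _ Jx.
by rewrite coindD => -> ->; rewrite addr0.
Qed.

(** Dually to [pre_ex], [F] is sent to the functional [x h b |-> phi(F(b))(x
    h)]. *)
Lemma copre_ex (F : co i) : exists f : {linear A -> k^o}, forall x h b, x \in C -> h \in H -> b \in B ->
  f (x * h * b) = iv (phi (F b)) (x * h).
Proof.
apply: (@tri_map _ _ _ _ _ T k^o (fun x h b => iv (phi (F b)) (x * h))).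
- by move=> h b c u v; rewrite mulrDl -scalerAl coind_lin.
- by move=> x b c u v; rewrite mulrDr -scalerAr coind_lin.
move=> x h c u v.
have -> : F (c *: u + v) = (c%:A : HH) *: F u + F v by rewrite nabD -mulr_algr nab_k.
rewrite linearP linearD coindD; congr (_ + _).
rewrite -[X in weight_inj_val _ _ _ X]/((c%:A : A) *: (phi (F u) : weight_inj al)) linearZ coindE mulr_algr.
exact: coind_evZ.
Qed.
Definition copre_fun (F : co i) := projT1 (cid (copre_ex F)).
Lemma copre_subproof (F : co i) : (copre_fun F : A -> k^o) \in @coind_pred _ A.
Proof. by apply/asboolP => a x y; rewrite linearP. Qed.
Definition copre (F : co i) : J := Coind (copre_subproof F).

Lemma copreE (F : co i) x h b : x \in C -> h \in H -> b \in B ->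
  copre F (x * h * b) = iv (phi (F b)) (x * h).
Proof. exact: (projT2 (cid (copre_ex F))). Qed.

Lemma copre_eq (F : co i) f : (forall l m x h b, Cd l x -> h \in H -> Bd m b ->
  iv (phi (F b)) (x * h) = (f : J) (x * h * b)) -> copre F = f.
Proof.
move=> e; apply: coindP; apply: (tri_ind (T := T)) => [|x y|l m x h b xl hH bm].
- by rewrite !coind_ev0.
- by rewrite !coind_evD => -> ->.
by rewrite copreE ?(e l m) //; [exact: Cd_C xl|exact: Bd_B bm].
Qed.

Lemma copreD (F F' : co i) : copre (F + F') = copre F + copre F'.
Proof.
apply: copre_eq => l m x h b /Cd_C xC hH /Bd_B bB.
by rewrite coindD !copreE // -coindD -!linearD.
Qed.

Lemma copreB b (F : co i) : b \in B -> copre (b *: F) = b *: copre F.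
Proof.
move=> bB; apply: copre_eq => l m x h c /Cd_C xC hH /Bd_B cB.
by rewrite coindE -[x * h * c * b]mulrA copreE ?rpredM.
Qed.

Lemma copreH h (F : co i) : h \in H -> copre (h *: F) = h *: copre F.
Proof.
move=> hH; apply: copre_eq => l m x g b /Cd_C xC gH /Bd_B bB.
rewrite coindE -[x * g * b * h]mulrA nabE; have [s [sP ->]] := BH_HB bB hH.
rewrite mulr_sumr; elim: s sP => [|y s IH] sP.
  by rewrite !big_nil nab0 !linear0 coind_ev0.
have [u [c [uH cB ->]]] := sP y (mem_head _ _).
rewrite !big_cons nabD coind_evD !linearD coindD IH; last first.
  by move=> z zs; apply: sP; rewrite inE zs orbT.
congr (_ + _); rewrite mulrA -[x * g * u]mulrA copreE ?rpredM // mulrA.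
rewrite (nabH F (SubAlg uH)) linearZ.
by rewrite -[X in weight_inj_val _ _ _ X]/(u *: (phi (F c) : weight_inj al)) linearZ coindE.
Qed.

Lemma copre_kap e : copre (kap e) = weight_inj_val k_char0 HIrr al (phi e).
Proof.
apply: copre_eq => l [|m] x h b xl hH bm; rewrite kapE; last first.
  rewrite -[b in rhoH b]mul1r (rho_B _ bm) scale0r !linear0 coind_0 -coindE -linearZ.
  by rewrite (kphi e bm) linear0.
have [c ->] := Bd0_scalar bm.
have -> : rhoH (c%:A) *: e = (c%:A : HH) *: e by rewrite -(kapE e) -[c%:A]mul1r nab_k kapE rho1 scale1r.
rewrite linearZ -[X in weight_inj_val _ _ _ X]/((c%:A : A) *: (phi e : weight_inj al)) linearZ.
exact: coindE.
Qed.

Lemma copre_JC (F : co i) x : JC (lowb al) x -> copre F x = 0.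
Proof.
move=> [s [sP ->]]; rewrite big_seq.
elim/big_ind: _ => [|u v|_ /sP[y [a [m [lm ym ->]]]]]; first exact: coind_ev0.
  by rewrite coind_evD => -> ->; rewrite addr0.
move: a; apply: (tri_ind (T := T)) => [|u v|l n x' h b /Cd_C xC hH /Bd_B bB].
- by rewrite mulr0 coind_ev0.
- by rewrite mulrDr coind_evD => -> ->; rewrite addr0.
rewrite !mulrA copreE ?rpredM //; last exact: Cd_C ym.
by rewrite -mulrA iv_JC //; apply: JC_gen ym.
Qed.

Lemma iv_dN (f : weight_inj al) x : iv f (dN al * x) = 0.
Proof.
have /in_mksub[s [sP ->]] := incl_in f.
rewrite big_seq; elim/big_ind: _ => // [u v|g /sP[j gj]]; last exact: co_dN gj _.
by rewrite coindD => -> ->; rewrite addr0.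
Qed.

Lemma copre_supp (F : co i) (n : int) l x :
  hgr n F -> x \in G l -> copre F x <> 0 -> - cI i + zk n = al + zk (- l).
Proof.
move=> Fn xl Fx; apply: contrapT => ne; apply: Fx; rewrite -(hc_id xl) {xl}.
move: x; apply: (tri_ind (T := T)) => [|u v|p m x h b xp hH bm].
- by rewrite linear0 coind_ev0.
- by rewrite linearD coind_evD => -> ->; rewrite addr0.
have g := tri_gr xp hH bm; have [e|ne'] := eqVneq l (p%:Z - m%:Z); last first.
  by rewrite (hc_neq g ne') coind_ev0.
rewrite e hc_id // copreE //; [|exact: Cd_C xp|exact: Bd_B bm].
have [nm|ne'] := eqVneq (n - m%:Z) 0; last first.
  by rewrite (homgr_deg Fn (Bd_G bm) ne') !linear0 coind_0.
have [_ gI] := weight_inj_graded k_char0 HIrr al.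
have [->|[j ej pj]] := gI _ _ (killed_gw k_char0 HIrr (kphi (F b))).
  by rewrite linear0 coind_0.
have [jp|ne'] := eqVneq (j + p%:Z) 0; last first.
  by apply: (co_deg pj _ ne'); apply: (grM (Cd_G xp) (Hgr hH)); rewrite addr0.
case: ne; rewrite ej e -addrA -rmorphD; congr (al + zk _).
have -> : n = m%:Z by apply/eqP; rewrite -subr_eq0 nm.
have -> : j = - p%:Z by apply/eqP; rewrite -addr_eq0 jp.
by rewrite opprB addrC.
Qed.

Lemma pd_JC p n x : JC n x -> JC n (pd p * x).
Proof.
move=> [s [sP ->]]; rewrite mulr_sumr big_seq.
elim/big_ind: _ => [|u v|_ /sP[y [a [m [lm ym ->]]]]]; [exact: JC0|exact: fin_sumD|].
have -> : p = shiftp m%:Z (p \Po ('X + (zk m%:Z)%:P)).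
  rewrite /shiftp -comp_polyA comp_polyD comp_polyX comp_polyC subrK comp_polyXr.
  by [].
by rewrite mulrA (pd_shift _ (Cd_G ym)) -mulrA; apply: JC_gen ym.
Qed.

(** As in [weight_proj_relfree], the functional [copre F] is corrected by a
    polynomial in [del], here on the left of the argument. *)
Lemma weight_inj_cofree : exists psi : co i -> weight_inj al, bmap psi /\ forall e, psi (kap e) = phi e.
Proof.
set N0 := nilN k_char0 HIrr al; set R := nilR k_char0 HIrr al.
have : coprimep (('X - al%:P) ^+ N0) R.
  by rewrite coprimep_expl // coprimep_sym coprimep_XsubC; apply: nilR_neq0.
move=> /Bezout_eq1_coprimepP[[u v] /= uv]; 
(* as in [weight_proj_relfree] *)
pose e := v * R.
have psP (F : co i) : (fun x => copre F (pd e * x)) \in @coind_pred _ A.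
  by apply/asboolP => a x y; rewrite mulrDr -scalerAr coind_lin.
pose ps F : J := Coind (psP F).
have psE F x : ps F x = copre F (pd e * x) by [].
have psD F F' : ps (F + F') = ps F + ps F'.
  by apply: coindP => x; rewrite coindD !psE copreD.
have psJC F x : JC (lowb al) x -> ps F x = 0 by move=> Jx; rewrite psE copre_JC //; apply: pd_JC.
have psdN F x : ps F (dN al * x) = 0.
  rewrite psE (_ : pd e * _ = pd (R * ('X - al%:P) ^+ N0) * (pd v * x)).
    by apply/copre_JC/JC_mulr/nilRN_C.
  by rewrite !mulrA -!pdM; congr (pd _ * x); rewrite /e -mulrA mulrC.
have ps_supp (F : co i) (n : int) l x : hgr n F -> x \in G l -> ps F x <> 0 ->
    - cI i + zk n = al + zk (- l).
  by move=> Fn xl; apply: copre_supp Fn _; apply: (grM (pd_gr0 T e) xl); rewrite add0r.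
have coP be (F : co i) : gw be F -> exists2 j, cohom k_char0 HIrr al j (ps F) & ps F = 0 \/ be = al + zk j.
  have ps0 : ps 0 = 0 by apply: (addrI (ps 0)); rewrite -psD !addr0.
  move=> gF; have [->|[n [en Fn]]] := nab_gw k_char0 (cE (i := i)) gF.
    by exists 0; [rewrite ps0; apply: cohom0|left].
  have [[j ej]|no] := EM (exists j, be = al + zk j).
    exists j; last by right.
    split=> [l x xl ne|x|x]; [|exact: psJC|exact: psdN].
    apply: contrapT => Fx; case/eqP: ne; have := ps_supp _ _ _ _ Fn xl Fx.
    by rewrite -en ej => /addrI/(zk_inj k_char0)->; rewrite addNr.
  suff F0 : ps F = 0 by exists 0; [rewrite F0; apply: cohom0|left].
  apply: coindP; apply: (gr_ind (T := T)) => [|x y|l x xl]; first exact: coind_ev0.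
    by rewrite !coind_evD => -> ->.
  apply: contrapT => Fx; apply: no; exists (- l); rewrite en.
  exact: ps_supp Fn xl Fx.
have psN F : ps F \in weight_injN k_char0 HIrr al.
  move: F; apply: (wt_ind (O_wt (co_O k_char0 HIrr i))) => [|F F' xF xF'|be F gF].
  - by rewrite (_ : ps 0 = 0) ?rpred0 //; apply: (addrI (ps 0)); rewrite -psD !addr0.
  - by rewrite psD rpredD.
  by have [j cj _] := coP _ _ gF; apply/in_mksub/fin_sum1; exists j.
pose psi F : weight_inj al := SubMod (psN F).
have psiE F : weight_inj_val k_char0 HIrr al (psi F) = ps F by [].
exists psi; split.
  split=> [F F'|b F bB|h F hH|be F gF].
  - by apply: (@weight_inj_val_inj _ _ _ k_char0 _ _ T _ _ HIrr); rewrite linearD !psiE.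
  - apply: (@weight_inj_val_inj _ _ _ k_char0 _ _ T _ _ HIrr); rewrite linearZ !psiE.
    by apply: coindP => x; rewrite coindE !psE copreB // coindE mulrA.
  - apply: (@weight_inj_val_inj _ _ _ k_char0 _ _ T _ _ HIrr); rewrite linearZ !psiE.
    by apply: coindP => x; rewrite coindE !psE copreH // coindE mulrA.
  apply: (gw_inj (@weight_inj_val_inj _ _ _ k_char0 _ _ T _ _ HIrr al)); rewrite psiE.
  have [j cj [->|->]] := coP _ _ gF; [exact: gw0|exact: cohom_gw cj].
move=> e'; apply: (@weight_inj_val_inj _ _ _ k_char0 _ _ T _ _ HIrr); rewrite psiE.
apply: coindP => x; rewrite psE copre_kap.
have -> : pd e = 1 - dN al * pd u.
  apply/eqP; rewrite eq_sym subr_eq -pdM -pdD [_ * u]mulrC.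
  by rewrite addrC uv pd1.
by rewrite mulrBl mul1r -mulrA -[X in X = _]addr0 -{1}(iv_dN (phi e') (pd u * x)) -coind_evD subrK.
Qed.
End RelcofreeWeightInj.

Lemma weight_inj_relcofree al : relcofree (weight_inj al).
Proof. by move=> i phi kp; apply: weight_inj_cofree. Qed.

(** The socle of a costandard object over [B] is its generating space, so an
    endomorphism that fixes it is injective, hence bijective on the
    finite-dimensional weight spaces. *)
Lemma nab_endo i (c : co i -> co i) : bmap c -> (forall e, c (kap e) = kap e) ->
  exists c', bmap c' /\ forall F, c (c' F) = F.
Proof.
move=> cb ck; have OC := co_O k_char0 HIrr i; have wC := O_wt OC.
have c0 F : c F = 0 -> F = 0.
  move=> cF; apply: contrapT => F0.
  have [m [b [bm bF0 kb]]] := exists_killed (O_nil OC) F0; apply: bF0.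
  have e : b *: F = kap (ev1 (b *: F)) := nab_killed kb.
  by rewrite e -ck -e (eqmS cb) ?cF ?scaler0 //; apply: Bd_B bm.
have ci : injective c.
  by move=> x y xy; apply/eqP; rewrite -subr_eq0; apply/eqP/c0; rewrite (eqmapB _ _ cb) xy subrr.
have cs al G : gw al G -> exists2 F, gw al F & c F = G.
  move=> gG.
  have Ws : subm (fun x : hmod (co i) => gw al (x : co i)).
    split=> [|h x y gx gy]; first exact: gw0.
    by apply: gwD => //; apply/gw_scale0 => //; apply/Hgr/valP.
  have cl : linear (c : hmod (co i) -> hmod (co i)).
    by move=> h x y; rewrite [LHS](eqmD cb) (eqmH cb) //; apply: valP.
  have [x|w wE] := corestrict (f := mklin cl \o incl (mksub Ws)) (N := mksub Ws).
    by apply/in_mksub/(eqmW cb); have /in_mksub := incl_in x.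
  have aW : artin (sub_mod (mksub Ws)).
    apply: (@artin_spanned k HH); apply: fd_spanned.
    apply: (@fd_inj k (kmod (sub_mod (mksub Ws))) (kmod (co i)) (fun _ => True) _
      (fun x => incl (mksub Ws) x : kmod (co i)) _ (O_fd al OC)) => // [x _ x0|x _].
      exact: (inj_linear0 (@incl_inj _ _ (mksub Ws))).
    by have /in_mksub := incl_in x.
  have wi : injective w.
    by move=> x y xy; apply: (@incl_inj _ _ (mksub Ws)); apply: ci; rewrite -[LHS]wE xy wE.
  have [G' G'E] := in_incl ((in_mksub Ws G).2 gG).
  have [F FE] := artin_inj_surj aW wi G'.
  exists (incl (mksub Ws) F); first by have /in_mksub := incl_in F.
  by rewrite -[LHS](wE F) FE G'E.
have cS G : exists F, c F = G.
  move: G; apply: (wt_ind wC) => [|x y [x' <-] [y' <-]|al G /cs[F _ FE]]; last by exists F.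
    by exists 0; apply: eqmap0 cb.
  by exists (x' + y'); rewrite (eqmD cb).
have [c' c'E] := choice cS; exists c'; split=> //.
split=> [x y|b x bB|h x hH|al x gx]; try apply: ci.
- by rewrite (eqmD cb) !c'E.
- by rewrite (eqmS cb) // !c'E.
- by rewrite (eqmH cb) // !c'E.
have [F gF cF] := cs _ _ gx; suff -> : c' x = F by [].
by apply: ci; rewrite c'E.
Qed.

Lemma relcofree_split M i (phi : {linear Irr i -> hmod M}) (g : {linear M -> co i}) :
    relcofree M -> (forall e, killed (phi e : M)) -> (forall e, g (phi e) = kap e) ->
  exists psi : co i -> M, bmap psi /\ forall F, g (psi F) = F.
Proof.
move=> cM kp gp; have [ps [pb pE]] := cM i phi kp.
have [|c [cb cE']] := nab_endo (eqmap_comp pb (eqmap_lin T B g)).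
  by move=> e /=; rewrite pE.
by exists (ps \o c); split; first exact: eqmap_comp cb pb.
Qed.

(** Dually to [relfree_coker], subtracting [psi g] moves the values of an
    extension into the kernel of [g]. *)
Lemma relcofree_ker M N i (g : {linear M -> co i}) (psi : co i -> M) (u : {linear N -> M}) :
    relcofree M -> bmap psi -> (forall F, g (psi F) = F) -> injective u ->
    (forall x, g x = 0 <-> exists y, u y = x) -> relcofree N.
Proof.
move=> cM pb gp ui ug j phi kp.
have gu y : g (u y) = 0 by apply/ug; exists y.
have hl : linear (fun e => u (phi e) : hmod M) by move=> h x y; rewrite !linearP.
have [|ps [sb sE]] := cM j (mklin hl); first by move=> e; apply: killed_lin (kp e).
pose f F := ps F - psi (g (ps F)).
have fb : bmap f.
  have tb := eqmap_comp (eqmap_comp sb (eqmap_lin T B g)) pb.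
  split=> [x y|b x bB|h x hH|al x gx]; rewrite /f.
  - by have /= -> := eqmD tb x y; rewrite (eqmD sb) opprD addrACA.
  - by have /= -> := eqmS tb x bB; rewrite (eqmS sb) // scalerBr.
  - by have /= -> := eqmH tb x hH; rewrite (eqmH sb) // scalerBr.
  by apply: gwD; [apply: (eqmW sb)|apply/gwN/(eqmW tb)].
have gf F : g (f F) = 0 by rewrite linearB gp subrr.
have /choice[f' f'E] F : exists y, u y = f F by apply/ug.
exists f'; split.
  split=> [x y|b x bB|h x hH|al x gx].
  - by apply: ui; rewrite linearD !f'E (eqmD fb).
  - by apply: ui; rewrite linearZ !f'E (eqmS fb).
  - by apply: ui; rewrite linearZ !f'E (eqmH fb).
  by apply: (gw_inj ui); rewrite f'E; apply: (eqmW fb).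
by move=> e; apply: ui; rewrite f'E /f sE /= gu (eqmap0 pb) subr0.
Qed.
End InjectiveHulls.

(** * Costandard filtrations and injective hulls *)

Section CostandardFiltrations.
Variables (k0 : closedFieldType) (k : fieldType) (sigma : {rmorphism k0 -> k}).
Hypothesis k_char0 : [pchar k] =i pred0.
Variables (A : algType k) (H0 : falgType k0) (T : triangular_algebra sigma A H0).
Local Notation B := (Bm T).
Local Notation H := (Hs T).
Hint Resolve Cd_C Bd_B Cd_G Bd_G : core.
Local Notation gw := (gen_weight T).
Local Notation zk := (@zk k).
Local Notation hmod M := (hmod_of (Hs T) M).
Local Notation O := (category_O T).
Local Notation killed := (@killed _ _ _ _ _ T _).
Local Notation bmap := (eqmap T (Bm T)).
Implicit Types M N : lmodType A.
Variables (I : Type) (Irr : I -> lmodType (sub_alg (Hs T))).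
Hypothesis HIrr : simple_representatives (fun _ => True) Irr.
Local Notation cI := (cI Irr).
Local Notation co i := (@costandard _ _ _ _ _ T (Irr i)).
Local Notation lt := (irr_lt Irr).
Local Notation Lm := (Lm Irr).
Local Notation Lp i := (Lp Irr i).
Local Notation weight_inj := (weight_inj k_char0 HIrr).
Local Notation relcofree := (relcofree Irr).

Lemma socle_uniq a b (g : {linear Lm a -> co b}) : injective g -> a = b.
Proof.
move=> gi; have [_ [f fi fu]] := co_socle k_char0 HIrr b.
have gf := fu _ g (Lm_simple k_char0 HIrr a) gi.
have [|h hE] := factor_inj (f := g) fi; first by move=> z; apply/gf; exists z.
apply: (Lm_inj k_char0 HIrr); exists h; apply: inj_surj_bij.
  by move=> x y xy; apply: gi; rewrite -!hE xy.
move=> y; have [x xE] : exists x, g x = f y by apply/gf; exists y.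
by exists x; apply: fi; rewrite hE.
Qed.

(** For [S] simple and [u] injective, [M] is then an essential extension of
    [S]. *)
Definition essential S M (u : {linear S -> M}) :=
  forall (P : submodClosed M) x, x \in P -> x <> 0 -> forall y, u y \in P.

Section Peel.
Variables (M : lmodType A) (a : I) (u : {linear Lm a -> M}).
Hypotheses (OM : O M) (cM : relcofree M) (ui : injective u) (ue : essential u).

(** The lowest weight space carries a functional that retracts [phi], hence a
    map to a costandard object; relative cofreeness splits it over [B H]. *)
Lemma co_peel_map b (phi : {linear Irr b -> hmod M}) : lowest T M (- cI b) -> injective phi ->
    (forall e, killed (phi e : M)) ->
  exists (g : {linear M -> co b}) psi, [/\ forall e, g (phi e) = kap e, bmap psi & forall F, g (psi F) = F].
Proof.
move=> lM pi kp.
have [f [fb fE]] := lowest_functional k_char0 OM lM pi (fun e => killed_gw k_char0 HIrr (kp e)).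
have [g gE] := nab_hom k_char0 (O_wt OM) fb.
have gk e : g (phi e) = kap e by rewrite (nab_killed (killed_lin g (kp e))) gE fE.
by have [psi [pb pE]] := relcofree_split k_char0 HIrr cM kp gk; exists g, psi.
Qed.

Lemma co_peel_inj N (g : {linear M -> N}) y : g (u y) <> 0 -> injective g.
Proof.
move=> gy; apply: linear_inj => x gx; apply: contrapT => x0; apply: gy.
by have /in_mksub := ue ((in_mksub _ x).2 gx : x \in kerm g) x0 y.
Qed.

Lemma co_peel_top : lowest T M (- cI a) -> mod_iso M (co a).
Proof.
move=> lM; have pl : linear (fun e => u (Lp a (iot e)) : hmod M).
  by move=> h x y; rewrite iotD iotH !linearP.
pose phi := mklin pl.
have pi : injective phi.
  by apply: linear_inj => e /(inj_linear0 ui)/(Lp_iot0 k_char0 HIrr).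
have kp e : killed (phi e : M) by do 2!apply: killed_lin; apply: iot_killed.
have [g [psi [gp _ gpsi]]] := co_peel_map lM pi kp.
exists g; apply: inj_surj_bij; last by move=> F; exists (psi F).
have [e e0] := irr_neq0 HIrr a; apply: (@co_peel_inj _ _ (Lp a (iot e))).
by rewrite -[u _]/(phi e) gp => z; apply: e0; rewrite -(kap1 e) z; apply: nab00.
Qed.

(** If [g] did not vanish on the image of [u], it would be injective by
    essentiality, and [L(a)] would be the socle of [nabla(b)]. *)
Lemma co_peel_low n (v : M) : gw (- cI a - zk n.+1%:Z) v -> v <> 0 -> lowest T M (- cI a - zk n.+1%:Z) ->
  exists b (g : {linear M -> co b}) psi,
    [/\ lt a b, bmap psi, forall F, g (psi F) = F & forall y, g (u y) = 0].
Proof.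
move=> gv v0 lM; have kv := lowest_killed lM gv.
have [b [phi [pi pk pg be]]] := killed_gw_irr k_char0 HIrr kv gv v0; rewrite be in lM.
have [g [psi [gp pb gpsi]]] := co_peel_map lM pi pk.
have ab : lt a b by apply: (@lt_weight _ _ _ _ _ T _ Irr b a n); rewrite -be subrK.
exists b, g, psi; split=> // y; apply: contrapT => gy.
apply: (@lt_irr _ _ _ k_char0 _ _ T _ Irr a).
suff e : a = b by rewrite {2}e.
apply: (@socle_uniq a b (g \o u)) => x z /(co_peel_inj gy)/ui.
by [].
Qed.
End Peel.

(** Costandard quotients are split off from submodules of [M] until the weight
    of the socle is the lowest one; what remains is then [nabla(a)]. *)
Lemma costandard_filtration M a (u : {linear Lm a -> M}) (N : submodClosed M) :
    O M -> injective u -> essential u -> relcofree (sub_mod N) -> (forall y, u y \in N) ->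
  exists n (F : nat -> submodClosed M), [/\ F 0%N = zerom M, F n.+1 = N,
    subquotient (F 0%N) (F 1%N) (co a) &
    forall i, (0 < i < n.+1)%N -> exists2 b, lt a b & subquotient (F i) (F i.+1) (co b)].
Proof.
move=> OM ui ue; have [m [mu [mum mulin]]] := O_artin k_char0 HIrr OM.
elim: (mu N).+1 {-2}N (ltnSn (mu N)) => // l IH {}N; rewrite ltnS => ml cN uN.
have [u' u'E] := corestrict uN.
have u'i : injective u' by move=> x y xy; apply: ui; rewrite -!u'E xy.
have u'e : essential u'.
  move=> P x xP x0 y.
  have : u y \in imm (incl N) P.
    apply: (ue _ (incl N x)); first by apply/in_mksub; exists x.
    by move=> /(inj_linear0 (@incl_inj _ _ N)).
  by move=> /in_mksub[z zP]; rewrite -u'E => /(@incl_inj _ _ N) <-.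
have ON := O_sub N OM.
have [w0 w00 gw0] : exists2 w0 : sub_mod N, w0 <> 0 & gw (- cI a) w0.
  have [e e0] := irr_neq0 HIrr a; exists (u' (Lp a (iot e))); last first.
    by do 2!apply: gw_lin; apply: gw_st.
  by move=> /(inj_linear0 u'i)/(Lp_iot0 k_char0 HIrr).
have [[|n] [w [gw_w w_neq0 lN]]] := lowest_weight k_char0 HIrr ON gw0 w00.
  rewrite zkE subr0 in lN; have [f fb] := co_peel_top ON cN u'i u'e lN.
  exists 0%N, (fun i => if i is 0%N then zerom M else N); split=> // [|[|i]] //.
  split=> [x /in_mksub ->|]; first exact: rpred0.
  exists f; split=> [|y]; first exact: bij_surj.
  split=> [/(inj_linear0 (bij_inj fb)) ->|/in_mksub y0]; first exact/in_mksub.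
  by rewrite (_ : y = 0) ?linear0 //; apply: (@incl_inj _ _ N); rewrite linear0.
have [b [g [psi [ab pb gpsi gu]]]] := co_peel_low ON cN u'i u'e gw_w w_neq0 lN.
pose N' := imm (incl N) (kerm g).
have N'P y : incl N y \in N' <-> g y = 0.
  split=> [/in_mksub[z /in_mksub gz /(@incl_inj _ _ N) <-] //|gy].
  by apply/in_mksub; exists y => //; apply/in_mksub.
have sN : {subset N' <= N} by move=> _ /in_mksub[z _ <-]; apply: incl_in.
have sq : subquotient N' N (co b).
  by split=> //; exists g; split=> [F|y]; [exists (psi F)|split=> /N'P].
have lt_mu : (mu N' < mu N)%N.
  apply: mulin sN _; apply: (subquotient_strict sq).
  have [e e0] := irr_neq0 HIrr b; exists (kap e); apply/eqP => z; apply: e0.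
  by rewrite -(kap1 e) z; apply: nab00.
have [v vE] : exists v : {linear sub_mod N' -> sub_mod N}, forall x, incl N (v x) = incl N' x.
  by apply: corestrict => x; apply/sN/incl_in.
have [|||n' [F [F0 F1 F2 F3]]] := IH N'.
- exact: leq_trans lt_mu ml.
- apply: (relcofree_ker cN pb gpsi (u := v)).
    by move=> x y xy; apply: (@incl_inj _ _ N'); rewrite -!vE xy.
  move=> x; split=> [/N'P/in_incl[y yE]|[y <-]].
    by exists y; apply: (@incl_inj _ _ N); rewrite vE yE.
  by apply/N'P; rewrite vE; apply: incl_in.
- by move=> y; rewrite -u'E; apply/N'P/gu.
exists n'.+1, (fun i => if (i <= n'.+1)%N then F i else N); split=> //.
  by rewrite ltnn.
move=> i /andP[i0]; rewrite ltnS => il1; have [->|ne] := eqVneq i n'.+1.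
  by rewrite leqnn ltnn F1; exists b.
have il : (i < n'.+1)%N by rewrite ltn_neqAle ne.
by rewrite il1 il; apply: F3; rewrite i0.
Qed.

(** The quotient of an injective object of [O] by a submodule maximal among
    those that miss a simple submodule is a direct summand. *)
Lemma exists_hull a : exists (X : lmodType A) (u : {linear Lm a -> X}),
  [/\ injective_in O X, injective u, essential u & relcofree X].
Proof.
pose al := - cI a; have OI := weight_inj_O k_char0 HIrr al; have OL := Lm_O k_char0 HIrr a.
have Ls := Lm_simple k_char0 HIrr a.
have [e e0] := irr_neq0 HIrr a.
have [|f fe] := weight_inj_nonzero k_char0 HIrr OL (gw_lin (Lp a) (gw_st k_char0 HIrr e)).
  by move=> /(Lp_iot0 k_char0 HIrr).
have fi := simple_inj Ls fe.
pose Q (N : submodClosed (weight_inj al)) := exists y, f y \notin N.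
have [|N [y0 y0N] Nmax] := artin_max (Q := Q) (N := zerom (weight_inj al)) (O_artin k_char0 HIrr OI).
  by exists (Lp a (iot e)); apply/negP => /in_mksub.
pose u := qpi N \o f : {linear Lm a -> quot_mod N}.
have ui : injective u.
  apply: (simple_inj Ls (x := y0)) => /qpi_eq0 fN; case/negP: y0N; exact: fN.
have ue : essential u.
  move=> P x xP x0 y; apply: contrapT => /negP uyP.
  have [x' x'E] := qpi_surj x.
  have s1 : {subset prem (qpi N) P <= N}.
    apply: Nmax; first by exists y; apply/negP => /in_mksub; apply/negP.
    by move=> z /qpi_eq0 z0; apply/in_mksub; rewrite z0 rpred0.
  apply: x0; rewrite -x'E; apply/qpi_eq0/s1/in_mksub.
  by rewrite x'E.
have OQ := O_quot N OI.
have [g gE] := (weight_inj_injective k_char0 HIrr al).2 _ _ u f OL OQ ui.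
pose v := qpi N \o g : {linear quot_mod N -> quot_mod N}.
have vi : injective v.
  apply: linear_inj => x vx; apply: contrapT => x0.
  have kx : x \in kerm v by apply/in_mksub.
  have /in_mksub := ue _ _ kx x0 y0; rewrite -[v _]/(qpi N (g (u y0))) gE.
  by move=> /qpi_eq0 fN; case/negP: y0N; exact: fN.
have [h [hK Kh]] := bij_inverse vi (artin_inj_surj (O_artin k_char0 HIrr OQ) vi).
pose r := h \o qpi N : {linear weight_inj al -> quot_mod N}.
have rE x : r (g x) = x by rewrite -[LHS]/(h (v x)) hK.
exists (quot_mod N), u; split=> //; last by apply: relcofree_retract rE _; apply: weight_inj_relcofree.
split=> // M X w q OM OX wi.
have [t tE] := (weight_inj_injective k_char0 HIrr al).2 _ _ w (g \o q) OM OX wi.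
by exists (r \o t) => x; rewrite -[LHS]/(r (t (w x))) tE; apply: rE.
Qed.

Theorem injective_hull_filtered a : exists2 X, injective_hull O (Lm a) X &
  exists n (F : nat -> submodClosed X),
    [/\ filtration n.+1 F, subquotient (F 0%N) (F 1%N) (co a) &
        forall i, (0 < i < n.+1)%N -> exists2 b, lt a b & subquotient (F i) (F i.+1) (co b)].
Proof.
have [X [u [Xi ui ue cX]]] := exists_hull a.
exists X.
  split=> //; exists u => // N g ON gui; apply: linear_inj => x gx; apply: contrapT => x0.
  have [e e0] := irr_neq0 HIrr a; apply: e0; apply: (Lp_iot0 k_char0 HIrr).
  have kx : x \in kerm g by apply/in_mksub.
  apply: gui; rewrite /= !linear0.
  by have /in_mksub := ue _ _ kx x0 (Lp a (iot e)).
have cF : relcofree (sub_mod (fullm X)).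
  have si : surj (incl (fullm X)) by move=> x; apply/in_incl/in_mksub.
  have [h [hK Kh]] := bij_inverse (@incl_inj _ _ (fullm X)) si.
  exact: relcofree_retract hK cX.
have [|n [F [F0 F1 F2 F3]]] := costandard_filtration Xi.1 ui ue cF.
  by move=> y; apply/in_mksub.
exists n, F; split=> //; split=> [x|x|[|i] il].
- by rewrite F0 => /in_mksub.
- by rewrite F1; apply/in_mksub.
- by case: F2.
by have [b _ []] := F3 i.+1 il.
Qed.

Lemma injective_prod (X Y : lmodType A) : injective_in O X -> injective_in O Y -> injective_in O (X * Y)%type.
Proof.
move=> [OX Xi] [OY Yi]; split=> [|M N u f OM ON ui]; first exact: O_prod.
have l1 : linear (fun m => (f m).1) by move=> c x y; rewrite linearP.
have l2 : linear (fun m => (f m).2) by move=> c x y; rewrite linearP.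
have [g gE] := Xi _ _ u (mklin l1) OM ON ui.
have [h hE] := Yi _ _ u (mklin l2) OM ON ui.
have gl : linear (fun n => (g n, h n)) by move=> c x y; rewrite !linearP.
by exists (mklin gl) => x; rewrite /= gE hE /=; case: (f x).
Qed.

(** A smallest kernel of a map to an injective object is 0, since
    [weight_inj_nonzero] provides a map that does not vanish on a given
    nonzero vector of lowest weight. *)
Theorem O_enough_injectives : enough_injectives O.
Proof.
move=> M OM.
pose Q (N : submodClosed M) := exists (X : lmodType A) (f : {linear M -> X}), injective_in O X /\
  forall x, x \in N <-> f x = 0.
have zl : linear (fun _ : M => 0 : weight_inj 0) by move=> c x y; rewrite scaler0 addr0.
have [|N [X [f [Xi fN]]] Nmin] := artin_min (Q := Q) (N := fullm M) (O_artin k_char0 HIrr OM).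
  (* the zero map, to any injective object *)
  exists (weight_inj 0), (mklin zl); split=> [|x]; first exact: weight_inj_injective.
  by split=> // _; apply/in_mksub.
exists X => //; exists f; apply: linear_inj => x /fN xN; apply: contrapT => x0.
have [i [y [yN y0 gy]]] := O_lowest k_char0 HIrr OM xN x0.
have [g gy0] := weight_inj_nonzero k_char0 HIrr OM gy y0.
have hl : linear (fun m => (f m, g m)) by move=> c u v; rewrite !linearP.
have /(_ y yN)/in_mksub gy1 : {subset N <= kerm (mklin hl)}.
  apply: Nmin => [|z /in_mksub[fz _]]; last exact/fN.
  exists (X * weight_inj (- cI i))%type, (mklin hl); split=> [|z]; last exact: in_mksub.
  by apply: injective_prod => //; apply: weight_inj_injective.
by case: gy1.
Qed.
End CostandardFiltrations.

Theorem theorem2p19 (k0 : closedFieldType) (k : fieldType)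
    (sigma : {rmorphism k0 -> k}) (k_char0 : [pchar k] =i pred0)
    (A : algType k) (H0 : falgType k0) (T : triangular_algebra sigma A H0)
    (I : Type) (Irr : I -> lmodType (sub_alg (Hs T)))
    (HIrr : simple_representatives (fun _ => True) Irr) :
  exists L : I -> lmodType A,
    highest_weight_category (category_O T) (irr_lt Irr) L
      (fun E => standard (Irr E)) (fun E => costandard (Irr E)).
Proof.
exists (Lm Irr); split.
- exact: O_abelian.
- exact: (O_locally_artinian k_char0 HIrr).
- exact: (O_enough_injectives k_char0 HIrr).
- by move=> a; apply: (lt_irr k_char0).
- exact: lt_trans.
- by move=> a b; apply: (finite_I HIrr).
- exact: (Lm_reps k_char0 HIrr).
- exact: (st_O k_char0 HIrr).
- exact: (co_O k_char0 HIrr).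
- exact: (st_head k_char0 HIrr).
- exact: (co_socle k_char0 HIrr).
- exact: (co_factors k_char0).
- exact: (co_mult k_char0 HIrr).
- by move=> a b; apply: (co_hom k_char0 HIrr); apply: (co_O k_char0 HIrr).
- exact: (injective_hull_filtered k_char0 HIrr).
- exact: (projective_cover_filtered k_char0 HIrr).
Qed.
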